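(* Let $n\ge 2$ and $N\ge 2$ be integers and let $\nu\in\{1,2,\ldots,n-1\}$. For $r\in\mathbb{N}$, $r\geq 1$, put $$\mathscr{H}_{2r-1}(\nu/n)=\left.\frac{d^{2r-1}}{d\varphi^{2r-1}}\cot\varphi\,\right|_{\varphi=\pi\nu/n}.$$ Then there exists $\lambda\in(0,1)$ (which may depend on $n,\nu,N$) such that $$\sum_{l=1}^{n-1}\cos\frac{2\pi\nu l}{n}\cdot\csc\frac{\pi l}{n}=-\frac{2n}{\pi}\ln\!\left(2\sin\frac{\pi\nu}{n}\right)+2\sum_{r=1}^{N-1}\frac{(1-2^{1-2r})\pi^{2r-1}B_{2r}}{(2r)!\,n^{2r-1}}\,\mathscr{H}_{2r-1}(\nu/n)+2\lambda\frac{(1-2^{1-2N})\pi^{2N-1}B_{2N}}{(2N)!\,n^{2N-1}}\,\mathscr{H}_{2N-1}(\nu/n).$$ Moreover, for every $r\ge 1$, $$\mathscr{H}_{2r-1}(\nu/n)=-\frac{1}{\pi^{2r}}\left\{\Psi_{2r-1}\!\left(\frac{\nu}{n}\right)+\Psi_{2r-1}\!\left(1-\frac{\nu}{n}\right)\right\}=(-1)^r\frac{(2n)^{2r-1}}{r}\sum_{s=1}^{n}B_{2r}\!\left(\frac sn\right)\cos\frac{2\pi s\nu}{n},$$ and $\mathscr{H}_{2r-1}(\nu/n)<0$.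
   Context: $B_m(x)$ are the Bernoulli polynomials, defined by $\frac{z e^{xz}}{e^z-1}=\sum_{m\ge0}\frac{B_m(x)}{m!}z^m$ for $|z|<2\pi$, and $B_m=B_m(0)$ are the Bernoulli numbers ($B_2=1/6$, $B_4=-1/30$, etc.). $\Psi=\Gamma'/\Gamma$ is the digamma function and $\Psi_m=\Psi^{(m)}$ its $m$-th derivative (polygamma function of order $m$). *)

(* Defs.v *)
(* Stdlib reals with Coquelicot. *)
From Stdlib Require Export Arith Factorial Reals.
From Coquelicot Require Export Coquelicot.
Open Scope R_scope.

Definition cot (x : R) : R := cos x / sin x.

Definition csc (x : R) : R := / sin x.

(* [B m x] is the value B_m(x).  The generating function has a removable
   singularity at z = 0, where the formula below would read 0 / 0; the identity
   on the punctured interval already determines every coefficient, and so it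
   characterizes B.  The same identity for complex z implies the one below. *)
Definition bernoulli_polynomials (B : nat -> R -> R) : Prop :=
  forall x z : R, z <> 0 -> Rabs z < 2 * PI ->
    is_pseries (fun m => B m x / INR (fact m)) z (z * exp (x * z) / (exp z - 1)).

(* Euler's integral; meaningful for x > 0 only. *)
Definition Gamma (x : R) : R :=
  RInt_gen (fun t => Rpower t (x - 1) * exp (- t))
           (at_right 0) (Rbar_locally p_infty).

Definition digamma (x : R) : R := Derive Gamma x / Gamma x.

Definition polygamma (m : nat) (x : R) : R := Derive_n digamma m x.

(* The derivative is taken with respect to the argument of cot and then
   evaluated at PI * x, so no power of PI comes out of the chain rule. *)
Definition scrH (m : nat) (x : R) : R := Derive_n cot m (PI * x).

(* Main.v *)
(* Put a = nu/n and let S be the sum of the theorem.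

   Polygamma and cotangent.  The tangent to t^u gives Gamma(s+u) <= s^u Gamma(s)
   for 0 <= u <= 1, hence Euler's limit formula for ln Gamma on (0, 1).  As the
   second derivatives of the approximants are locally bounded, the formula may be
   differentiated at will.  Herglotz's trick gives
   Psi'(x) + Psi'(1-x) = (PI / sin (PI x))^2; integrating twice gives the partial
   fractions of cot and the sine product.

   Bernoulli numbers.  The even part of the generating function reads
   sum_k B_2k(x) z^2k / (2k)! * sinh(z/2)/(z/2) = cosh((x-1/2)z).  Being an identity
   between coefficients it persists when z^2 is replaced by -z^2; summing it
   against cos(2 PI s nu / n) leaves (z/4)(cot(PI a + z/2n) - cot(PI a - z/2n)),
   whose Taylor coefficients are the H_{2r-1}.

   Remainder.  Let w(m) be the number of y in (0, m] congruent to nu, plus the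
   number of those congruent to -nu, mod n.  The function (2m+1)/n - w(m) is
   periodic, and its discrete Fourier expansion yields
   S = -(2n/PI) sum_m ((2m+1)/n - w(m)) / (m+1/2).  So the remainder after the
   terms r < N is (2n/PI) sum_m w(m) D_N(m), where D_N(m) is the error of the midpoint
   Euler-Maclaurin formula for 1/t on [m, m+1].  In powers of 1/(m+1/2) all the nonzero
   coefficients of D_N have the sign (-1)^N.  Hence so does the remainder, and
   consecutive remainders having opposite signs is what 0 < lambda < 1 says. *)
Require Import Defs.
From Stdlib Require Import Arith Factorial Reals.
From Coquelicot Require Import Coquelicot.
From Stdlib Require Import Lra Lia Psatz Classical_Prop.
Open Scope R_scope.

(** * Finite sums and limits of derivatives *)

(** S is a sum over the points m + 1/2, hence the midpoint formula: its weights involve B_2r(1/2) =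
    -(1 - 2^(1-2r)) B_2r, which produces the factors of the theorem. The interval [0, 1], where 1/t
    is singular, is harmless because w(0) = 0. The sign of D_N is settled coefficient by
    coefficient. Up to positive factors these are the coefficients of 1 minus sinh(z/2)/(z/2) times
    a truncation of its reciprocal. In the surviving convolutions the signs alternate and the moduli
    increase: |B_2r(1/2)|/(2r)! drops by less than a factor 80 per step, while the coefficients of
    sinh(z/2)/(z/2) drop by at least 80, except at their very first step (24), which never occurs
    there. The bound on B_2r(1/2) comes from the Bernoulli formula itself at n = 2, nu = 1, where H
    is essentially a sum of inverse powers of half-integers. Gamma(1/2) is never evaluated. The sine
    product is normalized at 1/2, and its behaviour there follows from comparing K! with (2K)!, in
    which Stirling's constant cancels. *)

Fixpoint psum (f : nat -> R) (n : nat) : R :=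
  match n with O => 0 | S m => psum f m + f m end.

Lemma psum_ext (f g : nat -> R) (n : nat) :
  (forall i, (i < n)%nat -> f i = g i) -> psum f n = psum g n.
Proof.
induction n as [|n IH]; simpl; intros H; auto.
rewrite IH, (H n); auto.
Qed.

Lemma psum_plus (f g : nat -> R) (n : nat) :
  psum (fun i => f i + g i) n = psum f n + psum g n.
Proof. induction n as [|n IH]; simpl; [|rewrite IH]; ring. Qed.

Lemma psum_minus (f g : nat -> R) (n : nat) :
  psum (fun i => f i - g i) n = psum f n - psum g n.
Proof. induction n as [|n IH]; simpl; [|rewrite IH]; ring. Qed.

Lemma psum_scal (c : R) (f : nat -> R) (n : nat) :
  psum (fun i => c * f i) n = c * psum f n.
Proof. induction n as [|n IH]; simpl; [|rewrite IH]; ring. Qed.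

Lemma psum_const (c : R) (n : nat) : psum (fun _ => c) n = INR n * c.
Proof. induction n as [|n IH]; [simpl; ring|]. rewrite S_INR; simpl; rewrite IH; ring. Qed.

Lemma psum_swap (f : nat -> nat -> R) (n m : nat) :
  psum (fun i => psum (f i) m) n = psum (fun j => psum (fun i => f i j) n) m.
Proof.
induction n as [|n IH]; simpl.
- rewrite psum_const; ring.
- rewrite psum_plus, IH; reflexivity.
Qed.

Lemma psum_le (f g : nat -> R) (n : nat) :
  (forall i, (i < n)%nat -> f i <= g i) -> psum f n <= psum g n.
Proof.
induction n as [|n IH]; simpl; intros H; [lra|].
assert (psum f n <= psum g n) by auto.
assert (f n <= g n) by auto. lra.
Qed.

Lemma psum_nonneg (f : nat -> R) (n : nat) :
  (forall i, (i < n)%nat -> 0 <= f i) -> 0 <= psum f n.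
Proof.
intros H. replace 0 with (psum (fun _ => 0) n) by (rewrite psum_const; ring).
now apply psum_le.
Qed.

Lemma psum_ge_term (f : nat -> R) (n j : nat) :
  (forall i, (i < n)%nat -> 0 <= f i) -> (j < n)%nat -> f j <= psum f n.
Proof.
induction n as [|n IH]; intros H Hj; [lia|]; simpl.
assert (0 <= f n) by auto.
assert (0 <= psum f n) by (apply psum_nonneg; auto).
destruct (Nat.eq_dec j n) as [->|Hn]; [lra|].
assert (f j <= psum f n) by (apply IH; auto; lia). lra.
Qed.

Lemma psum_telescope (g : nat -> R) (n : nat) :
  psum (fun i => g (S i) - g i) n = g n - g O.
Proof. induction n as [|n IH]; simpl; [|rewrite IH]; ring. Qed.

Lemma psum_head (f : nat -> R) (n : nat) :
  psum f (S n) = f O + psum (fun i => f (S i)) n.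
Proof.
induction n as [|n IH]; [simpl; ring|].
change (psum f (S (S n))) with (psum f (S n) + f (S n)). rewrite IH; simpl; ring.
Qed.

Lemma psum_rev (f : nat -> R) (n : nat) :
  psum (fun i => f (n - 1 - i)%nat) n = psum f n.
Proof.
induction n as [|n IH]; [reflexivity|].
rewrite psum_head. simpl (psum f (S n)). rewrite <- IH, Rplus_comm. f_equal.
- apply psum_ext; intros i Hi; f_equal; lia.
- f_equal; lia.
Qed.

Lemma psum_double (f : nat -> R) (n : nat) :
  psum (fun i => f (2 * i)%nat + f (2 * i + 1)%nat) n = psum f (2 * n).
Proof.
induction n as [|n IH]; [reflexivity|].
replace (2 * S n)%nat with (S (S (2 * n))) by lia.
cbn [psum]. rewrite IH.
replace (2 * n + 1)%nat with (S (2 * n)) by lia. ring.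
Qed.

Lemma psum_sum_n_m (f : nat -> R) (n : nat) :
  sum_n_m f 1 n = psum (fun i => f (S i)) n.
Proof.
induction n as [|n IH].
- rewrite sum_n_m_zero; [reflexivity|lia].
- rewrite sum_n_Sm by lia. rewrite IH. reflexivity.
Qed.

Lemma psum_sum_n (f : nat -> R) (n : nat) : sum_n f n = psum f (S n).
Proof.
induction n as [|n IH].
- rewrite sum_O. simpl; ring.
- rewrite sum_Sn, IH. reflexivity.
Qed.

Lemma is_series_psum (f : nat -> R) (l : R) :
  is_series f l <-> is_lim_seq (psum f) l.
Proof.
rewrite (is_lim_seq_incr_1 (psum f)).
split; intros H.
- apply is_lim_seq_ext with (u := sum_n f); [|exact H].
  intros n; apply psum_sum_n.
- apply (is_lim_seq_ext _ (sum_n f)) in H; [exact H|].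
  intros n; symmetry; apply psum_sum_n.
Qed.

Lemma is_lim_seq_psum (u : nat -> nat -> R) (l : nat -> R) (n : nat) :
  (forall i, (i < n)%nat -> is_lim_seq (u i) (l i)) ->
  is_lim_seq (fun K => psum (fun i => u i K) n) (psum l n).
Proof.
induction n as [|n IH]; simpl; intros H.
- apply is_lim_seq_const.
- apply is_lim_seq_plus'; auto.
Qed.

Lemma is_derive_psum (f df : nat -> R -> R) (n : nat) (x : R) :
  (forall i, (i < n)%nat -> is_derive (f i) x (df i x)) ->
  is_derive (fun y => psum (fun i => f i y) n) x (psum (fun i => df i x) n).
Proof.
induction n as [|n IH]; intros H; simpl.
- apply (is_derive_const (K := R_AbsRing) (V := R_NormedModule) 0).
- apply (is_derive_plus (fun y => psum (fun i => f i y) n) (f n)); auto.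
Qed.

Lemma is_lim_seq_inv_INR : is_lim_seq (fun n => / INR n) 0.
Proof.
replace (Finite 0) with (Rbar_inv p_infty) by reflexivity.
apply is_lim_seq_inv; [apply is_lim_seq_INR|discriminate].
Qed.

Lemma is_lim_seq_inv_INR_S : is_lim_seq (fun n => / INR (S n)) 0.
Proof. apply (is_lim_seq_incr_1 (fun n => / INR n)), is_lim_seq_inv_INR. Qed.

Lemma is_lim_seq_mul_subseq (u : nat -> R) (l : Rbar) (n : nat) :
  (1 <= n)%nat -> is_lim_seq u l -> is_lim_seq (fun K => u (K * n)%nat) l.
Proof.
intros Hn Hu. apply (is_lim_seq_subseq u l (fun K => (K * n)%nat)); [|exact Hu].
apply eventually_subseq. intros K; nia.
Qed.

Lemma is_lim_seq_squeeze0 (u v : nat -> R) (l : R) :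
  (forall n, Rabs (u n - l) <= v n) -> is_lim_seq v 0 -> is_lim_seq u l.
Proof.
intros H Hv.
apply is_lim_seq_le_le with (u := fun n => l - v n) (w := fun n => l + v n).
- intros n; specialize (H n); apply Rabs_le_between in H; lra.
- replace (Finite l) with (Finite (l - 0)) by (f_equal; ring).
  apply is_lim_seq_minus'; [apply is_lim_seq_const|exact Hv].
- replace (Finite l) with (Finite (l + 0)) by (f_equal; ring).
  apply is_lim_seq_plus'; [apply is_lim_seq_const|exact Hv].
Qed.

Lemma is_lim_seq_finite_unique (u : nat -> R) (l1 l2 : R) :
  is_lim_seq u l1 -> is_lim_seq u l2 -> l1 = l2.
Proof.
intros H1 H2. apply is_lim_seq_unique in H1. apply is_lim_seq_unique in H2.
rewrite H1 in H2. now injection H2.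
Qed.

Lemma is_derive_eq (f : R -> R) (x l l' : R) : is_derive f x l -> l = l' -> is_derive f x l'.
Proof. now intros H <-. Qed.

Lemma locally_Ioo (a b x : R) (P : R -> Prop) :
  a < x < b -> (forall y, a < y < b -> P y) -> locally x P.
Proof.
intros Hx HP.
assert (He : 0 < Rmin (x - a) (b - x)) by (apply Rmin_pos; lra).
exists (mkposreal _ He). intros y Hy.
apply HP. unfold ball in Hy; simpl in Hy; unfold AbsRing_ball in Hy; simpl in Hy.
unfold abs, minus, plus, opp in Hy; simpl in Hy.
apply Rabs_lt_between in Hy.
pose proof (Rmin_l (x - a) (b - x)); pose proof (Rmin_r (x - a) (b - x)). lra.
Qed.

(** The bound on the distance from [c] to [x] allows a second application, between [x] and [c], in
    [taylor1_bound]. *)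
Lemma mean_value (f df : R -> R) (a b x y : R) :
  (forall z, a < z < b -> is_derive f z (df z)) -> a < x < b -> a < y < b ->
  exists c, a < c < b /\ Rabs (c - x) <= Rabs (y - x) /\ f y - f x = df c * (y - x).
Proof.
intros Hf Hx Hy.
destruct (MVT_gen f x y df) as [c [Hc1 Hc2]].
- intros z Hz. apply Hf.
  pose proof (Rmin_Rgt_l x y a); pose proof (Rmax_Rlt x y b).
  revert Hz; unfold Rmin, Rmax; destruct (Rle_dec x y); lra.
- intros z Hz. apply continuity_pt_filterlim.
  apply (ex_derive_continuous f). exists (df z). apply Hf.
  revert Hz; unfold Rmin, Rmax; destruct (Rle_dec x y); lra.
- exists c. repeat split; auto; revert Hc1; unfold Rmin, Rmax; destruct (Rle_dec x y); intros;
    try lra; unfold Rabs; repeat destruct Rcase_abs; lra.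
Qed.

Lemma derive_zero_const (f : R -> R) (a b x y : R) :
  (forall z, a < z < b -> is_derive f z 0) -> a < x < b -> a < y < b -> f x = f y.
Proof.
intros Hf Hx Hy. destruct (mean_value f (fun _ => 0) a b x y Hf Hx Hy) as [c [_ [_ H]]]. lra.
Qed.

(** Two uses of the mean value theorem lose the factor 1/2 of Taylor's formula, which is harmless
    here. *)
Lemma taylor1_bound (f f1 f2 : R -> R) (a b M x y : R) :
  (forall z, a < z < b -> is_derive f z (f1 z)) ->
  (forall z, a < z < b -> is_derive f1 z (f2 z)) ->
  (forall z, a < z < b -> Rabs (f2 z) <= M) ->
  a < x < b -> a < y < b ->
  Rabs (f y - f x - (y - x) * f1 x) <= M * (y - x) ^ 2.
Proof.
intros H1 H2 HM Hx Hy.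
destruct (mean_value f f1 a b x y H1 Hx Hy) as [c [Hc [Hcx Hf]]].
destruct (mean_value f1 f2 a b x c H2 Hx Hc) as [d [Hd [_ Hf1]]].
replace (f y - f x - (y - x) * f1 x) with (f2 d * (c - x) * (y - x)) by (rewrite <- Hf1; lra).
rewrite !Rabs_mult, Rmult_assoc, <- Rsqr_pow2, Rsqr_abs. unfold Rsqr.
apply Rmult_le_compat; auto using Rabs_pos.
- apply Rmult_le_pos; apply Rabs_pos.
- apply Rmult_le_compat_r; auto using Rabs_pos.
Qed.

(* A uniform bound on the second derivatives makes the first derivatives of a
   pointwise convergent sequence converge as well. *)
Lemma limit_derive (f f1 f2 : nat -> R -> R) (F : R -> R) (a b M x : R) :
  (forall K z, a < z < b -> is_derive (f K) z (f1 K z)) ->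
  (forall K z, a < z < b -> is_derive (f1 K) z (f2 K z)) ->
  (forall K z, a < z < b -> Rabs (f2 K z) <= M) ->
  (forall z, a < z < b -> is_lim_seq (fun K => f K z) (F z)) ->
  a < x < b ->
  ex_derive F x /\ is_lim_seq (fun K => f1 K x) (Derive F x).
Proof.
intros H1 H2 HM HF Hx.
assert (HM0 : 0 <= M) by (apply Rle_trans with (2 := HM O x Hx); apply Rabs_pos).
assert (HT : forall K y, a < y < b ->
   Rabs (f K y - f K x - (y - x) * f1 K x) <= M * (y - x) ^ 2).
{ intros K y Hy. apply (taylor1_bound (f K) (f1 K) (f2 K) a b); auto. }
assert (Hl : ex_finite_lim_seq (fun K => f1 K x)).
{ apply ex_lim_seq_cauchy_corr. intros eps.
  (* The difference quotient over a fixed step [h] converges with [f] and stays within [M * h] of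
     [f1 K x]. With this [h] the deviations for [K] and [L] cost at most [eps / 4] each, and the
     Cauchy property of the quotients covers the other half. *)
  set (h := Rmin ((b - x) / 2) (eps / (4 * (M + 1)))).
  assert (Hh : 0 < h).
  { apply Rmin_pos; [lra|]. apply Rdiv_lt_0_compat; [apply eps|lra]. }
  assert (Hh1 : h <= (b - x) / 2) by apply Rmin_l.
  assert (Hh2 : h * (4 * (M + 1)) <= eps).
  { replace (pos eps) with (eps / (4 * (M + 1)) * (4 * (M + 1))) by (field; lra).
    apply Rmult_le_compat_r; [lra|apply Rmin_r]. }
  assert (Hy : a < x + h < b) by lra.
  assert (Hc : ex_lim_seq_cauchy (fun K => f K (x + h) - f K x)).
  { apply ex_lim_seq_cauchy_corr. exists (F (x + h) - F x).
    apply is_lim_seq_minus'; auto. }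
  assert (He : 0 < h * eps / 2).
  { pose proof (cond_pos eps). assert (0 < h * eps) by (apply Rmult_lt_0_compat; lra). lra. }
  destruct (Hc (mkposreal _ He)) as [K0 HK0]. exists K0. intros K L HK HL.
  specialize (HK0 K L HK HL). simpl in HK0.
  pose proof (HT K _ Hy) as TK. pose proof (HT L _ Hy) as TL.
  replace (x + h - x) with h in TK, TL by ring.
  apply Rabs_lt_between in HK0. apply Rabs_le_between in TK. apply Rabs_le_between in TL.
  apply Rmult_lt_reg_l with h; [exact Hh|].
  rewrite <- (Rabs_pos_eq h) at 1 by lra. rewrite <- Rabs_mult.
  apply Rabs_lt_between. nra. }
destruct Hl as [l Hl].
assert (HD : is_derive F x l).
{ apply is_derive_Reals. intros eps Heps.
  set (h := Rmin (Rmin (x - a) (b - x)) (eps / (M + 1))).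
  assert (Hh : 0 < h).
  { apply Rmin_pos; [apply Rmin_pos; lra|]. apply Rdiv_lt_0_compat; lra. }
  exists (mkposreal _ Hh). intros d Hd0 Hd. simpl in Hd.
  assert (Hd1 : Rabs d < x - a) by (eapply Rlt_le_trans; [exact Hd|]; unfold h; eapply Rle_trans; [apply Rmin_l|apply Rmin_l]).
  assert (Hd2 : Rabs d < b - x) by (eapply Rlt_le_trans; [exact Hd|]; unfold h; eapply Rle_trans; [apply Rmin_l|apply Rmin_r]).
  assert (Hd3 : Rabs d < eps / (M + 1)) by (eapply Rlt_le_trans; [exact Hd|]; apply Rmin_r).
  assert (Hy : a < x + d < b).
  { apply Rabs_lt_between in Hd1. apply Rabs_lt_between in Hd2. lra. }
  (* The Taylor bound is uniform in [K], so it passes to the limit and yields the derivative of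
     [F]. *)
  assert (HL : Rabs (F (x + d) - F x - d * l) <= M * d ^ 2).
  { assert (E : is_lim_seq (fun K => Rabs (f K (x + d) - f K x - d * f1 K x))
                  (Rabs (F (x + d) - F x - d * l))).
    { apply (is_lim_seq_abs _ (Finite _)). apply is_lim_seq_minus'.
      - apply is_lim_seq_minus'; auto.
      - apply (is_lim_seq_scal_l _ d (Finite l)); auto. }
    apply (is_lim_seq_le _ (fun _ => M * d ^ 2) _ (Finite (M * d ^ 2))) in E.
    - exact E.
    - intros K. pose proof (HT K _ Hy) as TK.
      replace (x + d - x) with d in TK by ring. exact TK.
    - apply is_lim_seq_const. }
  replace ((F (x + d) - F x) / d - l) with ((F (x + d) - F x - d * l) / d) by (field; auto).
  unfold Rdiv. rewrite Rabs_mult, Rabs_inv.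
  assert (Hdp : 0 < Rabs d) by (apply Rabs_pos_lt; auto).
  apply Rmult_lt_reg_r with (Rabs d); [exact Hdp|].
  rewrite Rmult_assoc, Rinv_l, Rmult_1_r by lra.
  eapply Rle_lt_trans; [exact HL|].
  replace (d ^ 2) with (Rabs d * Rabs d) by (rewrite <- Rsqr_pow2, Rsqr_abs; reflexivity).
  rewrite <- Rmult_assoc. apply Rmult_lt_compat_r; [exact Hdp|].
  apply Rle_lt_trans with ((M + 1) * Rabs d).
  - apply Rmult_le_compat_r; lra.
  - apply Rmult_lt_reg_r with (/ (M + 1)); [apply Rinv_0_lt_compat; lra|].
    replace ((M + 1) * Rabs d * / (M + 1)) with (Rabs d) by (field; lra). exact Hd3. }
split; [now exists l|].
rewrite (is_derive_unique F x l HD). exact Hl.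
Qed.

(** * Euler's integral *)

Lemma eventually_inv_INR_lt (a : R) : 0 < a -> eventually (fun n => / INR (S n) < a).
Proof.
intros Ha. assert (H := is_lim_seq_inv_INR_S).
apply is_lim_seq_spec in H. destruct (H (mkposreal a Ha)) as [N HN].
exists N. intros n Hn. specialize (HN n Hn). simpl in HN.
rewrite Rminus_0_r in HN. apply Rle_lt_trans with (2 := HN), Rle_abs.
Qed.

Lemma eventually_INR_gt (b : R) : eventually (fun n => b < INR (S n)).
Proof.
assert (H := is_lim_seq_INR). apply is_lim_seq_spec in H. destruct (H b) as [N HN].
exists N. intros n Hn. apply HN. lia.
Qed.

Lemma ex_RInt_pos (f : R -> R) (a b : R) :
  (forall t, 0 < t -> continuous f t) -> 0 < a -> 0 < b -> ex_RInt f a b.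
Proof.
intros Hc Ha Hb. apply (ex_RInt_continuous f). intros z Hz. apply Hc.
revert Hz; unfold Rmin, Rmax; destruct (Rle_dec a b); lra.
Qed.

Lemma RInt_mono_interval (f : R -> R) (a b c d : R) :
  (forall t, 0 < t -> continuous f t) -> (forall t, 0 < t -> 0 <= f t) ->
  0 < c <= a -> a <= b <= d -> RInt f a b <= RInt f c d.
Proof.
intros Hc Hp Hca Hbd.
assert (E : forall x y, 0 < x -> 0 < y -> ex_RInt f x y) by (intros; apply ex_RInt_pos; auto).
rewrite <- (RInt_Chasles f c a d) by (apply E; lra).
rewrite <- (RInt_Chasles f a b d) by (apply E; lra).
unfold plus; simpl.
assert (0 <= RInt f c a) by (apply RInt_ge_0; [lra|apply E; lra|intros; apply Hp; lra]).
assert (0 <= RInt f b d) by (apply RInt_ge_0; [lra|apply E; lra|intros; apply Hp; lra]).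
lra.
Qed.

(** For a nonnegative integrand the improper integral is the supremum of the proper ones. Exhausting
    the half-line by the intervals from 1/(n+1) to n+1 makes it the limit of a single sequence,
    through which relations between Gamma values are proved. *)
Lemma RInt_gen_bounded (f : R -> R) (C : R) :
  (forall t, 0 < t -> continuous f t) -> (forall t, 0 < t -> 0 <= f t) ->
  (forall a b, 0 < a <= b -> RInt f a b <= C) ->
  let I := RInt_gen f (at_right 0) (Rbar_locally p_infty) in
  (forall a b, 0 < a <= b -> RInt f a b <= I) /\
  is_lim_seq (fun n => RInt f (/ INR (S n)) (INR (S n))) I.
Proof.
intros Hc Hp HC.
set (E := fun v => exists a b, 0 < a <= b /\ v = RInt f a b).
destruct (completeness E) as [I [HI1 HI2]].
{ exists C. intros v [a [b [Hab ->]]]. auto. }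
{ exists (RInt f 1 1), 1, 1. split; [lra|auto]. }
assert (Hub : forall a b, 0 < a <= b -> RInt f a b <= I).
{ intros a b Hab. apply HI1. now exists a, b. }
assert (Happ : forall eps : posreal, exists a b, 0 < a <= b /\
   forall c d, 0 < c <= a -> b <= d -> Rabs (RInt f c d - I) < eps).
{ intros eps.
  destruct (classic (exists a b, 0 < a <= b /\ I - eps < RInt f a b))
    as [[a [b [Hab Hv]]]|Hn].
  - exists a, b. split; [exact Hab|]. intros c d Hc' Hd.
    assert (RInt f a b <= RInt f c d) by (apply RInt_mono_interval; auto; lra).
    assert (RInt f c d <= I) by (apply Hub; lra).
    apply Rabs_lt_between. pose proof (cond_pos eps). lra.
  - exfalso. assert (I <= I - eps).
    { apply HI2. intros v [a [b [Hab ->]]].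
      destruct (Rle_lt_dec (RInt f a b) (I - eps)) as [H|H]; [exact H|].
      exfalso; apply Hn. now exists a, b. }
    pose proof (cond_pos eps). lra. }
assert (HG : is_RInt_gen f (at_right 0) (Rbar_locally p_infty) I).
{ intros P [eps HP]. destruct (Happ eps) as [a [b [Hab H]]].
  apply (Filter_prod _ _ _ (fun c => 0 < c < a) (fun d => b < d)).
  - exists (mkposreal a (proj1 Hab)). intros c Hb Hc0.
    unfold ball in Hb; simpl in Hb; unfold AbsRing_ball, abs, minus, plus, opp in Hb; simpl in Hb.
    apply Rabs_lt_between in Hb. lra.
  - exists b; auto.
  - intros c d Hc1 Hd1. exists (RInt f c d). split.
    + apply (RInt_correct (V := R_CompleteNormedModule)), ex_RInt_pos; simpl; auto; lra.
    + apply HP. apply H; lra. }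
intros I'; unfold I'; rewrite (is_RInt_gen_unique f I HG). split; [exact Hub|].
apply is_lim_seq_spec. intros eps. destruct (Happ eps) as [a [b [Hab H]]].
destruct (eventually_inv_INR_lt a (proj1 Hab)) as [N1 H1].
destruct (eventually_INR_gt b) as [N2 H2].
exists (max N1 N2). intros n Hn. apply H.
- split; [apply Rinv_0_lt_compat, lt_0_INR; lia|].
  apply Rlt_le, H1; lia.
- apply Rlt_le, H2; lia.
Qed.

Lemma exp_le_compat (x y : R) : x <= y -> exp x <= exp y.
Proof. intros [H| ->]; [apply Rlt_le, exp_increasing, H|apply Rle_refl]. Qed.

Lemma ln_le_minus_1 (y : R) : 0 < y -> ln y <= y - 1.
Proof.
intros Hy. pose proof (exp_ineq1_le (ln y)) as H. rewrite exp_ln in H by exact Hy. lra.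
Qed.

Definition gamma_integrand (s t : R) : R := Rpower t (s - 1) * exp (- t).

Lemma gamma_integrand_exp (s t : R) : gamma_integrand s t = exp ((s - 1) * ln t - t).
Proof. unfold gamma_integrand, Rpower. rewrite <- exp_plus. f_equal; ring. Qed.

Lemma gamma_integrand_pos (s t : R) : 0 < gamma_integrand s t.
Proof. rewrite gamma_integrand_exp. apply exp_pos. Qed.

Lemma continuous_gamma_integrand (s t : R) : 0 < t -> continuous (gamma_integrand s) t.
Proof.
intros Ht. apply (ex_derive_continuous (gamma_integrand s)).
unfold gamma_integrand, Rpower. auto_derive. auto.
Qed.

(* [ln (1 + t)] stays below its tangent at [t = s], with slope [1 / (s + 1)]. *)
Lemma gamma_integrand_bound (s t : R) : 0 < s -> 0 < t ->
  gamma_integrand s t <=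
  exp ((s + 1) * ln (s + 1) - s) * (exp (s * (ln t - ln (1 + t))) / (t * (1 + t))).
Proof.
intros Hs Ht. rewrite gamma_integrand_exp.
replace (t * (1 + t)) with (exp (ln t + ln (1 + t))) by (rewrite exp_plus, !exp_ln; lra).
unfold Rdiv. rewrite <- exp_Ropp, <- !exp_plus.
apply exp_le_compat.
assert (H : ln ((1 + t) / (s + 1)) <= (1 + t) / (s + 1) - 1).
{ apply ln_le_minus_1. apply Rdiv_lt_0_compat; lra. }
rewrite ln_div in H by lra.
assert (H' : (s + 1) * (ln (1 + t) - ln (s + 1)) <= (s + 1) * ((1 + t) / (s + 1) - 1))
  by (apply Rmult_le_compat_l; lra).
replace ((s + 1) * ((1 + t) / (s + 1) - 1)) with (t - s) in H' by (field; lra).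
lra.
Qed.

(** Up to the constant, the majorant has the antiderivative (t/(1+t))^s / s, which stays between 0
    and 1/s; it controls both ends of the half-line at once. *)
Lemma RInt_gamma_integrand_bound (s a b : R) : 0 < s -> 0 < a <= b ->
  RInt (gamma_integrand s) a b <= exp ((s + 1) * ln (s + 1) - s) / s.
Proof.
intros Hs Hab.
set (C := exp ((s + 1) * ln (s + 1) - s)).
assert (HC : 0 < C) by apply exp_pos.
set (H := fun t => C / s * exp (s * (ln t - ln (1 + t)))).
set (h := fun t => C * (exp (s * (ln t - ln (1 + t))) / (t * (1 + t)))).
assert (HI : is_RInt h a b (minus (H b) (H a))).
{ apply (is_RInt_derive (V := R_CompleteNormedModule) H); rewrite Rmin_left, Rmax_right by lra; intros x Hx.
  - unfold H, h. auto_derive; [lra|].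
    fold (ln x - ln (1 + x)). field. lra.
  - apply (ex_derive_continuous h). unfold h. auto_derive.
    repeat split; try lra. apply Rgt_not_eq, Rmult_lt_0_compat; lra. }
apply Rle_trans with (RInt h a b).
- apply RInt_le; [lra| |eexists; exact HI|].
  + apply ex_RInt_pos; try lra. intros; apply continuous_gamma_integrand; auto.
  + intros x Hx. apply gamma_integrand_bound; lra.
- rewrite (is_RInt_unique _ _ _ _ HI). unfold minus, plus, opp; simpl. unfold H.
  assert (0 < C / s * exp (s * (ln a - ln (1 + a)))).
  { apply Rmult_lt_0_compat; [apply Rdiv_lt_0_compat; lra|apply exp_pos]. }
  assert (exp (s * (ln b - ln (1 + b))) <= 1).
  { apply Rle_trans with (exp 0); [apply exp_le_compat|rewrite exp_0; lra].
    assert (ln b < ln (1 + b)) by (apply ln_increasing; lra). nra. }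
  assert (0 < C / s) by (apply Rdiv_lt_0_compat; lra).
  nra.
Qed.

Lemma Gamma_facts (s : R) : 0 < s ->
  (forall a b, 0 < a <= b -> RInt (gamma_integrand s) a b <= Gamma s) /\
  is_lim_seq (fun n => RInt (gamma_integrand s) (/ INR (S n)) (INR (S n))) (Gamma s).
Proof.
intros Hs.
apply (RInt_gen_bounded (gamma_integrand s) (exp ((s + 1) * ln (s + 1) - s) / s)).
- intros; now apply continuous_gamma_integrand.
- intros; apply Rlt_le, gamma_integrand_pos.
- intros; now apply RInt_gamma_integrand_bound.
Qed.

Lemma Gamma_pos (s : R) : 0 < s -> 0 < Gamma s.
Proof.
intros Hs. apply Rlt_le_trans with (RInt (gamma_integrand s) 1 2).
- apply RInt_gt_0; [lra| |].
  + intros; apply gamma_integrand_pos.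
  + intros; apply continuous_gamma_integrand; lra.
- apply (proj1 (Gamma_facts s Hs)); lra.
Qed.

Lemma ex_RInt_gamma_integrand (s a b : R) : 0 < a -> 0 < b -> ex_RInt (gamma_integrand s) a b.
Proof. intros; apply ex_RInt_pos; auto. intros; now apply continuous_gamma_integrand. Qed.

Lemma inv_INR_S_bounds (n : nat) : 0 < / INR (S n) /\ / INR (S n) <= INR (S n).
Proof.
assert (1 <= INR (S n)) by (apply (le_INR 1); lia).
split; [apply Rinv_0_lt_compat; lra|].
apply Rle_trans with 1; [|lra]. rewrite <- Rinv_1. apply Rinv_le_contravar; lra.
Qed.

Lemma Gamma_step (s : R) : 0 < s -> Gamma (s + 1) = s * Gamma s.
Proof.
intros Hs.
(* Integration by parts: [F] is t^s e^(-t), whose derivative is the difference of the two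
   integrands, and its boundary values vanish in the limit. *)
set (F := fun t => exp (s * ln t - t)).
assert (HB : is_lim_seq (fun n => F (INR (S n)) - F (/ INR (S n))) 0).
{ replace (Finite 0) with (Finite (0 - 0)) by (f_equal; ring).
  apply is_lim_seq_minus'.
  (* The tangent to ln at s + 1 bounds t^(s+1) e^(-t) by its maximum; [C] is a convenient larger
     value, so that F(t) is at most C/t. *)
  - set (C := exp ((s + 2) * ln (s + 2) - (s + 1))).
    apply is_lim_seq_squeeze0 with (v := fun n => C * / INR (S n)).
    + intros n. destruct (inv_INR_S_bounds n) as [Hp _].
      assert (Ht : 0 < INR (S n)) by (apply lt_0_INR; lia).
      set (t := INR (S n)) in *. rewrite Rminus_0_r, Rabs_pos_eq by apply Rlt_le, exp_pos.
      unfold F, C. replace (/ t) with (exp (- ln t)) by (rewrite exp_Ropp, exp_ln; auto).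
      rewrite <- exp_plus. apply exp_le_compat.
      assert (H : ln (t / (s + 1)) <= t / (s + 1) - 1).
      { apply ln_le_minus_1. apply Rdiv_lt_0_compat; lra. }
      rewrite ln_div in H by lra.
      assert (H' : (s + 1) * (ln t - ln (s + 1)) <= (s + 1) * (t / (s + 1) - 1))
        by (apply Rmult_le_compat_l; lra).
      replace ((s + 1) * (t / (s + 1) - 1)) with (t - (s + 1)) in H' by (field; lra).
      assert (ln (s + 1) <= ln (s + 2)) by (apply ln_le; lra).
      assert (0 <= ln (s + 2)) by (rewrite <- ln_1; apply ln_le; lra). nra.
    + replace (Finite 0) with (Rbar_mult C 0) by (simpl; f_equal; ring).
      apply is_lim_seq_scal_l, is_lim_seq_inv_INR_S.
  - apply is_lim_seq_squeeze0 with (v := fun n => exp (- (s * ln (INR (S n))))).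
    + intros n. rewrite Rminus_0_r, Rabs_pos_eq by apply Rlt_le, exp_pos.
      unfold F. apply exp_le_compat. rewrite ln_Rinv by (apply lt_0_INR; lia).
      pose proof (inv_INR_S_bounds n). lra.
    + apply (filterlim_comp _ _ _ (fun n => - (s * ln (INR (S n)))) exp eventually (Rbar_locally m_infty)); [|exact is_lim_exp_m].
      apply (is_lim_seq_opp (fun n => s * ln (INR (S n))) p_infty).
      replace p_infty with (Rbar_mult s p_infty).
      * apply is_lim_seq_scal_l.
        apply (filterlim_comp _ _ _ (fun n => INR (S n)) ln eventually (Rbar_locally p_infty)); [|exact is_lim_ln_p].
        apply (is_lim_seq_incr_1 INR), is_lim_seq_INR.
      * simpl. destruct (Rle_dec 0 s) as [h|h]; [|lra].
        destruct (Rle_lt_or_eq_dec 0 s h); [reflexivity|lra]. }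
assert (HL := proj2 (Gamma_facts s Hs)).
assert (HL1 := proj2 (Gamma_facts (s + 1) ltac:(lra))).
assert (E : is_lim_seq (fun n => F (INR (S n)) - F (/ INR (S n))) (s * Gamma s - Gamma (s + 1))).
{ eapply is_lim_seq_ext; [|apply is_lim_seq_minus'; [apply (is_lim_seq_scal_l _ s _ HL)|exact HL1]].
  intros n. cbv beta. destruct (inv_INR_S_bounds n) as [Hp Hle].
  assert (Ht : 0 < INR (S n)) by lra.
  set (b := INR (S n)) in *. set (a := / b) in *.
  assert (HI : is_RInt (fun t => s * gamma_integrand s t - gamma_integrand (s + 1) t) a b
                       (minus (F b) (F a))).
  { apply (is_RInt_derive (V := R_CompleteNormedModule) F); rewrite Rmin_left, Rmax_right by lra; intros x Hx.
    - unfold F. auto_derive; [lra|]. rewrite !gamma_integrand_exp.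
      replace ((s + 1 - 1) * ln x - x) with (s * ln x - x) by ring.
      assert (Hx' : exp ((s - 1) * ln x - x) = exp (s * ln x - x) / x).
      { replace ((s - 1) * ln x - x) with (s * ln x - x + - ln x) by ring.
        now rewrite exp_plus, exp_Ropp, exp_ln by lra. }
      rewrite Hx'. fold (s * ln x - x). field; lra.
    - apply (continuous_minus (fun t => s * gamma_integrand s t)).
      + apply (continuous_scal_r s (gamma_integrand s)), continuous_gamma_integrand; lra.
      + apply continuous_gamma_integrand; lra. }
  apply (is_RInt_unique (V := R_CompleteNormedModule)) in HI. unfold minus, plus, opp in HI; simpl in HI.
  unfold Rminus. rewrite <- HI.
  rewrite (RInt_plus (fun t => s * gamma_integrand s t) (fun t => - gamma_integrand (s + 1) t)).
  - rewrite (RInt_scal (gamma_integrand s)), (RInt_opp (gamma_integrand (s + 1)));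
      try apply ex_RInt_gamma_integrand; auto.
  - apply (ex_RInt_scal (gamma_integrand s)), ex_RInt_gamma_integrand; auto.
  - apply (ex_RInt_opp (gamma_integrand (s + 1))), ex_RInt_gamma_integrand; auto. }
pose proof (is_lim_seq_finite_unique _ _ _ HB E). lra.
Qed.

(** Both exp x and 1 are compared with exp(ux) through the tangent to exp at 0; with the weights u
    and 1 - u the linear terms cancel. *)
Lemma exp_convex (u x : R) : 0 <= u <= 1 -> exp (u * x) <= 1 - u + u * exp x.
Proof.
intros Hu.
pose proof (exp_ineq1_le (x - u * x)) as H1. pose proof (exp_ineq1_le (- (u * x))) as H2.
pose proof (exp_pos (u * x)) as H0.
assert (E1 : exp x = exp (u * x) * exp (x - u * x)) by (rewrite <- exp_plus; f_equal; ring).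
assert (E2 : 1 = exp (u * x) * exp (- (u * x)))
  by (rewrite <- exp_plus, <- exp_0; f_equal; ring).
rewrite E1.
replace (1 - u) with ((1 - u) * (exp (u * x) * exp (- (u * x)))) by (rewrite <- E2; ring).
assert (A1 : u * (1 + (x - u * x)) <= u * exp (x - u * x)) by (apply Rmult_le_compat_l; lra).
assert (A2 : (1 - u) * (1 + - (u * x)) <= (1 - u) * exp (- (u * x)))
  by (apply Rmult_le_compat_l; lra).
assert (A3 : exp (u * x) * 1 <= exp (u * x) * (u * exp (x - u * x) + (1 - u) * exp (- (u * x))))
  by (apply Rmult_le_compat_l; nra).
lra.
Qed.

(** The tangent is taken at t = s, so that after integration [Gamma_step] collapses the combination
    of Gamma(s) and Gamma(s+1) to a multiple of Gamma(s). No separate lower bound is needed: it is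
    the same inequality for the step from s + u to s + 1. *)
Lemma Gamma_shift_le (s u : R) : 0 < s -> 0 <= u <= 1 ->
  Gamma (s + u) <= exp (u * ln s) * Gamma s.
Proof.
intros Hs Hu.
assert (HL := proj2 (Gamma_facts s Hs)).
assert (HLu := proj2 (Gamma_facts (s + u) ltac:(lra))).
assert (HL1 := proj2 (Gamma_facts (s + 1) ltac:(lra))).
set (c := exp (u * ln s)).
replace (c * Gamma s) with (c * (1 - u) * Gamma s + c * (u / s) * Gamma (s + 1))
  by (rewrite Gamma_step by exact Hs; field; lra).
assert (E := is_lim_seq_plus' _ _ _ _ (is_lim_seq_scal_l _ (c * (1 - u)) _ HL)
                             (is_lim_seq_scal_l _ (c * (u / s)) _ HL1)).
refine (is_lim_seq_le _ _ (Finite _) (Finite _) _ HLu E). intros n. cbv beta. destruct (inv_INR_S_bounds n) as [Hp Hle].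
assert (Ht : 0 < INR (S n)) by lra.
set (b := INR (S n)) in *. set (a := / b) in *.
set (G := fun t => c * (1 - u) * gamma_integrand s t + c * (u / s) * gamma_integrand (s + 1) t).
assert (X : forall k r, ex_RInt (fun t => k * gamma_integrand r t) a b).
{ intros k r. apply (ex_RInt_scal (gamma_integrand r)), ex_RInt_gamma_integrand; auto. }
apply Rle_trans with (RInt G a b).
- apply RInt_le; auto.
  + apply ex_RInt_gamma_integrand; auto.
  + apply (ex_RInt_plus (fun t => c * (1 - u) * gamma_integrand s t)); apply X.
  + intros t Ht'. unfold G. rewrite !gamma_integrand_exp.
    assert (0 < t) by lra.
    replace ((s + u - 1) * ln t - t) with (u * ln s + (u * (ln t - ln s)) + ((s - 1) * ln t - t)) by ring.
    replace ((s + 1 - 1) * ln t - t) with (ln t + ((s - 1) * ln t - t)) by ring.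
    rewrite !exp_plus, exp_ln by lra. fold c.
    pose proof (exp_convex u (ln t - ln s) Hu) as HC.
    unfold Rminus in HC at 3. rewrite exp_plus, exp_Ropp, !exp_ln in HC by lra.
    assert (0 < c) by apply exp_pos.
    pose proof (exp_pos ((s - 1) * ln t - t)).
    set (e := exp ((s - 1) * ln t - t)) in *.
    apply Rle_trans with (c * (1 - u + u * (t * / s)) * e).
    * apply Rmult_le_compat_r; [lra|]. apply Rmult_le_compat_l; lra.
    * right. field. lra.
- right. unfold G. rewrite (RInt_plus (fun t => c * (1 - u) * gamma_integrand s t)) by apply X.
  rewrite !(RInt_scal (gamma_integrand _)) by (apply ex_RInt_gamma_integrand; auto).
  reflexivity.
Qed.

(** * Euler's limit formula and the polygamma functions *)

Definition lnGamma (x : R) : R := ln (Gamma x).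

Lemma lnGamma_shift (x : R) (K : nat) : 0 < x ->
  lnGamma (x + INR K) = lnGamma x + psum (fun k => ln (x + INR k)) K.
Proof.
intros Hx. induction K as [|K IH]; [simpl; rewrite !Rplus_0_r; reflexivity|].
pose proof (pos_INR K). cbn [psum]. rewrite S_INR, <- Rplus_assoc.
unfold lnGamma at 1. rewrite Gamma_step by lra.
rewrite ln_mult by (try apply Gamma_pos; lra).
fold (lnGamma (x + INR K)). rewrite IH; ring.
Qed.

(* The j-th derivative of the K-th approximant of ln Gamma in Euler's limit formula,
   for 0 < x < 1. *)
Definition euler_approx (j K : nat) (x : R) : R :=
  match j with
  | O => lnGamma (INR (S K)) + x * ln (INR (S K)) - psum (fun k => ln (x + INR k)) (S K)
  | S O => ln (INR (S K)) - psum (fun k => / (x + INR k)) (S K)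
  | S (S m) => (-1) ^ m * INR (fact (S m)) * psum (fun k => / (x + INR k) ^ (m + 2)) (S K)
  end.

Lemma is_derive_euler_approx (j K : nat) (x : R) : 0 < x ->
  is_derive (euler_approx j K) x (euler_approx (S j) K x).
Proof.
intros Hx.
assert (Hk : forall k, 0 < x + INR k) by (intros k; pose proof (pos_INR k); lra).
destruct j as [|[|m]]; cbn [euler_approx].
- apply (is_derive_minus (fun y => lnGamma (INR (S K)) + y * ln (INR (S K)))
           (fun y => psum (fun k => ln (y + INR k)) (S K))).
  + generalize (ln (INR (S K))) (lnGamma (INR (S K))). intros c d. auto_derive; auto; ring.
  + apply (is_derive_psum (fun k y => ln (y + INR k)) (fun k y => / (y + INR k))).
    intros k _. auto_derive; [apply Hk|]. field. specialize (Hk k); lra.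
- apply is_derive_eq with (0 - psum (fun k => - / (x + INR k) ^ 2) (S K)).
  + apply (is_derive_minus (fun _ => ln (INR (S K))) (fun y => psum (fun k => / (y + INR k)) (S K))).
    * apply (is_derive_const (K := R_AbsRing) (V := R_NormedModule)).
    * apply (is_derive_psum (fun k y => / (y + INR k)) (fun k y => - / (y + INR k) ^ 2)).
      intros k _. specialize (Hk k). auto_derive; [lra|]. field. lra.
  + rewrite (psum_ext _ (fun k => (-1) * / (x + INR k) ^ 2)) by (intros; ring).
    rewrite psum_scal. change (INR (fact 1)) with 1. change (0 + 2)%nat with 2%nat. change ((-1) ^ 0) with 1. ring.
- apply is_derive_eq with ((-1) ^ m * INR (fact (S m)) *
    psum (fun k => - INR (m + 2) * / (x + INR k) ^ (m + 3)) (S K)).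
  + apply (is_derive_scal (fun y => psum (fun k => / (y + INR k) ^ (m + 2)) (S K))).
    apply (is_derive_psum (fun k y => / (y + INR k) ^ (m + 2))
              (fun k y => - INR (m + 2) * / (y + INR k) ^ (m + 3))).
    intros k _. specialize (Hk k).
    assert (x + INR k <> 0) by lra.
    auto_derive; [apply pow_nonzero; auto|].
    replace (m + 3)%nat with (S (S (S m))) by lia. replace (m + 2)%nat with (S (S m)) by lia.
    cbn [Nat.pred pow]. field. split; auto. apply pow_nonzero; auto.
  + rewrite psum_scal. replace (S m + 2)%nat with (m + 3)%nat by lia.
    rewrite (fact_simpl (S m)), mult_INR.
    replace (m + 2)%nat with (S (S m)) by lia. simpl ((-1) ^ S m). ring.
Qed.

Lemma psum_inv_sqr_le (a : R) (n : nat) : 0 < a ->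
  psum (fun k => / (a + INR k) ^ 2) n <= / a ^ 2 + / a.
Proof.
intros Ha.
assert (Ha2 : 0 < / a ^ 2) by (apply Rinv_0_lt_compat, pow_lt; auto).
assert (Ha1 : 0 < / a) by (apply Rinv_0_lt_compat; auto).
destruct n as [|n]; [simpl psum; lra|].
rewrite psum_head. simpl (INR 0). rewrite Rplus_0_r. apply Rplus_le_compat_l.
apply Rle_trans with (psum (fun k => - / (a + INR (S k)) - - / (a + INR k)) n).
- apply psum_le. intros k _. pose proof (pos_INR k). rewrite S_INR.
  apply Rminus_le_0.
  replace (- / (a + (INR k + 1)) - - / (a + INR k) - / (a + (INR k + 1)) ^ 2)
    with (/ ((a + INR k) * (a + INR k + 1) ^ 2)) by (field; lra).
  apply Rlt_le, Rinv_0_lt_compat, Rmult_lt_0_compat; [lra|apply pow_lt; lra].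
- rewrite (psum_telescope (fun k => - / (a + INR k))). simpl (INR 0). rewrite Rplus_0_r.
  pose proof (pos_INR n). assert (0 < / (a + INR n)) by (apply Rinv_0_lt_compat; lra). lra.
Qed.

Lemma psum_inv_pow_le (a x : R) (m n : nat) : 0 < a <= x ->
  psum (fun k => / (x + INR k) ^ (m + 2)) n <= / a ^ m * (/ a ^ 2 + / a).
Proof.
intros [Ha Hx].
apply Rle_trans with (/ a ^ m * psum (fun k => / (a + INR k) ^ 2) n).
- rewrite <- psum_scal. apply psum_le. intros k _. pose proof (pos_INR k).
  rewrite pow_add, Rinv_mult.
  apply Rmult_le_compat.
  + apply Rlt_le, Rinv_0_lt_compat, pow_lt; lra.
  + apply Rlt_le, Rinv_0_lt_compat, pow_lt; lra.
  + apply Rinv_le_contravar; [apply pow_lt; lra|apply pow_incr; lra].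
  + apply Rinv_le_contravar; [apply pow_lt; lra|apply pow_incr; lra].
- apply Rmult_le_compat_l; [apply Rlt_le, Rinv_0_lt_compat, pow_lt; lra|].
  apply psum_inv_sqr_le; auto.
Qed.

Lemma euler_approx_bound (m K : nat) (a x : R) : 0 < a <= x ->
  Rabs (euler_approx (S (S m)) K x) <= INR (fact (S m)) * (/ a ^ m * (/ a ^ 2 + / a)).
Proof.
intros H. cbn [euler_approx]. rewrite !Rabs_mult, pow_1_abs, Rmult_1_l.
assert (0 < INR (fact (S m))) by apply INR_fact_lt_0.
rewrite (Rabs_pos_eq (INR _)) by lra. apply Rmult_le_compat_l; [lra|].
rewrite Rabs_pos_eq; [apply psum_inv_pow_le; auto|].
apply psum_nonneg. intros k _. pose proof (pos_INR k).
apply Rlt_le, Rinv_0_lt_compat, pow_lt; lra.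
Qed.

(** The inequality [Gamma_shift_le], from s to s + x and from s + x to s + 1, traps ln Gamma(x+s) -
    ln Gamma(s) - x ln s in an interval of length at most (1-x)(ln(x+s) - ln s), which is below 1/s;
    here s = K + 1. *)
Lemma euler_limit (x : R) : 0 < x < 1 ->
  is_lim_seq (fun K => euler_approx 0 K x) (lnGamma x).
Proof.
intros Hx.
apply is_lim_seq_squeeze0 with (v := fun K => / INR (S K)); [|apply is_lim_seq_inv_INR_S].
intros K. cbn [euler_approx].
assert (E : psum (fun k => ln (x + INR k)) (S K) = lnGamma (x + INR (S K)) - lnGamma x)
  by (rewrite lnGamma_shift by lra; ring).
rewrite E. set (s := INR (S K)).
assert (Hs : 0 < s) by (apply lt_0_INR; lia).
assert (G1 := Gamma_pos s Hs). assert (G2 := Gamma_pos (x + s) ltac:(lra)).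
assert (U := Gamma_shift_le s x Hs ltac:(lra)).
assert (L := Gamma_shift_le (s + x) (1 - x) ltac:(lra) ltac:(lra)).
replace (s + x + (1 - x)) with (s + 1) in L by ring. rewrite Gamma_step in L by exact Hs.
rewrite (Rplus_comm s x) in U, L.
apply ln_le in U; [|exact G2]. apply ln_le in L; [|apply Rmult_lt_0_compat; auto].
rewrite ln_mult, ln_exp in U by (try apply exp_pos; auto).
rewrite !ln_mult, ln_exp in L by (try apply exp_pos; auto).
assert (D : ln (x + s) - ln s <= x / s).
{ rewrite <- ln_div by lra. replace (x / s) with ((x + s) / s - 1) by (field; lra).
  apply ln_le_minus_1, Rdiv_lt_0_compat; lra. }
assert (D' : x / s <= / s).
{ unfold Rdiv. rewrite <- (Rmult_1_l (/ s)) at 2. apply Rmult_le_compat_r; [|lra].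
  apply Rlt_le, Rinv_0_lt_compat; lra. }
assert (D0 : ln s <= ln (x + s)) by (apply ln_le; lra).
unfold lnGamma. apply Rabs_le_between. nra.
Qed.

(** Each order follows from the preceding one by [limit_derive]. The bounds on the approximants blow
    up at 0, hence the interval from x/2 to 1. Differentiability is part of the conclusion since
    [Derive_n] alone carries no such information. *)
Lemma lnGamma_derivatives (j : nat) (x : R) : 0 < x < 1 ->
  ex_derive_n lnGamma j x /\ is_lim_seq (fun K => euler_approx j K x) (Derive_n lnGamma j x).
Proof.
revert x. induction j as [|j IH]; intros x Hx.
- split; [exact I|apply euler_limit, Hx].
- apply (limit_derive (euler_approx j) (euler_approx (S j)) (euler_approx (S (S j)))
    (Derive_n lnGamma j) (x / 2) 1
    (INR (fact (S j)) * (/ (x / 2) ^ j * (/ (x / 2) ^ 2 + / (x / 2))))); try lra.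
  + intros; apply is_derive_euler_approx; lra.
  + intros; apply is_derive_euler_approx; lra.
  + intros K z Hz. apply euler_approx_bound; lra.
  + intros z Hz. apply IH; lra.
Qed.

Lemma is_derive_lnGamma_n (j : nat) (x : R) : 0 < x < 1 ->
  is_derive (Derive_n lnGamma j) x (Derive_n lnGamma (S j) x).
Proof. intros Hx. apply Derive_correct. apply (lnGamma_derivatives (S j) x Hx). Qed.

Lemma Gamma_exp_lnGamma (x : R) : 0 < x -> Gamma x = exp (lnGamma x).
Proof. intros Hx. unfold lnGamma. rewrite exp_ln; auto using Gamma_pos. Qed.

(** What is known to be differentiable is [lnGamma], so Gamma is differentiated as its
    exponential. *)
Lemma digamma_lnGamma (x : R) : 0 < x < 1 -> digamma x = Derive_n lnGamma 1 x.
Proof.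
intros Hx. unfold digamma.
assert (D := is_derive_lnGamma_n 0 x Hx). change (Derive_n lnGamma 0) with lnGamma in D.
rewrite (Derive_ext_loc Gamma (fun y => exp (lnGamma y))).
- rewrite Gamma_exp_lnGamma by lra.
  rewrite (is_derive_unique _ x (Derive_n lnGamma 1 x * exp (lnGamma x))).
  + field. apply Rgt_not_eq, exp_pos.
  + apply (is_derive_comp exp lnGamma); [apply is_derive_Reals, derivable_pt_lim_exp|exact D].
- apply (locally_Ioo 0 1); [exact Hx|]. intros; apply Gamma_exp_lnGamma; lra.
Qed.

Lemma polygamma_lnGamma (m : nat) (x : R) : 0 < x < 1 ->
  polygamma m x = Derive_n lnGamma (S m) x.
Proof.
intros Hx. unfold polygamma.
rewrite (Derive_n_ext_loc digamma (Derive_n lnGamma 1)).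
- rewrite Derive_n_comp. f_equal. lia.
- apply (locally_Ioo 0 1); [exact Hx|]. apply digamma_lnGamma.
Qed.

(** * Reflection formulas *)

(** The limit is the Hurwitz zeta value at m + 2, read off from the convergence of the approximants
    of order m + 2. *)
Lemma hurwitz_lim (m : nat) (x : R) : 0 < x < 1 ->
  is_lim_seq (psum (fun k => / (x + INR k) ^ (m + 2)))
    ((-1) ^ m / INR (fact (S m)) * Derive_n lnGamma (S (S m)) x).
Proof.
intros Hx. apply is_lim_seq_incr_1.
eapply is_lim_seq_ext;
  [|exact (is_lim_seq_scal_l _ ((-1) ^ m / INR (fact (S m))) _ (proj2 (lnGamma_derivatives (S (S m)) x Hx)))].
intros K. cbn [euler_approx]. pose proof (INR_fact_neq_0 (S m)).
assert (E : (-1) ^ m * (-1) ^ m = 1).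
{ rewrite <- Rpow_mult_distr. replace (-1 * -1) with 1 by ring. apply pow1. }
set (s := psum _ (S K)).
transitivity (((-1) ^ m * (-1) ^ m) * s); [field; auto|rewrite E; ring].
Qed.

Lemma trigamma_lim (x : R) : 0 < x < 1 ->
  is_lim_seq (psum (fun k => / (x + INR k) ^ 2)) (Derive_n lnGamma 2 x).
Proof.
intros Hx. generalize (hurwitz_lim 0 x Hx).
change (0 + 2)%nat with 2%nat. change (INR (fact 1)) with 1. change ((-1) ^ 0) with 1.
replace (1 / 1 * Derive_n lnGamma 2 x) with (Derive_n lnGamma 2 x) by field. auto.
Qed.

(** Isolates the pole at 0, which in [reflection_defect] has to cancel that of the squared
    cosecant. *)
Lemma trigamma_bounds (x : R) : 0 < x < 1 ->
  / x ^ 2 <= Derive_n lnGamma 2 x <= / x ^ 2 + 2.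
Proof.
intros Hx. assert (L := trigamma_lim x Hx). apply is_lim_seq_incr_1 in L.
assert (E : forall K, psum (fun k => / (x + INR k) ^ 2) (S K)
   = / x ^ 2 + psum (fun k => / ((x + 1) + INR k) ^ 2) K).
{ intros K. rewrite psum_head. simpl (INR 0). rewrite Rplus_0_r. f_equal.
  apply psum_ext. intros i _. rewrite S_INR. f_equal. f_equal. ring. }
split.
- refine (is_lim_seq_le (fun _ => / x ^ 2) _ (Finite _) (Finite _) _ (is_lim_seq_const _) L).
  intros K. rewrite E. assert (0 <= psum (fun k => / ((x + 1) + INR k) ^ 2) K); [|lra].
  apply psum_nonneg. intros k _. pose proof (pos_INR k).
  apply Rlt_le, Rinv_0_lt_compat, pow_lt; lra.
- refine (is_lim_seq_le _ (fun _ => / x ^ 2 + 2) (Finite _) (Finite _) _ L (is_lim_seq_const _)).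
  intros K. rewrite E. apply Rplus_le_compat_l.
  eapply Rle_trans; [apply psum_inv_sqr_le; lra|].
  assert (/ (x + 1) <= 1) by (rewrite <- Rinv_1; apply Rinv_le_contravar; lra).
  assert (0 < / (x + 1)) by (apply Rinv_0_lt_compat; lra).
  rewrite <- pow_inv. nra.
Qed.

Lemma trigamma_double (x : R) : 0 < x < 1 ->
  Derive_n lnGamma 2 (x / 2) + Derive_n lnGamma 2 ((x + 1) / 2) = 4 * Derive_n lnGamma 2 x.
Proof.
intros Hx.
assert (L1 := trigamma_lim (x / 2) ltac:(lra)).
assert (L2 := trigamma_lim ((x + 1) / 2) ltac:(lra)).
assert (L := is_lim_seq_mul_subseq _ _ 2 ltac:(lia) (trigamma_lim x Hx)).
apply (is_lim_seq_finite_unique (fun K => psum (fun k => / (x / 2 + INR k) ^ 2) K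
          + psum (fun k => / ((x + 1) / 2 + INR k) ^ 2) K)).
- apply is_lim_seq_plus'; auto.
- eapply is_lim_seq_ext; [|exact (is_lim_seq_scal_l _ 4 _ L)].
  intros K. cbv beta. rewrite (Nat.mul_comm K), <- psum_double, <- psum_plus, <- psum_scal.
  apply psum_ext. intros k _. rewrite plus_INR, mult_INR. simpl (INR 2). simpl (INR 1).
  pose proof (pos_INR k). field. lra.
Qed.

(** * Cancellation of the poles and Herglotz's trick *)

Lemma sin_cubic_bound (y : R) : 0 < y <= 2 -> y / 3 <= sin y <= y /\ y - sin y <= y ^ 3 / 6.
Proof.
intros Hy.
assert (HP : 3 / 2 < PI / 2) by apply PI2_3_2.
assert (L : y - y ^ 3 / 6 <= sin y).
{ pose proof (proj1 (sin_bound y 0 ltac:(lra) ltac:(lra))) as H.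
  unfold sin_approx, sin_term in H. simpl in H. lra. }
assert (sin y < y) by (apply sin_lt_x; lra).
split; [|lra]. split; [|lra].
assert (y ^ 3 / 6 <= y * (2 / 3)); [|lra].
replace (y ^ 3 / 6) with (y * (y ^ 2 / 6)) by field. apply Rmult_le_compat_l; nra.
Qed.

Lemma inv_sin_sqr_bound (y : R) : 0 < y <= 2 -> 0 <= / sin y ^ 2 - / y ^ 2 <= 3.
Proof.
intros Hy. destruct (sin_cubic_bound y Hy) as [[H1 H2] H3].
set (s := sin y) in *. assert (Hs : 0 < s) by lra.
split.
- apply -> Rminus_le_0; apply Rinv_le_contravar; [apply pow_lt; lra|apply pow_incr; lra].
- replace (/ s ^ 2 - / y ^ 2) with ((y - s) * (y + s) * / (s ^ 2 * y ^ 2)) by (field; lra).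
  assert (P : 0 < s ^ 2 * y ^ 2) by (apply Rmult_lt_0_compat; apply pow_lt; lra).
  apply Rmult_le_reg_r with (s ^ 2 * y ^ 2); [exact P|].
  rewrite Rmult_assoc, Rinv_l, Rmult_1_r by lra.
  (* The numerator is at most (y^3/6)(2y) = y^4/3, and sin y >= y/3 makes 3 (y sin y)^2 at least as
     large. *)
  apply Rle_trans with (y ^ 3 / 6 * (2 * y)).
  + apply Rmult_le_compat; lra.
  + replace (3 * (s ^ 2 * y ^ 2)) with ((9 * s ^ 2) * (y ^ 2 / 3)) by field.
    replace (y ^ 3 / 6 * (2 * y)) with (y ^ 2 * (y ^ 2 / 3)) by field.
    apply Rmult_le_compat_r; [pose proof (pow2_ge_0 y); lra|]. nra.
Qed.

Lemma sin_PI_pos (x : R) : 0 < x < 1 -> 0 < sin (PI * x).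
Proof. intros Hx. pose proof PI_RGT_0. apply sin_gt_0; nra. Qed.

Lemma sin_PI_sym (x : R) : sin (PI * (1 - x)) = sin (PI * x).
Proof. replace (PI * (1 - x)) with (PI - PI * x) by ring. apply sin_PI_x. Qed.

Definition reflection_defect (x : R) : R :=
  (PI / sin (PI * x)) ^ 2 - (Derive_n lnGamma 2 x + Derive_n lnGamma 2 (1 - x)).

Lemma reflection_defect_sym (x : R) : reflection_defect (1 - x) = reflection_defect x.
Proof.
unfold reflection_defect. rewrite sin_PI_sym. replace (1 - (1 - x)) with x by ring. ring.
Qed.

Lemma reflection_defect_bounded (x : R) : 0 < x < 1 -> Rabs (reflection_defect x) <= 56.
Proof.
(* Symmetry reduces to x at most 1/2, where PI x stays below 2. After 1/x^2 cancels, the cosecant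
   contributes at most 4^2 * 3 = 48 and the trigamma values at most 2 + (4 + 2). *)
assert (H : forall x, 0 < x <= / 2 -> Rabs (reflection_defect x) <= 56).
{ clear x; intros x Hx. unfold reflection_defect.
  pose proof PI_RGT_0. pose proof PI_4.
  destruct (inv_sin_sqr_bound (PI * x)) as [L U]; [nra|].
  pose proof (sin_PI_pos x ltac:(lra)).
  pose proof (trigamma_bounds x ltac:(lra)) as T1. pose proof (trigamma_bounds (1 - x) ltac:(lra)) as T2.
  assert (E : (PI / sin (PI * x)) ^ 2 - / x ^ 2 = PI ^ 2 * (/ sin (PI * x) ^ 2 - / (PI * x) ^ 2)).
  { field. repeat split; lra. }
  assert (P : 0 <= (PI / sin (PI * x)) ^ 2 - / x ^ 2 <= 48).
  { rewrite E. split; [apply Rmult_le_pos; nra|].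
    replace 48 with (4 ^ 2 * 3) by ring. apply Rmult_le_compat; try nra. }
  assert (Q : / (1 - x) ^ 2 <= 4).
  { replace 4 with (/ (/ 2) ^ 2) by field. apply Rinv_le_contravar; [|apply pow_incr]; lra. }
  assert (0 < / (1 - x) ^ 2) by (apply Rinv_0_lt_compat, pow_lt; lra).
  apply Rabs_le_between. lra. }
intros Hx. destruct (Rle_lt_dec x (/ 2)) as [h|h]; [apply H; lra|].
rewrite <- reflection_defect_sym. apply H; lra.
Qed.

Lemma reflection_defect_double (x : R) : 0 < x < 1 ->
  reflection_defect (x / 2) + reflection_defect ((x + 1) / 2) = 4 * reflection_defect x.
Proof.
intros Hx. unfold reflection_defect.
pose proof (trigamma_double x Hx) as T1. pose proof (trigamma_double (1 - x) ltac:(lra)) as T2.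
replace (1 - (x + 1) / 2) with ((1 - x) / 2) by field.
replace (1 - x / 2) with ((1 - x + 1) / 2) by field.
assert (S : (PI / sin (PI * (x / 2))) ^ 2 + (PI / sin (PI * ((x + 1) / 2))) ^ 2
   = 4 * (PI / sin (PI * x)) ^ 2).
{ pose proof (sin_PI_pos (x / 2) ltac:(lra)) as P1.
  pose proof (sin_PI_pos ((x + 1) / 2) ltac:(lra)) as P2.
  replace (PI * ((x + 1) / 2)) with (PI * (x / 2) + PI / 2) in * by field.
  replace (PI * x) with (2 * (PI * (x / 2))) by field.
  rewrite sin_plus, cos_PI2, sin_PI2, sin_2a in *.
  pose proof (sin2_cos2 (PI * (x / 2))) as E. unfold Rsqr in E.
  set (s := sin (PI * (x / 2))) in *. set (c := cos (PI * (x / 2))) in *.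
  rewrite Rmult_0_r, Rplus_0_l, Rmult_1_r in *.
  replace ((PI / s) ^ 2 + (PI / c) ^ 2) with (PI ^ 2 * (s * s + c * c) / (s ^ 2 * c ^ 2))
    by (field; lra).
  rewrite E. field; lra. }
lra.
Qed.

(* Herglotz's trick: the defect is bounded, and the duplication formula halves
   any bound for it. *)
Lemma trigamma_reflection (x : R) : 0 < x < 1 ->
  Derive_n lnGamma 2 x + Derive_n lnGamma 2 (1 - x) = (PI / sin (PI * x)) ^ 2.
Proof.
intros Hx.
assert (H : forall k y, 0 < y < 1 -> Rabs (reflection_defect y) <= 56 * (/ 2) ^ k).
{ induction k as [|k IH]; intros y Hy.
  - rewrite pow_O, Rmult_1_r. now apply reflection_defect_bounded.
  - pose proof (IH (y / 2) ltac:(lra)) as H1. pose proof (IH ((y + 1) / 2) ltac:(lra)) as H2.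
    pose proof (reflection_defect_double y Hy) as H3.
    apply Rabs_le_between in H1. apply Rabs_le_between in H2. apply Rabs_le_between.
    simpl pow. lra. }
assert (E : reflection_defect x = 0).
{ apply (is_lim_seq_finite_unique (fun _ => reflection_defect x)); [apply is_lim_seq_const|].
  apply is_lim_seq_squeeze0 with (v := fun k => 56 * (/ 2) ^ k).
  - intros k. rewrite Rminus_0_r. now apply H.
  - replace (Finite 0) with (Rbar_mult 56 0) by (simpl; f_equal; ring).
    apply is_lim_seq_scal_l, is_lim_seq_geom. apply Rabs_lt_between; lra. }
unfold reflection_defect in E. lra.
Qed.

Lemma is_derive_comp_reflect (f : R -> R) (c x l : R) :
  is_derive f (c - x) l -> is_derive (fun y => f (c - y)) x (- l).
Proof.
intros H. apply is_derive_eq with (scal (-1) l); [|unfold scal; simpl; unfold mult; simpl; ring].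
apply (is_derive_comp f (fun y => c - y)); [exact H|]. auto_derive; auto; ring.
Qed.

(** The constant of integration is fixed at 1/2, where both sides vanish. *)
Lemma digamma_reflection (x : R) : 0 < x < 1 ->
  Derive_n lnGamma 1 (1 - x) - Derive_n lnGamma 1 x = PI * cot (PI * x).
Proof.
intros Hx.
set (h := fun y => Derive_n lnGamma 1 (1 - y) - Derive_n lnGamma 1 y - PI * cot (PI * y)).
assert (H0 : h (/ 2) = 0).
{ unfold h. replace (1 - / 2) with (/ 2) by lra. unfold cot.
  replace (PI * / 2) with (PI / 2) by reflexivity. rewrite cos_PI2. unfold Rdiv; ring. }
assert (H : h x = h (/ 2)); [|unfold h in *; lra].
apply (derive_zero_const h 0 1); try lra.
intros z Hz. pose proof (sin_PI_pos z Hz) as Hs.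
apply is_derive_eq with
  (- Derive_n lnGamma 2 (1 - z) - Derive_n lnGamma 2 z - (- (PI / sin (PI * z)) ^ 2)).
- apply (is_derive_minus (fun y => Derive_n lnGamma 1 (1 - y) - Derive_n lnGamma 1 y)
           (fun y => PI * cot (PI * y))).
  + apply (is_derive_minus (fun y => Derive_n lnGamma 1 (1 - y)) (Derive_n lnGamma 1)).
    * apply is_derive_comp_reflect, is_derive_lnGamma_n; lra.
    * apply is_derive_lnGamma_n; lra.
  + unfold cot. auto_derive; [lra|].
    pose proof (sin2_cos2 (PI * z)) as E. unfold Rsqr in E.
    set (s := sin (PI * z)) in *. set (c := cos (PI * z)) in *.
    apply Rmult_eq_reg_r with (s ^ 2); [|apply Rgt_not_eq, pow_lt, Hs].
    transitivity (- PI ^ 2 * (s * s + c * c)); [field; lra|rewrite E; field; lra].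
- rewrite <- trigamma_reflection by exact Hz. ring.
Qed.

(** The constant is ln PI in disguise; it is left unevaluated because it cancels in
    [log_sine_product]. *)
Lemma lnGamma_reflection (x : R) : 0 < x < 1 ->
  lnGamma x + lnGamma (1 - x) + ln (sin (PI * x)) = 2 * lnGamma (/ 2).
Proof.
intros Hx.
set (h := fun y => lnGamma y + lnGamma (1 - y) + ln (sin (PI * y))).
assert (H0 : h (/ 2) = 2 * lnGamma (/ 2)).
{ unfold h. replace (1 - / 2) with (/ 2) by lra.
  replace (PI * / 2) with (PI / 2) by reflexivity. rewrite sin_PI2, ln_1. ring. }
rewrite <- H0. change (h x = h (/ 2)).
apply (derive_zero_const h 0 1); try lra.
intros z Hz. pose proof (sin_PI_pos z Hz) as Hs.
apply is_derive_eq with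
  (Derive_n lnGamma 1 z + - Derive_n lnGamma 1 (1 - z) + PI * cot (PI * z)).
- apply (is_derive_plus (fun y => lnGamma y + lnGamma (1 - y)) (fun y => ln (sin (PI * y)))).
  + apply (is_derive_plus lnGamma (fun y => lnGamma (1 - y))).
    * apply (is_derive_lnGamma_n 0); lra.
    * apply is_derive_comp_reflect, (is_derive_lnGamma_n 0); lra.
  + auto_derive; [exact Hs|]. unfold cot. field; lra.
- rewrite <- digamma_reflection by exact Hz. ring.
Qed.

(** Euler's sine product divided by its value at 1/2: this normalization removes from the
    approximants both their growth in K and the constant of the reflection formula. *)
Lemma log_sine_product (x : R) : 0 < x < 1 ->
  is_lim_seq (psum (fun k => ln (x + INR k) + ln (1 - x + INR k) - 2 * ln (/ 2 + INR k)))
    (ln (sin (PI * x))).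
Proof.
intros Hx. apply is_lim_seq_incr_1.
replace (ln (sin (PI * x))) with (2 * lnGamma (/ 2) - (lnGamma x + lnGamma (1 - x)))
  by (rewrite <- (lnGamma_reflection x Hx); ring).
eapply is_lim_seq_ext; [|exact (is_lim_seq_minus' _ _ _ _
  (is_lim_seq_scal_l _ 2 _ (euler_limit (/ 2) ltac:(lra)))
  (is_lim_seq_plus' _ _ _ _ (euler_limit x Hx) (euler_limit (1 - x) ltac:(lra))))].
intros K. cbv beta. unfold euler_approx.
rewrite psum_minus, psum_plus, psum_scal. field.
Qed.

(** * Stirling's formula up to its constant, and the product of half-integers *)

Lemma ge_0_of_derive_ge_0 (f df : R -> R) (x : R) : 0 <= x ->
  (forall t, 0 <= t <= x -> is_derive f t (df t)) ->
  (forall t, 0 <= t <= x -> 0 <= df t) -> f 0 = 0 -> 0 <= f x.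
Proof.
intros Hx Hf Hd H0.
destruct (MVT_gen f 0 x df) as [c [Hc1 Hc2]]; rewrite ?Rmin_left, ?Rmax_right in * by lra.
- intros; apply Hf; lra.
- intros z Hz. apply continuity_pt_filterlim, (ex_derive_continuous f). eexists; apply Hf, Hz.
- specialize (Hd c Hc1). rewrite H0 in Hc2. nra.
Qed.

(** The midpoint rule underestimates the integral of the convex function 1/t. With x = 1/(2t+1) the
    claim reads ln((1+x)/(1-x)) >= 2x. *)
Lemma ln_succ_ge (t : R) : 0 < t -> / (t + / 2) <= ln (t + 1) - ln t.
Proof.
intros Ht. set (f := fun x => ln (1 + x) - ln (1 - x) - 2 * x).
assert (H : 0 <= f (/ (2 * t + 1))).
{ assert (0 < / (2 * t + 1)) by (apply Rinv_0_lt_compat; lra).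
  assert (/ (2 * t + 1) < 1) by (rewrite <- Rinv_1; apply Rinv_lt_contravar; lra).
  apply ge_0_of_derive_ge_0 with (df := fun x => 2 * x ^ 2 / (1 - x ^ 2)); [lra| | |].
  - intros y Hy. unfold f. auto_derive; [lra|]. field. nra.
  - intros y Hy. apply Rmult_le_pos; [nra|]. apply Rlt_le, Rinv_0_lt_compat. nra.
  - unfold f. rewrite Rplus_0_r, Rminus_0_r. ring. }
unfold f in H.
replace (1 + / (2 * t + 1)) with ((t + 1) * (2 / (2 * t + 1))) in H by (field; lra).
replace (1 - / (2 * t + 1)) with (t * (2 / (2 * t + 1))) in H by (field; lra).
assert (0 < 2 / (2 * t + 1)) by (apply Rdiv_lt_0_compat; lra).
rewrite !ln_mult in H by lra.
replace (/ (t + / 2)) with (2 * / (2 * t + 1)) by (field; lra). lra.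
Qed.

(** The trapezoidal rule overestimates the same integral; the substitution is y = 1/t. *)
Lemma ln_succ_le (t : R) : 0 < t -> ln (t + 1) - ln t <= (/ t + / (t + 1)) / 2.
Proof.
intros Ht. set (f := fun y => (y + 1 - / (1 + y)) / 2 - ln (1 + y)).
assert (H : 0 <= f (/ t)).
{ assert (0 < / t) by (apply Rinv_0_lt_compat; lra).
  apply ge_0_of_derive_ge_0 with (df := fun y => y ^ 2 / (2 * (1 + y) ^ 2)); [lra| | |].
  - intros y Hy. unfold f. auto_derive; [lra|]. field. lra.
  - intros y Hy. apply Rmult_le_pos; [nra|]. apply Rlt_le, Rinv_0_lt_compat. nra.
  - unfold f. rewrite Rplus_0_r, ln_1. field. }
unfold f in H.
replace (1 + / t) with ((t + 1) / t) in H by (field; lra).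
rewrite ln_div in H by lra.
replace (/ ((t + 1) / t)) with (1 - / (t + 1)) in H by (field; lra). lra.
Qed.

Definition stirling_defect (K : nat) : R :=
  ln (INR (fact K)) - (INR K + / 2) * ln (INR K) + INR K.

(** The difference is (K + 1/2)(ln(K+1) - ln K) - 1. The two quadrature bounds place it between 0
    and a telescoping quantity, so the gap from K to 2K tends to 0 although the limit of the defect
    is not computed. *)
Lemma stirling_defect_step (K : nat) : (1 <= K)%nat ->
  0 <= stirling_defect K - stirling_defect (S K) <= (/ INR K - / INR (S K)) / 4.
Proof.
intros HK. assert (H : 1 <= INR K) by (apply (le_INR 1), HK).
unfold stirling_defect. rewrite fact_simpl, mult_INR.
rewrite ln_mult by (try apply INR_fact_lt_0; apply lt_0_INR; lia).
rewrite S_INR. set (t := INR K) in *.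
pose proof (ln_succ_ge t ltac:(lra)) as L. pose proof (ln_succ_le t ltac:(lra)) as U.
apply (Rmult_le_compat_l (t + / 2)) in L; [|lra]. apply (Rmult_le_compat_l (t + / 2)) in U; [|lra].
rewrite Rinv_r in L by lra.
replace ((t + / 2) * ((/ t + / (t + 1)) / 2)) with (1 + (/ t - / (t + 1)) / 4) in U by (field; lra).
lra.
Qed.

Lemma stirling_defect_gap (K n : nat) : (1 <= K)%nat ->
  0 <= stirling_defect K - stirling_defect (K + n) <= (/ INR K - / INR (K + n)) / 4.
Proof.
intros HK. induction n as [|n IH]; [rewrite Nat.add_0_r; lra|].
pose proof (stirling_defect_step (K + n) ltac:(lia)).
replace (K + S n)%nat with (S (K + n)) by lia. lra.
Qed.

Lemma psum_ln_half (K : nat) :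
  psum (fun k => ln (/ 2 + INR k)) K
  = ln (INR (fact (2 * K))) - ln (INR (fact K)) - 2 * INR K * ln 2.
Proof.
induction K as [|K IH]; [simpl; ring|].
cbn [psum]. rewrite IH. replace (2 * S K)%nat with (S (S (2 * K))) by lia.
rewrite !fact_simpl, !mult_INR.
assert (HF := INR_fact_lt_0). pose proof (pos_INR K).
assert (E1 : INR (S (S (2 * K))) = 2 * INR (S K)) by (rewrite !S_INR, mult_INR; simpl (INR 2); ring).
assert (E2 : INR (S (2 * K)) = 2 * (/ 2 + INR K)) by (rewrite S_INR, mult_INR; simpl (INR 2); field).
rewrite E1, E2, S_INR. rewrite !ln_mult; try lra; try apply HF.
apply Rmult_lt_0_compat; [lra|apply HF].
Qed.

(** The half-integers multiply to (2K)!/(4^K K!). Stirling's constant cancels between the two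
    factorials, and the ln 2 left over is twice the term (1/2) ln 2 from the expansion of ln
    (2K)!. *)
Lemma log_half_product :
  is_lim_seq (fun K => 2 * psum (fun k => ln (/ 2 + INR k)) K - 2 * INR K * ln (INR K) + 2 * INR K)
    (ln 2).
Proof.
apply is_lim_seq_incr_1.
apply is_lim_seq_squeeze0 with (v := fun K => / INR (S K)); [|apply is_lim_seq_inv_INR_S].
intros K. rewrite psum_ln_half.
pose proof (stirling_defect_gap (S K) (S K) ltac:(lia)) as G.
replace (S K + S K)%nat with (2 * S K)%nat in G by lia.
unfold stirling_defect in G.
assert (P : 0 < INR (S K)) by (apply lt_0_INR; lia).
assert (E : INR (2 * S K) = 2 * INR (S K)) by (rewrite mult_INR; reflexivity).
rewrite E in G. rewrite ln_mult in G by lra.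
set (t := INR (S K)) in *. set (a := ln (INR (fact (2 * S K)))) in *. set (b := ln (INR (fact (S K)))) in *.
assert (0 < / t) by (apply Rinv_0_lt_compat; lra).
assert (0 < / (2 * t)) by (apply Rinv_0_lt_compat; lra).
apply Rabs_le_between. lra.
Qed.

Lemma log_product_asymptotics (x : R) : 0 < x < 1 ->
  is_lim_seq (fun K => psum (fun k => ln (x + INR k) + ln (1 - x + INR k)) K
                       - 2 * INR K * ln (INR K) + 2 * INR K)
    (ln (2 * sin (PI * x))).
Proof.
intros Hx. rewrite ln_mult by (try apply sin_PI_pos; lra).
eapply is_lim_seq_ext; [|exact (is_lim_seq_plus' _ _ _ _ log_half_product (log_sine_product x Hx))].
intros K. cbv beta. rewrite psum_minus, psum_scal. ring.
Qed.

(** * Derivatives of the cotangent *)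

(** Repeated differentiation of [digamma_reflection], with p = PI x. The second half records genuine
    differentiability, which the value of [Derive_n] does not imply. *)
Lemma cot_derivatives (m : nat) (p : R) : 0 < p < PI ->
  Derive_n cot m p = ((-1) ^ m * Derive_n lnGamma (S m) (1 - p / PI)
                      - Derive_n lnGamma (S m) (p / PI)) / PI ^ (S m)
  /\ is_derive (Derive_n cot m) p (Derive_n cot (S m) p).
Proof.
pose proof PI_RGT_0 as HPI.
set (C := fun j q => ((-1) ^ j * Derive_n lnGamma (S j) (1 - q / PI)
                      - Derive_n lnGamma (S j) (q / PI)) / PI ^ (S j)).
assert (HI : forall q, 0 < q < PI -> 0 < q / PI < 1).
{ intros q Hq. split; [apply Rdiv_lt_0_compat; lra|].
  apply Rmult_lt_reg_r with PI; [exact HPI|]. unfold Rdiv. rewrite Rmult_assoc, Rinv_l; lra. }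
assert (HC : forall j q, 0 < q < PI -> is_derive (C j) q (C (S j) q)).
{ intros j q Hq. specialize (HI q Hq).
  assert (D1 : is_derive (fun y => Derive_n lnGamma (S j) (y / PI)) q
            (scal (/ PI) (Derive_n lnGamma (S (S j)) (q / PI)))).
  { apply (is_derive_comp (Derive_n lnGamma (S j)) (fun y => y / PI)).
    - now apply is_derive_lnGamma_n.
    - auto_derive; auto. field; lra. }
  assert (D2 : is_derive (fun y => Derive_n lnGamma (S j) (1 - y / PI)) q
            (scal (- / PI) (Derive_n lnGamma (S (S j)) (1 - q / PI)))).
  { apply (is_derive_comp (Derive_n lnGamma (S j)) (fun y => 1 - y / PI)).
    - apply is_derive_lnGamma_n; lra.
    - auto_derive; auto. field; lra. }
  apply is_derive_eq with
    (/ PI ^ (S j) * ((-1) ^ j * scal (- / PI) (Derive_n lnGamma (S (S j)) (1 - q / PI))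
                      - scal (/ PI) (Derive_n lnGamma (S (S j)) (q / PI)))).
  - apply (is_derive_ext (fun y => / PI ^ (S j) * ((-1) ^ j * Derive_n lnGamma (S j) (1 - y / PI)
                      - Derive_n lnGamma (S j) (y / PI)))).
    + intros t. unfold C, Rdiv. apply Rmult_comm.
    + apply (is_derive_scal (fun y => (-1) ^ j * Derive_n lnGamma (S j) (1 - y / PI)
                      - Derive_n lnGamma (S j) (y / PI))).
      apply (is_derive_minus (fun y => (-1) ^ j * Derive_n lnGamma (S j) (1 - y / PI))
                      (fun y => Derive_n lnGamma (S j) (y / PI))); [|exact D1].
      apply (is_derive_scal (fun y => Derive_n lnGamma (S j) (1 - y / PI))). exact D2.
  - unfold C, scal; simpl; unfold mult; simpl. field. repeat split; try apply pow_nonzero; lra. }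
assert (HE : forall j q, 0 < q < PI -> Derive_n cot j q = C j q).
{ induction j as [|j IH]; intros q Hq.
  - unfold C. pose proof (digamma_reflection (q / PI) (HI q Hq)) as E.
    replace (PI * (q / PI)) with q in E by (field; lra).
    rewrite pow_O, Rmult_1_l, E, pow_1. change (cot q = PI * cot q / PI). field; lra.
  - change (Derive (Derive_n cot j) q = C (S j) q).
    rewrite (Derive_ext_loc _ (C j)).
    + apply is_derive_unique, HC, Hq.
    + apply (locally_Ioo 0 PI); auto. }
intros Hp. split; [apply HE, Hp|].
rewrite (HE (S m) p Hp).
apply (is_derive_ext_loc (C m)); [|apply HC, Hp].
apply (locally_Ioo 0 PI); [exact Hp|]. intros y Hy. symmetry. apply HE, Hy.
Qed.

Lemma scrH_lnGamma (r : nat) (x : R) : (1 <= r)%nat -> 0 < x < 1 ->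
  scrH (2 * r - 1) x
  = - (1 / PI ^ (2 * r)) * (Derive_n lnGamma (2 * r) x + Derive_n lnGamma (2 * r) (1 - x)).
Proof.
intros Hr Hx. pose proof PI_RGT_0. unfold scrH.
rewrite (proj1 (cot_derivatives (2 * r - 1) (PI * x) ltac:(nra))).
replace (PI * x / PI) with x by (field; lra).
replace (S (2 * r - 1)) with (2 * r)%nat by lia.
destruct r as [|r]; [lia|].
replace (2 * S r - 1)%nat with (S (2 * r)) by lia.
rewrite pow_1_odd. field. apply pow_nonzero; lra.
Qed.

Lemma scrH_polygamma (r : nat) (x : R) : (1 <= r)%nat -> 0 < x < 1 ->
  scrH (2 * r - 1) x
  = - (1 / PI ^ (2 * r)) * (polygamma (2 * r - 1) x + polygamma (2 * r - 1) (1 - x)).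
Proof.
intros Hr Hx. rewrite scrH_lnGamma, !polygamma_lnGamma by (auto; lra).
now replace (S (2 * r - 1)) with (2 * r)%nat by lia.
Qed.

(** The differentiated partial fractions of cot: a sum over all integers, folded at 0 into two
    Hurwitz sums. All terms being positive, the sign of [scrH] becomes visible. *)
Lemma scrH_lim (r : nat) (x : R) : (1 <= r)%nat -> 0 < x < 1 ->
  is_lim_seq (psum (fun k => / (x + INR k) ^ (2 * r) + / (1 - x + INR k) ^ (2 * r)))
    (- (PI ^ (2 * r) / INR (fact (2 * r - 1))) * scrH (2 * r - 1) x).
Proof.
intros Hr Hx. rewrite scrH_lnGamma by auto.
assert (L1 := hurwitz_lim (2 * r - 2) x Hx).
assert (L2 := hurwitz_lim (2 * r - 2) (1 - x) ltac:(lra)).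
replace (2 * r - 2 + 2)%nat with (2 * r)%nat in L1, L2 by lia.
replace (S (S (2 * r - 2))) with (2 * r)%nat in L1, L2 by lia.
replace (S (2 * r - 2)) with (2 * r - 1)%nat in L1, L2 by lia.
assert (E : (-1) ^ (2 * r - 2) = 1).
{ replace (2 * r - 2)%nat with (2 * (r - 1))%nat by lia. apply pow_1_even. }
rewrite E in L1, L2.
assert (HP : PI ^ (2 * r) <> 0) by (apply pow_nonzero, PI_neq0).
pose proof (INR_fact_neq_0 (2 * r - 1)).
replace (Finite _) with (Finite (1 / INR (fact (2 * r - 1)) * Derive_n lnGamma (2 * r) x +
   1 / INR (fact (2 * r - 1)) * Derive_n lnGamma (2 * r) (1 - x))) by (f_equal; field; auto).
eapply is_lim_seq_ext; [|apply is_lim_seq_plus'; [exact L1|exact L2]].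
intros K. cbv beta. now rewrite psum_plus.
Qed.

Lemma psum_lower_bound_lim (f : nat -> R) (l : R) :
  (forall k, 0 <= f k) -> is_lim_seq (psum f) l -> f O <= l.
Proof.
intros Hf L. apply is_lim_seq_incr_1 in L.
refine (is_lim_seq_le (fun _ => f O) _ (Finite _) (Finite _) _ (is_lim_seq_const _) L).
intros K. apply (psum_ge_term f (S K) 0); [auto|lia].
Qed.

Lemma inv_pow_pos (x : R) (n : nat) : 0 < x -> 0 < / x ^ n.
Proof. intros; apply Rinv_0_lt_compat, pow_lt; auto. Qed.

Lemma scrH_neg (r : nat) (x : R) : (1 <= r)%nat -> 0 < x < 1 -> scrH (2 * r - 1) x < 0.
Proof.
intros Hr Hx. assert (L := scrH_lim r x Hr Hx).
apply psum_lower_bound_lim in L.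
- simpl (INR 0) in L. rewrite !Rplus_0_r in L.
  pose proof (inv_pow_pos x (2 * r) ltac:(lra)). pose proof (inv_pow_pos (1 - x) (2 * r) ltac:(lra)).
  assert (0 < PI ^ (2 * r) / INR (fact (2 * r - 1))).
  { apply Rdiv_lt_0_compat; [apply pow_lt, PI_RGT_0|apply INR_fact_lt_0]. }
  nra.
- intros k. pose proof (pos_INR k).
  pose proof (inv_pow_pos (x + INR k) (2 * r) ltac:(lra)).
  pose proof (inv_pow_pos (1 - x + INR k) (2 * r) ltac:(lra)). lra.
Qed.

(** * Even power series *)

Lemma is_series_ext_R (a b : nat -> R) (l : R) :
  (forall n, a n = b n) -> is_series a l -> is_series b l.
Proof. apply is_series_ext. Qed.

Lemma CV_radius_gt (a : nat -> R) (rho x : R) :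
  (forall z, 0 < z < rho -> ex_pseries a z) -> Rabs x < rho ->
  Rbar_lt (Rabs x) (CV_radius a).
Proof.
intros H Hx. apply Rbar_not_le_lt. intros Hle.
set (z := (Rabs x + rho) / 2). pose proof (Rabs_pos x).
assert (Hz : 0 < z < rho) by (unfold z; lra).
apply (CV_disk_outside a z).
- apply Rbar_le_lt_trans with (1 := Hle). simpl. rewrite (Rabs_pos_eq z) by lra. unfold z; lra.
- destruct (H z Hz) as [l Hl]. apply ex_series_lim_0. exists l. exact (proj1 (is_pseries_R a z l) Hl).
Qed.

(** The point 0 is excluded because the closed forms are 0/0 there. Multiplying both series by z
    makes them agree at 0 as well, which only shifts the coefficients. *)
Lemma pseries_unique (a b : nat -> R) (rho : R) (n : nat) : 0 < rho ->
  (forall z, z <> 0 -> Rabs z < rho -> exists l, is_pseries a z l /\ is_pseries b z l) ->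
  a n = b n.
Proof.
intros Hrho H.
assert (E : forall c, (forall z, z <> 0 -> Rabs z < rho -> ex_pseries c z) ->
   Rbar_lt 0 (CV_radius (PS_incr_1 c))).
{ intros c Hc. rewrite CV_radius_incr_1, <- Rabs_R0. apply (CV_radius_gt c rho).
  - intros z Hz. apply Hc; [lra|]. rewrite Rabs_pos_eq; lra.
  - rewrite Rabs_R0. exact Hrho. }
change (PS_incr_1 a (S n) = PS_incr_1 b (S n)).
apply PSeries_ext_recip.
- apply E. intros z Hz Hz'. destruct (H z Hz Hz') as [l [Hl _]]. now exists l.
- apply E. intros z Hz Hz'. destruct (H z Hz Hz') as [l [_ Hl]]. now exists l.
- apply (locally_Ioo (- rho) rho); [lra|]. intros z Hz.
  rewrite !PSeries_incr_1. destruct (Req_dec z 0) as [->|Hz0]; [ring|]. f_equal.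
  destruct (H z Hz0) as [l [H1 H2]]; [apply Rabs_lt_between; lra|].
  now rewrite (is_pseries_unique _ _ _ H1), (is_pseries_unique _ _ _ H2).
Qed.

(** Turns a series in z^2 into one in z, to which uniqueness of coefficients and Taylor's formula
    apply. *)
Definition even_interleave (a : nat -> R) (n : nat) : R :=
  if Nat.even n then a (Nat.div2 n) else 0.

Definition odd_interleave (a : nat -> R) (n : nat) : R :=
  if Nat.even n then 0 else a (Nat.div2 n).

Lemma even_interleave_double (a : nat -> R) (n : nat) :
  even_interleave a (2 * n) = a n /\ even_interleave a (2 * n + 1) = 0.
Proof.
unfold even_interleave. replace (2 * n + 1)%nat with (S (2 * n)) by lia.
rewrite Nat.div2_double. rewrite Nat.even_succ, <- Nat.negb_even, Nat.even_mul.
split; reflexivity.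
Qed.

Lemma odd_interleave_double (a : nat -> R) (n : nat) :
  odd_interleave a (2 * n) = 0 /\ odd_interleave a (2 * n + 1) = a n.
Proof.
unfold odd_interleave. replace (2 * n + 1)%nat with (S (2 * n)) by lia.
rewrite Nat.div2_succ_double. rewrite Nat.even_succ, <- Nat.negb_even, Nat.even_mul.
split; reflexivity.
Qed.

Lemma is_pseries_zero (x : R) : is_pseries (fun _ => 0) x 0.
Proof.
apply is_pseries_R. apply is_series_psum.
apply (is_lim_seq_ext (fun _ => 0)); [|apply is_lim_seq_const].
intros n. rewrite (psum_ext _ (fun _ => 0)) by (intros; ring). rewrite psum_const; ring.
Qed.

Lemma is_pseries_even_interleave (a : nat -> R) (z l : R) :
  is_pseries a (z ^ 2) l -> is_pseries (even_interleave a) z l.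
Proof.
intros H. replace l with (l + z * 0) by ring.
apply is_pseries_odd_even.
- eapply is_pseries_ext; [|exact H]. intros n; symmetry; apply even_interleave_double.
- eapply is_pseries_ext; [|apply is_pseries_zero].
  intros n; symmetry; apply even_interleave_double.
Qed.

Lemma is_pseries_odd_interleave (a : nat -> R) (z l : R) :
  is_pseries a (z ^ 2) l -> is_pseries (odd_interleave a) z (z * l).
Proof.
intros H. replace (z * l) with (0 + z * l) by ring.
apply is_pseries_odd_even.
- eapply is_pseries_ext; [|apply is_pseries_zero].
  intros n; symmetry; apply odd_interleave_double.
- eapply is_pseries_ext; [|exact H]. intros n; symmetry; apply odd_interleave_double.
Qed.

Lemma even_pseries_unique (a b : nat -> R) (rho : R) (n : nat) : 0 < rho ->
  (forall z, 0 < z < rho -> exists l, is_pseries a (z ^ 2) l /\ is_pseries b (z ^ 2) l) ->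
  a n = b n.
Proof.
intros Hrho H.
rewrite <- (proj1 (even_interleave_double a n)), <- (proj1 (even_interleave_double b n)).
apply pseries_unique with rho; [exact Hrho|]. intros z Hz0 Hz.
destruct (H (Rabs z)) as [l [H1 H2]]; [split; [now apply Rabs_pos_lt|exact Hz]|].
rewrite RPow_abs, Rabs_pos_eq in H1, H2 by apply pow2_ge_0.
exists l. split; now apply is_pseries_even_interleave.
Qed.

(** Absolute convergence is not invoked: partial sums of even length at z and -z combine exactly to
    partial sums of the even and of the odd part. *)
Lemma is_pseries_parts (a : nat -> R) (z l l' : R) : z <> 0 ->
  is_pseries a z l -> is_pseries a (- z) l' ->
  is_pseries (fun k => a (2 * k)%nat) (z ^ 2) ((l + l') / 2) /\
  is_pseries (fun k => a (2 * k + 1)%nat) (z ^ 2) ((l - l') / (2 * z)).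
Proof.
intros Hz H H'.
apply is_pseries_R, is_series_psum in H. apply is_pseries_R, is_series_psum in H'.
assert (X := is_lim_seq_mul_subseq _ _ 2 ltac:(lia) H).
assert (X' := is_lim_seq_mul_subseq _ _ 2 ltac:(lia) H').
assert (E1 : forall k, z ^ (2 * k) = (z ^ 2) ^ k) by (intros; apply pow_mult).
assert (E2 : forall k, (- z) ^ (2 * k) = (z ^ 2) ^ k) by (intros; rewrite pow_mult; f_equal; ring).
assert (E3 : forall k, z ^ (2 * k + 1) = z * (z ^ 2) ^ k) by (intros; rewrite pow_add, E1; ring).
assert (E4 : forall k, (- z) ^ (2 * k + 1) = - (z * (z ^ 2) ^ k)) by (intros; rewrite pow_add, E2; ring).
split; apply is_pseries_R, is_series_psum.
- unfold Rdiv; rewrite Rmult_comm.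
  eapply is_lim_seq_ext; [|exact (is_lim_seq_scal_l _ (/ 2) _ (is_lim_seq_plus' _ _ _ _ X X'))].
  intros K. cbv beta. rewrite (Nat.mul_comm K), <- !psum_double, <- psum_plus, <- psum_scal.
  apply psum_ext. intros k _. rewrite E1, E2, E3, E4. field.
- unfold Rdiv; rewrite Rmult_comm.
  eapply is_lim_seq_ext; [|exact (is_lim_seq_scal_l _ (/ (2 * z)) _ (is_lim_seq_minus' _ _ _ _ X X'))].
  intros K. cbv beta. rewrite (Nat.mul_comm K), <- !psum_double, <- psum_minus, <- psum_scal.
  apply psum_ext. intros k _. rewrite E1, E2, E3, E4. field. auto.
Qed.

Lemma is_pseries_psum (a : nat -> nat -> R) (x : R) (l : nat -> R) (n : nat) :
  (forall i, (i < n)%nat -> is_pseries (a i) x (l i)) ->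
  is_pseries (fun k => psum (fun i => a i k) n) x (psum l n).
Proof.
induction n as [|n IH]; intros H; simpl.
- apply is_pseries_zero.
- apply (is_pseries_plus (fun k => psum (fun i => a i k) n) (a n)); auto.
Qed.

Lemma is_pseries_mulc (a : nat -> R) (c x l : R) :
  is_pseries a x l -> is_pseries (fun k => c * a k) x (c * l).
Proof. intros H. apply (is_pseries_scal c a); [apply Rmult_comm|exact H]. Qed.

(* An identity between products of power series in z^2 with z real holds for the
   coefficients, and so remains valid at the arguments -z^2. *)
Lemma even_product_identity (a b c : nat -> R) (f g : R -> R) (rho : R) : 0 < rho ->
  (forall z, 0 < z < rho -> is_pseries a (z ^ 2) (f z)) ->
  (forall z, 0 < z < rho -> is_pseries b (z ^ 2) (g z)) ->
  (forall z, 0 < z < rho -> is_pseries c (z ^ 2) (f z * g z)) ->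
  (forall n, PS_mult a b n = c n) /\
  (forall z, Rabs z < rho -> ex_pseries a (- z ^ 2) /\
     PSeries a (- z ^ 2) * PSeries b (- z ^ 2) = PSeries c (- z ^ 2)).
Proof.
intros Hrho Ha Hb Hc.
assert (R : forall d h, (forall z, 0 < z < rho -> is_pseries d (z ^ 2) (h z)) ->
   forall w, Rabs w < rho ^ 2 -> Rbar_lt (Rabs w) (CV_radius d)).
{ intros d h Hd w Hw. apply (CV_radius_gt d (rho ^ 2)); [|exact Hw].
  intros y Hy. exists (h (sqrt y)).
  assert (Hs : 0 < sqrt y < rho).
  { split; [apply sqrt_lt_R0; lra|]. rewrite <- (sqrt_pow2 rho) by lra. apply sqrt_lt_1; lra. }
  generalize (Hd (sqrt y) Hs). rewrite pow2_sqrt by lra. auto. }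
assert (Q : forall z, Rabs z < rho -> Rabs (z ^ 2) < rho ^ 2).
{ intros z Hz. rewrite <- RPow_abs. pose proof (Rabs_pos z). simpl. nra. }
assert (M : forall n, PS_mult a b n = c n).
{ intros n. apply even_pseries_unique with rho; [exact Hrho|]. intros z Hz.
  exists (f z * g z). split; [|auto].
  assert (Rabs (z ^ 2) < rho ^ 2) by (apply Q; rewrite Rabs_pos_eq; lra).
  apply is_pseries_mult; auto; eapply R; eauto. }
split; [exact M|]. intros z Hz.
assert (Hw : Rabs (- z ^ 2) < rho ^ 2) by (rewrite Rabs_Ropp; auto).
split; [apply CV_radius_inside; eapply R; eauto|].
rewrite <- PSeries_mult by (eapply R; eauto).
apply PSeries_ext. exact M.
Qed.

Lemma is_pseries_cos (y c : R) :
  is_pseries (fun k => c ^ (2 * k) / INR (fact (2 * k))) (- y ^ 2) (cos (c * y)).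
Proof.
apply is_pseries_R. apply is_series_Reals.
assert (H : cos_in (Rsqr (c * y)) (cos (c * y))).
{ unfold cos. destruct (exist_cos (Rsqr (c * y))); auto. }
unfold cos_in in H. apply is_series_Reals. apply is_series_Reals in H.
eapply is_series_ext_R; [|exact H]. intros k. cbv beta. unfold cos_n.
replace (Rsqr (c * y)) with (c ^ 2 * y ^ 2) by (unfold Rsqr; ring).
replace (- y ^ 2) with (-1 * y ^ 2) by ring.
rewrite !Rpow_mult_distr, (pow_mult c). unfold Rdiv. ring.
Qed.

(** Coefficients of sinh(z/2)/(z/2) in powers of z^2; evaluated at -z^2 they give sin(z/2)/(z/2). *)
Definition sinhc_coef (k : nat) : R := / (4 ^ k * INR (fact (2 * k + 1))).

Lemma is_pseries_sinc (y : R) : y <> 0 ->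
  is_pseries sinhc_coef (- y ^ 2) (sin (y / 2) / (y / 2)).
Proof.
intros Hy. apply is_pseries_R.
assert (H : exists l, sin (y / 2) = y / 2 * l /\ sin_in (Rsqr (y / 2)) l).
{ unfold sin. destruct (exist_sin (Rsqr (y / 2))) as [l Hl]. now exists l. }
destruct H as [l [-> H]]. replace (y / 2 * l / (y / 2)) with l by (field; auto).
unfold sin_in in H. apply is_series_Reals in H.
eapply is_series_ext_R; [|exact H]. intros k. cbv beta. unfold sin_n, sinhc_coef.
replace (Rsqr (y / 2)) with (/ 4 * y ^ 2) by (unfold Rsqr; field).
replace (- y ^ 2) with (-1 * y ^ 2) by ring.
rewrite !Rpow_mult_distr, Rinv_mult, pow_inv. unfold Rdiv. ring.
Qed.

Lemma is_pseries_sinhc (z : R) : z <> 0 ->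
  is_pseries sinhc_coef (z ^ 2) ((exp (z / 2) - exp (- (z / 2))) / z).
Proof.
intros Hz. assert (Hz2 : z / 2 <> 0) by lra.
pose proof (proj2 (is_pseries_parts _ _ _ _ Hz2 (is_exp_Reals (z / 2)) (is_exp_Reals (- (z / 2))))) as H.
replace (2 * (z / 2)) with z in H by field.
apply is_pseries_R in H. apply is_pseries_R. eapply is_series_ext_R; [|exact H].
intros k. cbv beta. unfold sinhc_coef. replace ((z / 2) ^ 2) with (/ 4 * z ^ 2) by field.
rewrite Rpow_mult_distr, Rinv_mult, pow_inv. ring.
Qed.

Lemma is_pseries_cosh (c z : R) : z <> 0 ->
  is_pseries (fun k => c ^ (2 * k) / INR (fact (2 * k))) (z ^ 2)
     ((exp (c * z) + exp (- (c * z))) / 2).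
Proof.
(* The case c = 0 is the one that occurs for B_2k(1/2). It is separate because [is_pseries_parts]
   divides by its argument; the constant term is then 0^0 = 1. *)
intros Hz. destruct (Req_dec c 0) as [->|Hc].
- rewrite Rmult_0_l, Ropp_0, exp_0. replace ((1 + 1) / 2) with 1 by field.
  apply is_pseries_R, is_series_psum, is_lim_seq_incr_1.
  apply (is_lim_seq_ext (fun _ => 1)); [|apply is_lim_seq_const].
  intros n. rewrite psum_head. rewrite (psum_ext _ (fun _ => 0)).
  + rewrite psum_const. simpl; field.
  + intros i _. rewrite pow_i by lia. unfold Rdiv; ring.
- assert (Hcz : c * z <> 0) by (apply Rmult_integral_contrapositive; auto).
  pose proof (proj1 (is_pseries_parts _ _ _ _ Hcz (is_exp_Reals (c * z)) (is_exp_Reals (- (c * z))))) as H.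
  apply is_pseries_R in H. apply is_pseries_R. eapply is_series_ext_R; [|exact H].
  intros k. cbv beta. replace ((c * z) ^ 2) with (c ^ 2 * z ^ 2) by ring.
  rewrite Rpow_mult_distr, (pow_mult c). unfold Rdiv; ring.
Qed.

(** * Bernoulli polynomials *)

Definition bernoulli_coef (B : nat -> R -> R) (x : R) (k : nat) : R :=
  B (2 * k)%nat x / INR (fact (2 * k)).

Lemma exp_minus_1_neq0 (z : R) : z <> 0 -> exp z - 1 <> 0.
Proof.
intros Hz E. apply Hz. rewrite <- (ln_exp z). replace (exp z) with 1 by lra. apply ln_1.
Qed.

Lemma is_pseries_bernoulli_coef (B : nat -> R -> R) (x z : R) :
  bernoulli_polynomials B -> 0 < z < 2 * PI ->
  is_pseries (bernoulli_coef B x) (z ^ 2)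
    (z * (exp ((x - / 2) * z) + exp (- ((x - / 2) * z))) / 2
     / (exp (z / 2) - exp (- (z / 2)))).
Proof.
intros HB Hz.
assert (Hz0 : z <> 0) by lra.
assert (H1 := HB x z ltac:(lra) ltac:(rewrite Rabs_pos_eq; lra)).
assert (H2 := HB x (- z) ltac:(lra) ltac:(rewrite Rabs_Ropp, Rabs_pos_eq; lra)).
pose proof (proj1 (is_pseries_parts _ _ _ _ Hz0 H1 H2)) as H.
unfold bernoulli_coef. match goal with |- is_pseries _ _ ?r => match type of H with is_pseries _ _ ?l =>
  replace r with l; [exact H|] end end.
(* In terms of [e] and [u] below, the symmetrized generating function is a rational expression and
   [field] decides. *)
set (e := exp (z / 2)). assert (He : 0 < e) by apply exp_pos.
assert (E1 : exp z = e * e) by (unfold e; rewrite <- exp_plus; f_equal; field).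
assert (E2 : exp (- (z / 2)) = / e) by apply exp_Ropp.
assert (E3 : exp (- z) = / (e * e)) by (rewrite exp_Ropp, E1; reflexivity).
set (u := exp ((x - / 2) * z)). assert (Hu : 0 < u) by apply exp_pos.
assert (E4 : exp (x * z) = u * e) by (unfold u, e; rewrite <- exp_plus; f_equal; field).
assert (E5 : exp (x * - z) = / (u * e)) by (rewrite Ropp_mult_distr_r_reverse, exp_Ropp, E4; reflexivity).
rewrite E2, E3, E4, E5, exp_Ropp. fold u. rewrite E1.
pose proof (exp_minus_1_neq0 z Hz0) as N. rewrite E1 in N.
field. repeat split; lra.
Qed.

Lemma bernoulli_product (B : nat -> R -> R) (x : R) : bernoulli_polynomials B ->
  (forall n, PS_mult (bernoulli_coef B x) sinhc_coef n
             = (x - / 2) ^ (2 * n) / INR (fact (2 * n))) /\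
  (forall z, Rabs z < 2 * PI -> ex_pseries (bernoulli_coef B x) (- z ^ 2) /\
     PSeries (bernoulli_coef B x) (- z ^ 2) * PSeries sinhc_coef (- z ^ 2)
     = PSeries (fun k => (x - / 2) ^ (2 * k) / INR (fact (2 * k))) (- z ^ 2)).
Proof.
intros HB. pose proof PI_RGT_0.
apply (even_product_identity _ _ _
   (fun z => z * (exp ((x - / 2) * z) + exp (- ((x - / 2) * z))) / 2 / (exp (z / 2) - exp (- (z / 2))))
   (fun z => (exp (z / 2) - exp (- (z / 2))) / z)); [lra| | |].
- intros z Hz. now apply is_pseries_bernoulli_coef.
- intros z Hz. apply is_pseries_sinhc; lra.
- intros z Hz.
  replace (_ * _) with ((exp ((x - / 2) * z) + exp (- ((x - / 2) * z))) / 2).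
  + apply is_pseries_cosh; lra.
  + assert (exp (- (z / 2)) < exp (z / 2)) by (apply exp_increasing; lra).
    field. lra.
Qed.

Lemma is_pseries_bernoulli_coef_neg (B : nat -> R -> R) (x z : R) :
  bernoulli_polynomials B -> z <> 0 -> Rabs z < 2 * PI -> sin (z / 2) <> 0 ->
  is_pseries (bernoulli_coef B x) (- z ^ 2) (z / 2 * cos ((x - / 2) * z) / sin (z / 2)).
Proof.
intros HB Hz0 Hz Hs.
destruct (proj2 (bernoulli_product B x HB) z Hz) as [Hex E].
apply PSeries_correct in Hex.
assert (E1 : PSeries sinhc_coef (- z ^ 2) = sin (z / 2) / (z / 2))
  by apply is_pseries_unique, is_pseries_sinc, Hz0.
rewrite E1, (is_pseries_unique _ _ _ (is_pseries_cos z (x - / 2))) in E.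
replace (z / 2 * _ / _) with (PSeries (bernoulli_coef B x) (- z ^ 2)); [exact Hex|].
rewrite <- E. field. auto.
Qed.

Lemma bernoulli_coef_0 (B : nat -> R -> R) (x : R) : bernoulli_polynomials B ->
  bernoulli_coef B x 0 = 1.
Proof.
intros HB. pose proof (proj1 (bernoulli_product B x HB) 0%nat) as H.
unfold PS_mult, sinhc_coef in H. simpl in H.
rewrite Rmult_1_l, Rinv_1, Rmult_1_r in H. rewrite H. field.
Qed.

(** * Cosine sums of Bernoulli polynomials as derivatives of the cotangent *)

Lemma psum_cos (al de : R) (n : nat) :
  psum (fun s => cos (INR (S s) * (2 * al) - de)) n * (2 * sin al)
  = sin ((2 * INR n + 1) * al - de) - sin (al - de).
Proof.
rewrite Rmult_comm, <- psum_scal.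
rewrite (psum_ext _ (fun s => sin ((2 * INR (S s) + 1) * al - de) - sin ((2 * INR s + 1) * al - de))).
- rewrite (psum_telescope (fun s => sin ((2 * INR s + 1) * al - de))).
  simpl (INR 0). replace ((2 * 0 + 1) * al - de) with (al - de) by ring. reflexivity.
- intros s _. rewrite S_INR.
  replace ((2 * (INR s + 1) + 1) * al - de) with (((INR s + 1) * (2 * al) - de) + al) by ring.
  replace ((2 * INR s + 1) * al - de) with (((INR s + 1) * (2 * al) - de) - al) by ring.
  generalize ((INR s + 1) * (2 * al) - de). intros t. rewrite sin_plus, sin_minus. ring.
Qed.

Lemma sin_period_Z (x : R) (k : nat) : sin (x - 2 * INR k * PI) = sin x.
Proof. rewrite <- (sin_period (x - 2 * INR k * PI) k). f_equal. ring. Qed.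

Lemma is_derive_comp_shift (f : R -> R) (c x l : R) :
  is_derive f (c + x) l -> is_derive (fun y => f (c + y)) x l.
Proof.
intros H. apply is_derive_eq with (scal 1 l); [|unfold scal; simpl; unfold mult; simpl; ring].
apply (is_derive_comp f (fun y => c + y)); [exact H|]. auto_derive; auto; ring.
Qed.

(** At h = 0 and odd m the two terms add up to twice the derivative of cot at p. The range of h
    keeps both arguments inside (0, PI). *)
Lemma Derive_n_cot_gap (m : nat) (p d h : R) : 0 < d -> d <= p -> d <= PI - p -> - d < h < d ->
  Derive_n (fun h => cot (p + h) - cot (p - h)) m h
  = Derive_n cot m (p + h) - (-1) ^ m * Derive_n cot m (p - h).
Proof.
intros Hd H1 H2. revert h. induction m as [|m IH]; intros h Hh.
- simpl. ring.
- change (Derive (Derive_n (fun h => cot (p + h) - cot (p - h)) m) h =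
    Derive_n cot (S m) (p + h) - (-1) ^ S m * Derive_n cot (S m) (p - h)).
  rewrite (Derive_ext_loc _ (fun h => Derive_n cot m (p + h) - (-1) ^ m * Derive_n cot m (p - h))).
  + apply is_derive_unique. apply is_derive_eq with
      (Derive_n cot (S m) (p + h) - (-1) ^ m * - Derive_n cot (S m) (p - h)); [|simpl pow; ring].
    apply (is_derive_minus (fun h => Derive_n cot m (p + h))
             (fun h => (-1) ^ m * Derive_n cot m (p - h))).
    * apply is_derive_comp_shift, cot_derivatives; lra.
    * apply (is_derive_scal (fun h => Derive_n cot m (p - h))).
      apply is_derive_comp_reflect, cot_derivatives; lra.
  + apply (locally_Ioo (- d) d); auto.
Qed.

(** With p = PI nu/n, both sides are read off from the Taylor coefficients of cot(p+h) - cot(p-h).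
    The other expansion comes from the generating functions at z = 2nh: since n p is a multiple of
    PI, their cosine sum has a closed form. *)
Lemma scrH_bernoulli (B : nat -> R -> R) (n nu r : nat) : bernoulli_polynomials B ->
  (1 <= nu < n)%nat -> (1 <= r)%nat ->
  scrH (2 * r - 1) (INR nu / INR n)
  = (-1) ^ r * ((2 * INR n) ^ (2 * r - 1) / INR r)
    * psum (fun s => B (2 * r)%nat (INR (S s) / INR n)
                     * cos (2 * PI * INR (S s) * INR nu / INR n)) n.
Proof.
intros HB Hnu Hr.
assert (Hnu0 : 0 < INR nu) by (apply lt_0_INR; lia).
assert (Hnun : INR nu < INR n) by (apply lt_INR; lia).
pose proof PI_RGT_0 as HPI.
set (p := PI * (INR nu / INR n)).
assert (Hp : 0 < p < PI).
{ unfold p. assert (0 < INR nu / INR n < 1); [|nra].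
  split; [apply Rdiv_lt_0_compat; lra|].
  apply Rmult_lt_reg_r with (INR n); [lra|]. unfold Rdiv. rewrite Rmult_assoc, Rinv_l; lra. }
assert (Hnp : INR n * p = INR nu * PI) by (unfold p; field; lra).
set (A := fun k => psum (fun s => cos (2 * PI * INR (S s) * INR nu / INR n)
                                  * bernoulli_coef B (INR (S s) / INR n) k) n).
(* For |h| < d both p + h and p - h lie in (0, PI), and |2nh| is within the radius 2 PI. *)
set (d := Rmin (Rmin p (PI - p)) (PI / INR n)).
assert (Hd : 0 < d).
{ apply Rmin_pos; [apply Rmin_pos; lra|apply Rdiv_lt_0_compat; lra]. }
assert (Hd1 : d <= p) by (eapply Rle_trans; apply Rmin_l).
assert (Hd2 : d <= PI - p) by (eapply Rle_trans; [apply Rmin_l|apply Rmin_r]).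
assert (Hd3 : d * INR n <= PI).
{ replace PI with (PI / INR n * INR n) by (field; lra). apply Rmult_le_compat_r; [lra|apply Rmin_r]. }
(* The cosines of a full period sum to 0; this lets the factor n h / 2 be divided out of the series
   below. *)
assert (HA0 : A 0%nat = 0).
{ unfold A. rewrite (psum_ext _ (fun s => cos (INR (S s) * (2 * p) - 0))).
  - apply Rmult_eq_reg_r with (2 * sin p); [|pose proof (sin_gt_0 p); lra].
    rewrite psum_cos, Rmult_0_l, !Rminus_0_r.
    replace ((2 * INR n + 1) * p) with (p + 2 * INR nu * PI) by lra.
    rewrite sin_period. ring.
  - intros s _. rewrite bernoulli_coef_0, Rmult_1_r by exact HB. f_equal. unfold p. field. lra. }
assert (HD : forall h, h <> 0 -> - d < h < d ->
   is_pseries A (- (2 * INR n * h) ^ 2) (INR n * h / 2 * (cot (p + h) - cot (p - h)))).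
{ intros h Hh0 Hh.
  assert (Hnh : - PI < INR n * h < PI) by nra.
  assert (Hnh0 : INR n * h <> 0) by (apply Rmult_integral_contrapositive; split; lra).
  assert (Hs : sin (INR n * h) <> 0).
  { destruct (Rlt_or_le 0 (INR n * h)).
    - apply Rgt_not_eq, sin_gt_0; lra.
    - apply Rlt_not_eq. rewrite <- (Ropp_involutive (INR n * h)), sin_neg.
      apply Ropp_lt_gt_0_contravar, sin_gt_0; lra. }
  assert (Hs1 : 0 < sin (p + h)) by (apply sin_gt_0; lra).
  assert (Hs2 : 0 < sin (p - h)) by (apply sin_gt_0; lra).
  set (l := fun s => cos (2 * PI * INR (S s) * INR nu / INR n) *
     (2 * INR n * h / 2 * cos ((INR (S s) / INR n - / 2) * (2 * INR n * h)) / sin (2 * INR n * h / 2))).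
  replace (INR n * h / 2 * (cot (p + h) - cot (p - h))) with (psum l n).
  - apply is_pseries_psum. intros s _. apply is_pseries_mulc.
    apply is_pseries_bernoulli_coef_neg; auto.
    + lra.
    + apply Rabs_lt_between; lra.
    + now replace (2 * INR n * h / 2) with (INR n * h) by field.
  - rewrite (psum_ext l (fun s => INR n * h / (2 * sin (INR n * h)) *
        (cos (INR (S s) * (2 * (p + h)) - INR n * h) + cos (INR (S s) * (2 * (- (p - h))) - INR n * h)))).
    + rewrite psum_scal, psum_plus.
      (* The product of cosines has been split into the angles p + h and -(p - h). The upper ends of
         both telescoping sums differ from short angles by nu full turns. *)
      assert (E1 := psum_cos (p + h) (INR n * h) n). assert (E2 := psum_cos (- (p - h)) (INR n * h) n).
      replace ((2 * INR n + 1) * (p + h) - INR n * h) with ((p + h + INR n * h) + 2 * INR nu * PI) in E1 by lra.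
      replace ((2 * INR n + 1) * (- (p - h)) - INR n * h) with ((- (p - h) + INR n * h) - 2 * INR nu * PI) in E2 by lra.
      rewrite sin_period in E1. rewrite sin_period_Z in E2.
      rewrite (sin_plus (p + h)), (sin_minus (p + h)) in E1. rewrite (sin_plus (- (p - h))), (sin_minus (- (p - h))) in E2.
      rewrite sin_neg, cos_neg in E2.
      set (S1 := psum (fun s => cos (INR (S s) * (2 * (p + h)) - INR n * h)) n) in *.
      set (S2 := psum (fun s => cos (INR (S s) * (2 * (- (p - h))) - INR n * h)) n) in *.
      assert (F1 : S1 = cos (p + h) * sin (INR n * h) / sin (p + h)).
      { apply Rmult_eq_reg_r with (2 * sin (p + h)); [|lra]. rewrite E1. field. lra. }
      assert (F2 : S2 = - (cos (p - h) * sin (INR n * h) / sin (p - h))).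
      { apply Rmult_eq_reg_r with (2 * - sin (p - h)); [|lra]. rewrite E2. field. lra. }
      rewrite F1, F2. unfold cot. field. lra.
    + intros s _. unfold l.
      replace (2 * INR n * h / 2) with (INR n * h) by field.
      replace ((INR (S s) / INR n - / 2) * (2 * INR n * h)) with (INR (S s) * (2 * h) - INR n * h)
        by (field; lra).
      replace (2 * PI * INR (S s) * INR nu / INR n) with (INR (S s) * (2 * p)) by (unfold p; field; lra).
      replace (INR (S s) * (2 * (p + h)) - INR n * h) with
        ((INR (S s) * (2 * h) - INR n * h) + INR (S s) * (2 * p)) by ring.
      replace (INR (S s) * (2 * (- (p - h))) - INR n * h) with
        ((INR (S s) * (2 * h) - INR n * h) - INR (S s) * (2 * p)) by ring.
      generalize (INR (S s) * (2 * h) - INR n * h) (INR (S s) * (2 * p)). intros t t'.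
      rewrite cos_plus, cos_minus. field. exact Hs. }
(* Division of the series by n h / 2 moves the index by one and leaves an odd series in h. *)
set (b := fun k => 2 / INR n * (- (2 * INR n) ^ 2) ^ (S k) * A (S k)).
assert (Hb : forall h, h <> 0 -> - d < h < d ->
   is_pseries (odd_interleave b) h (cot (p + h) - cot (p - h))).
{ intros h Hh0 Hh. specialize (HD h Hh0 Hh).
  replace (cot (p + h) - cot (p - h)) with (h * (/ h * (cot (p + h) - cot (p - h)))) by (field; exact Hh0).
  apply is_pseries_odd_interleave.
  apply is_pseries_R in HD. apply is_pseries_R.
  apply is_series_psum, is_lim_seq_incr_1 in HD. apply is_series_psum.
  replace (/ h * (cot (p + h) - cot (p - h))) with
    (2 / (INR n * h ^ 2) * (INR n * h / 2 * (cot (p + h) - cot (p - h)))) by (field; lra).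
  eapply is_lim_seq_ext; [|exact (is_lim_seq_scal_l _ (2 / (INR n * h ^ 2)) _ HD)].
  intros K. cbv beta. rewrite psum_head, HA0, Rmult_0_l, Rplus_0_l, <- psum_scal.
  apply psum_ext. intros k _. unfold b.
  replace (- (2 * INR n * h) ^ 2) with (- (2 * INR n) ^ 2 * h ^ 2) by ring.
  rewrite Rpow_mult_distr, <- (tech_pow_Rmult (h ^ 2)). field. lra. }
assert (HR : Rbar_lt 0 (CV_radius (odd_interleave b))).
{ rewrite <- Rabs_R0. apply (CV_radius_gt _ d); [|rewrite Rabs_R0; exact Hd].
  intros z Hz. eexists. apply Hb; lra. }
assert (E : Derive_n (fun h => cot (p + h) - cot (p - h)) (2 * r - 1) 0
            = odd_interleave b (2 * r - 1) * INR (fact (2 * r - 1))).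
{ rewrite <- Derive_n_coef by exact HR. apply Derive_n_ext_loc.
  apply (locally_Ioo (- d) d); [lra|]. intros h Hh. symmetry.
  destruct (Req_dec h 0) as [->|Hh0]; [|now apply is_pseries_unique, Hb].
  rewrite PSeries_0. rewrite Rplus_0_r, Rminus_0_r. unfold odd_interleave. simpl. ring. }
rewrite (Derive_n_cot_gap _ p d) in E by lra.
rewrite Rplus_0_r, Rminus_0_r in E.
destruct r as [|r]; [lia|].
replace (2 * S r - 1)%nat with (2 * r + 1)%nat in * by lia.
rewrite (proj2 (odd_interleave_double b r)) in E.
assert (E1 : (-1) ^ (2 * r + 1) = -1) by (rewrite Nat.add_1_r; apply pow_1_odd).
rewrite E1 in E. unfold scrH. fold p.
assert (EA : A (S r) = / INR (fact (2 * S r)) * psum (fun s => B (2 * S r)%nat (INR (S s) / INR n)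
                     * cos (2 * PI * INR (S s) * INR nu / INR n)) n).
{ unfold A. rewrite <- psum_scal. apply psum_ext. intros s _.
  unfold bernoulli_coef, Rdiv. ring. }
unfold b in E. rewrite EA in E.
set (T := psum _ n) in *.
replace (2 * S r)%nat with (S (2 * r + 1)) in E by lia.
rewrite fact_simpl, mult_INR in E.
replace (- (2 * INR n) ^ 2) with (-1 * (2 * INR n) ^ 2) in E by ring.
rewrite Rpow_mult_distr, <- pow_mult in E.
replace (2 * S r)%nat with (S (2 * r + 1)) in E by lia.
rewrite <- (tech_pow_Rmult (2 * INR n)) in E.
assert (EI : INR (S (2 * r + 1)) = 2 * INR (S r)).
{ replace (S (2 * r + 1)) with (2 * S r)%nat by lia. now rewrite mult_INR. }
rewrite EI in E.
assert (0 < INR (S r)) by (apply lt_0_INR; lia).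
pose proof (INR_fact_neq_0 (2 * r + 1)).
match type of E with _ = ?rhs => assert (E' : Derive_n cot (2 * r + 1) p = / 2 * rhs) by lra end.
rewrite E'. field. repeat split; auto; lra.
Qed.

(** The even part of the generating function depends on x only through |x - 1/2|. *)
Lemma bernoulli_coef_1 (B : nat -> R -> R) (r : nat) : bernoulli_polynomials B ->
  bernoulli_coef B 1 r = bernoulli_coef B 0 r.
Proof.
intros HB. pose proof PI_RGT_0.
apply even_pseries_unique with (2 * PI); [lra|]. intros z Hz.
eexists. split; [apply is_pseries_bernoulli_coef; [exact HB|lra]|].
match goal with |- is_pseries _ _ ?l => replace l with
    (z * (exp ((0 - / 2) * z) + exp (- ((0 - / 2) * z))) / 2
     / (exp (z / 2) - exp (- (z / 2)))) end.
- now apply is_pseries_bernoulli_coef.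
- replace ((0 - / 2) * z) with (- (z / 2)) by field.
  replace ((1 - / 2) * z) with (z / 2) by field. rewrite Ropp_involutive.
  do 3 f_equal. ring.
Qed.

(** Writing g(z) = z/(e^z - 1), the generating function at 1/2 is 2 g(z/2) - g(z); coefficients are
    compared in the full series, then specialized to even index. *)
Lemma bernoulli_coef_half (B : nat -> R -> R) (r : nat) : bernoulli_polynomials B ->
  (1 <= r)%nat ->
  bernoulli_coef B (/ 2) r = - (1 - / 2 ^ (2 * r - 1)) * bernoulli_coef B 0 r.
Proof.
intros HB Hr. pose proof PI_RGT_0 as HPI.
assert (H : B (2 * r)%nat (/ 2) / INR (fact (2 * r))
   = (2 * (/ 2) ^ (2 * r) - 1) * (B (2 * r)%nat 0 / INR (fact (2 * r)))).
{ apply (pseries_unique (fun m => B m (/ 2) / INR (fact m))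
     (fun m => (2 * (/ 2) ^ m - 1) * (B m 0 / INR (fact m))) (2 * PI)); [lra|].
  intros z Hz0 Hz. eexists. split; [now apply HB|].
  assert (H0 := HB 0 z Hz0 Hz).
  assert (H1 := HB 0 (z / 2) ltac:(lra)
    ltac:(unfold Rdiv; rewrite Rabs_mult, (Rabs_pos_eq (/ 2)) by lra; pose proof (Rabs_pos z); lra)).
  apply is_pseries_R in H0. apply is_pseries_R in H1. apply is_pseries_R.
  apply is_series_psum in H0. apply is_series_psum in H1. apply is_series_psum.
  rewrite Rmult_0_l, exp_0, Rmult_1_r in H0. rewrite Rmult_0_l, exp_0, Rmult_1_r in H1.
  assert (N1 := exp_minus_1_neq0 z Hz0). assert (N2 := exp_minus_1_neq0 (z / 2) ltac:(lra)).
  replace (Finite _) with (Finite (2 * (z / 2 / (exp (z / 2) - 1)) - z / (exp z - 1))).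
  - eapply is_lim_seq_ext; [|exact (is_lim_seq_minus' _ _ _ _ (is_lim_seq_scal_l _ 2 _ H1) H0)].
    intros K. cbv beta. rewrite <- psum_scal, <- psum_minus. apply psum_ext. intros m _.
    unfold Rdiv. rewrite Rpow_mult_distr. ring.
  - f_equal. replace (/ 2 * z) with (z / 2) by field.
    set (e := exp (z / 2)) in *.
    assert (E1 : exp z = e * e) by (unfold e; rewrite <- exp_plus; f_equal; field).
    rewrite E1 in *. field. auto. }
unfold bernoulli_coef. rewrite H. destruct r as [|r]; [lia|].
replace (2 * S r - 1)%nat with (S (2 * r)) by lia.
replace (2 * S r)%nat with (S (S (2 * r))) by lia.
rewrite pow_inv. simpl pow. field. split; [apply INR_fact_neq_0|apply pow_nonzero; lra].
Qed.

(** * Sign and growth of B_2r(1/2) *)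

Definition half_coef_abs (B : nat -> R -> R) (r : nat) : R := (-1) ^ r * bernoulli_coef B (/ 2) r.

(** The case n = 2, nu = 1 of [scrH_bernoulli]: the sum is B_2r(1) - B_2r(1/2) = (2 - 2^(1-2r))
    B_2r. The factors are kept multiplied out so that positivity and ratios can be read off. *)
Lemma half_coef_abs_scrH (B : nat -> R -> R) (r : nat) : bernoulli_polynomials B ->
  (1 <= r)%nat ->
  half_coef_abs B r * ((2 - / 2 ^ (2 * r - 1)) * 4 ^ (2 * r - 1) * PI ^ (2 * r))
  = (1 - / 2 ^ (2 * r - 1))
    * (- (PI ^ (2 * r) / (2 * INR (fact (2 * r - 1)))) * scrH (2 * r - 1) (/ 2)).
Proof.
intros HB Hr. unfold half_coef_abs. rewrite bernoulli_coef_half by auto.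
assert (E := scrH_bernoulli B 2 1 r HB ltac:(lia) Hr).
replace (INR 1 / INR 2) with (/ 2) in E by (simpl; field).
rewrite E. clear E. cbn [psum].
assert (E1 : INR 1 / INR 2 = / 2) by (simpl; field). rewrite E1.
assert (E2 : INR 2 / INR 2 = 1) by (simpl; field). rewrite E2.
assert (E3 : 2 * PI * INR 1 * INR 1 / INR 2 = PI) by (simpl; field). rewrite E3.
assert (E4 : 2 * PI * INR 2 * INR 1 / INR 2 = 2 * PI) by (simpl; field). rewrite E4.
rewrite cos_PI, cos_2PI. clear E1 E2 E3 E4.
replace (2 * INR 2) with 4 by (simpl; ring).
assert (HF := INR_fact_neq_0 (2 * r)).
assert (E1 := bernoulli_coef_1 B r HB). assert (E2 := bernoulli_coef_half B r HB Hr).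
unfold bernoulli_coef in *.
assert (E3 : B (2 * r)%nat 1 = B (2 * r)%nat 0).
{ apply Rmult_eq_reg_r with (/ INR (fact (2 * r))); [exact E1|now apply Rinv_neq_0_compat]. }
assert (E4 : B (2 * r)%nat (/ 2) = - (1 - / 2 ^ (2 * r - 1)) * B (2 * r)%nat 0).
{ apply Rmult_eq_reg_r with (/ INR (fact (2 * r))); [|now apply Rinv_neq_0_compat].
  unfold Rdiv in E2. rewrite E2. ring. }
rewrite E3, E4. clear E1 E2 E3 E4.
destruct r as [|r]; [lia|].
replace (2 * S r - 1)%nat with (S (2 * r)) by lia.
replace (2 * S r)%nat with (S (S (2 * r))) in * by lia.
rewrite (fact_simpl (S (2 * r))), mult_INR in *.
assert (EI : INR (S (S (2 * r))) = 2 * INR (S r)).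
{ replace (S (S (2 * r))) with (2 * S r)%nat by lia. now rewrite mult_INR. }
rewrite EI in *.
assert (0 < INR (S r)) by (apply lt_0_INR; lia). pose proof (INR_fact_neq_0 (S (2 * r))).
field. repeat split; auto; try apply pow_nonzero; lra.
Qed.

Lemma inv_pow2_pred_bounds (r : nat) : (1 <= r)%nat -> 0 < / 2 ^ (2 * r - 1) <= / 2.
Proof.
intros Hr. split; [apply inv_pow_pos; lra|].
apply Rinv_le_contravar; [lra|]. rewrite <- (pow_1 2) at 1. apply Rle_pow; [lra|lia].
Qed.

(** The middle term is the sum of (k + 1/2)^(-2r). Its first term is 4^r, and [psum_inv_pow_le] at
    1/2 gives 4^(r-1) (4 + 2). *)
Lemma scrH_half_bounds (r : nat) : (1 <= r)%nat ->
  4 ^ r <= - (PI ^ (2 * r) / (2 * INR (fact (2 * r - 1)))) * scrH (2 * r - 1) (/ 2)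
        <= 6 * 4 ^ (r - 1).
Proof.
intros Hr. assert (L := scrH_lim r (/ 2) Hr ltac:(lra)).
replace (1 - / 2) with (/ 2) in L by field.
assert (L' : is_lim_seq (psum (fun k => / (/ 2 + INR k) ^ (2 * r)))
  (- (PI ^ (2 * r) / (2 * INR (fact (2 * r - 1)))) * scrH (2 * r - 1) (/ 2))).
{ replace (Finite _) with (Finite (/ 2 * (- (PI ^ (2 * r) / INR (fact (2 * r - 1))) * scrH (2 * r - 1) (/ 2)))).
  - eapply is_lim_seq_ext; [|exact (is_lim_seq_scal_l _ (/ 2) _ L)].
    intros K. cbv beta. rewrite <- psum_scal. apply psum_ext. intros; field.
    apply pow_nonzero. pose proof (pos_INR i). lra.
  - f_equal. field. apply INR_fact_neq_0. }
split.
- apply psum_lower_bound_lim in L'.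
  + simpl (INR 0) in L'. rewrite Rplus_0_r, pow_mult in L'.
    replace ((/ 2) ^ 2) with (/ 4) in L' by field. rewrite pow_inv, Rinv_inv in L'. exact L'.
  + intros k. pose proof (pos_INR k). apply Rlt_le, inv_pow_pos; lra.
- refine (is_lim_seq_le _ (fun _ => 6 * 4 ^ (r - 1)) (Finite _) (Finite _) _ L' (is_lim_seq_const _)).
  intros K. assert (H := psum_inv_pow_le (/ 2) (/ 2) (2 * r - 2) K ltac:(lra)).
  replace (2 * r - 2 + 2)%nat with (2 * r)%nat in H by lia.
  replace (2 * r - 2)%nat with (2 * (r - 1))%nat in H by lia.
  rewrite (pow_mult (/ 2)) in H. replace ((/ 2) ^ 2) with (/ 4) in H by field.
  rewrite pow_inv, !Rinv_inv in H. lra.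
Qed.

(** Three terms of Leibniz's series give PI <= 52/15. The bound 13 is sharp enough because 6 * 13 =
    78 < 80 in [half_coef_abs_ratio]. *)
Lemma PI_sqr_lt_13 : PI ^ 2 < 13.
Proof.
pose proof (proj2 (PI_ineq 1)) as H. pose proof PI_RGT_0.
unfold tg_alt, PI_tg in H. simpl in H.
assert (PI <= 3.5) by lra. nra.
Qed.

Lemma half_coef_abs_0 (B : nat -> R -> R) : bernoulli_polynomials B -> half_coef_abs B 0 = 1.
Proof. intros HB. unfold half_coef_abs. rewrite bernoulli_coef_0 by exact HB. simpl; ring. Qed.

Lemma half_coef_abs_pos (B : nat -> R -> R) (r : nat) : bernoulli_polynomials B ->
  0 < half_coef_abs B r.
Proof.
intros HB. destruct r as [|r]; [rewrite half_coef_abs_0; auto; lra|].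
assert (E := half_coef_abs_scrH B (S r) HB ltac:(lia)).
pose proof (proj1 (scrH_half_bounds (S r) ltac:(lia))) as H.
pose proof (inv_pow2_pred_bounds (S r) ltac:(lia)) as Ht.
set (t := / 2 ^ (2 * S r - 1)) in *.
assert (HQ : 0 < (2 - t) * 4 ^ (2 * S r - 1) * PI ^ (2 * S r)).
{ apply Rmult_lt_0_compat; [apply Rmult_lt_0_compat; [lra|apply pow_lt; lra]|apply pow_lt, PI_RGT_0]. }
assert (0 < 4 ^ S r) by (apply pow_lt; lra).
apply (Rmult_lt_reg_r _ _ _ HQ). rewrite E, Rmult_0_l.
apply Rmult_lt_0_compat; lra.
Qed.

Lemma bernoulli_half_product (B : nat -> R -> R) (n : nat) : bernoulli_polynomials B ->
  PS_mult (bernoulli_coef B (/ 2)) sinhc_coef n = match n with O => 1 | S _ => 0 end.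
Proof.
intros HB. rewrite (proj1 (bernoulli_product B (/ 2) HB) n), Rminus_diag.
destruct n as [|n]; [simpl; field|]. rewrite pow_i by lia. unfold Rdiv; ring.
Qed.

(* The ratio tends to 4 PI^2; any bound by the constant 80 of [sinhc_coef_ratio] will do. *)
Lemma half_coef_abs_ratio (B : nat -> R -> R) (r : nat) : bernoulli_polynomials B ->
  half_coef_abs B r < 80 * half_coef_abs B (S r).
Proof.
intros HB. destruct r as [|r].
- rewrite half_coef_abs_0 by exact HB.
  (* The coefficient of z^2 in the product being 0, the value at index 1 is 1/24. *)
  pose proof (bernoulli_half_product B 1 HB) as H. unfold PS_mult in H. simpl sum_f_R0 in H.
  rewrite bernoulli_coef_0 in H by exact HB.
  unfold sinhc_coef in H. simpl in H. unfold half_coef_abs. simpl. lra.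
- assert (E := half_coef_abs_scrH B (S r) HB ltac:(lia)).
  assert (E' := half_coef_abs_scrH B (S (S r)) HB ltac:(lia)).
  destruct (scrH_half_bounds (S r) ltac:(lia)) as [_ U].
  destruct (scrH_half_bounds (S (S r)) ltac:(lia)) as [L _].
  pose proof (inv_pow2_pred_bounds (S r) ltac:(lia)) as Ht.
  pose proof (half_coef_abs_pos B (S r) HB) as P. pose proof (half_coef_abs_pos B (S (S r)) HB) as P'.
  set (Z := - _ * scrH (2 * S r - 1) _) in *. set (Z' := - _ * scrH (2 * S (S r) - 1) _) in *.
  replace (2 * S (S r) - 1)%nat with (S (S (2 * S r - 1))) in E' by lia.
  assert (Et : / 2 ^ S (S (2 * S r - 1)) = / 2 ^ (2 * S r - 1) / 4).
  { simpl pow. field. apply pow_nonzero; lra. }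
  rewrite Et in E'. set (t := / 2 ^ (2 * S r - 1)) in *.
  replace (2 * S (S r))%nat with (2 * S r + 2)%nat in E' by lia.
  rewrite pow_add, <- !tech_pow_Rmult in E'.
  set (F := 4 ^ (2 * S r - 1)) in *. set (Q := PI ^ (2 * S r)) in *.
  assert (0 < F) by (apply pow_lt; lra). assert (0 < Q) by (apply pow_lt, PI_RGT_0).
  replace (S r - 1)%nat with r in U by lia. simpl pow in L.
  set (f := 4 ^ r) in *. assert (Hf : 0 < f) by (apply pow_lt; lra).
  set (p := half_coef_abs B (S r)) in *. set (p' := half_coef_abs B (S (S r))) in *.
  pose proof PI_sqr_lt_13 as H13.
  assert (HFQ : 0 < F * Q) by (apply Rmult_lt_0_compat; auto).
  assert (A1 : p * (F * Q) * (2 - t) <= (1 - t) * (6 * f)).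
  { replace (p * (F * Q) * (2 - t)) with ((1 - t) * Z) by (rewrite <- E; ring).
    apply Rmult_le_compat_l; lra. }
  assert (A2 : (1 - t / 4) * (16 * f) <= 16 * (p' * (F * Q)) * (2 - t / 4) * PI ^ 2).
  { replace (16 * (p' * (F * Q)) * (2 - t / 4) * PI ^ 2) with ((1 - t / 4) * Z') by (rewrite <- E'; ring).
    apply Rmult_le_compat_l; lra. }
  apply Rmult_lt_reg_r with (F * Q); [exact HFQ|].
  rewrite Rmult_assoc.
  set (a := p * (F * Q)) in *. set (b := p' * (F * Q)) in *.
  assert (0 < b) by (apply Rmult_lt_0_compat; auto).
  assert (A3 : (1 - t / 4) * f < b * (2 - t / 4) * 13).
  { apply Rle_lt_trans with (b * (2 - t / 4) * PI ^ 2); [lra|].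
    apply Rmult_lt_compat_l; [apply Rmult_lt_0_compat; lra|exact H13]. }
  (* This says that (1-t)/(2-t) decreases in t, so the dyadic factors only help and 6 PI^2 bounds
     the ratio. *)
  assert (A4 : (1 - t) * (2 - t / 4) <= (1 - t / 4) * (2 - t)) by nra.
  apply Rmult_lt_reg_r with ((2 - t) * (2 - t / 4)); [apply Rmult_lt_0_compat; lra|].
  apply Rle_lt_trans with (6 * f * ((1 - t) * (2 - t / 4))).
  + apply (Rmult_le_compat_r (2 - t / 4)) in A1; [|lra]. lra.
  + apply Rle_lt_trans with (6 * f * ((1 - t / 4) * (2 - t))).
    * apply Rmult_le_compat_l; [lra|exact A4].
    * apply (Rmult_lt_compat_r (2 - t)) in A3; [|lra].
      assert (0 < b * ((2 - t) * (2 - t / 4))) by (apply Rmult_lt_0_compat; [lra|apply Rmult_lt_0_compat; lra]). lra.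
Qed.

(** * The midpoint Euler-Maclaurin defect *)

Lemma CV_radius_ones (x : R) : Rabs x < 1 -> Rbar_lt (Rabs x) (CV_radius (fun _ => 1)).
Proof.
intros Hx. apply (CV_radius_gt _ 1); [|exact Hx]. intros z Hz.
exists (/ (1 - z)). apply is_pseries_R.
apply (is_series_ext_R (fun k => z ^ k)); [intros; ring|].
apply is_series_geom. rewrite Rabs_pos_eq; lra.
Qed.

Lemma PSeries_ones (x : R) : Rabs x < 1 -> PSeries (fun _ => 1) x = / (1 - x).
Proof.
intros Hx. apply is_pseries_unique, is_pseries_R.
apply (is_series_ext_R (fun k => x ^ k)); [intros; ring|]. now apply is_series_geom.
Qed.

Lemma Derive_n_geom (n : nat) (x : R) : -1 < x < 1 ->
  Derive_n (PSeries (fun _ => 1)) n x = INR (fact n) / (1 - x) ^ (S n).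
Proof.
revert x. induction n as [|n IH]; intros x Hx.
- simpl Derive_n. rewrite PSeries_ones by (apply Rabs_lt_between; lra). simpl. field. lra.
- change (Derive (Derive_n (PSeries (fun _ => 1)) n) x = INR (fact (S n)) / (1 - x) ^ (S (S n))).
  rewrite (Derive_ext_loc _ (fun y => INR (fact n) / (1 - y) ^ (S n))).
  + apply is_derive_unique. rewrite fact_simpl, mult_INR.
    generalize (INR (fact n)). intros c.
    auto_derive; [apply (pow_nonzero (1 - x) (S n)); lra|].
    change (match n with O => 1 | S _ => INR n + 1 end) with (INR (S n)). fold (1 - x).
    rewrite <- !tech_pow_Rmult. field. split; [apply pow_nonzero; lra|lra].
  + apply (locally_Ioo (-1) 1); auto.
Qed.

Lemma is_pseries_inv_pow (n : nat) (x : R) : -1 < x < 1 ->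
  is_pseries (fun k => INR (fact (k + n)) / INR (fact k)) x (INR (fact n) / (1 - x) ^ (S n)).
Proof.
intros Hx. rewrite <- Derive_n_geom by exact Hx.
assert (HR : Rbar_lt (Rabs x) (CV_radius (fun _ => 1))) by (apply CV_radius_ones, Rabs_lt_between; lra).
rewrite Derive_n_PSeries by exact HR.
apply (is_pseries_ext (PS_derive_n n (fun _ => 1))).
- intros k. unfold PS_derive_n. apply Rmult_1_r.
- apply PSeries_correct, CV_radius_inside. now rewrite CV_radius_derive_n.
Qed.

Lemma is_pseries_ln (x : R) : -1 < x < 1 -> is_pseries (PS_Int (fun _ => 1)) x (- ln (1 - x)).
Proof.
intros Hx.
assert (E : RInt (PSeries (fun _ => 1)) 0 x = - ln (1 - x)).
{ apply is_RInt_unique.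
  assert (B : forall t, Rmin 0 x <= t <= Rmax 0 x -> -1 < t < 1).
  { intros t. unfold Rmin, Rmax. destruct (Rle_dec 0 x); lra. }
  apply (is_RInt_ext (fun t => / (1 - t))).
  - intros t Ht. symmetry. apply PSeries_ones. apply Rabs_lt_between.
    specialize (B t ltac:(lra)). lra.
  - replace (- ln (1 - x)) with (minus (- ln (1 - x)) (- ln (1 - 0))).
    + apply (is_RInt_derive (V := R_CompleteNormedModule) (fun t => - ln (1 - t))); intros t Ht; specialize (B t Ht).
      * auto_derive; [lra|]. field. lra.
      * apply (ex_derive_continuous (fun t => / (1 - t))). auto_derive. lra.
    + unfold minus, plus, opp; simpl. rewrite Rminus_0_r, ln_1. ring. }
rewrite <- E. apply is_pseries_RInt, CV_radius_ones, Rabs_lt_between. lra.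
Qed.

(** The derivative of ln of order 2r, hence an antiderivative of the derivative of 1/t of that
    order. *)
Definition inv_power_fun (r : nat) (t : R) : R :=
  match r with O => ln t | S _ => - INR (fact (2 * r - 1)) / t ^ (2 * r) end.

Lemma odd_series (r : nat) (x : R) : 0 < x < 1 ->
  is_pseries (fun i => INR (fact (2 * (i + r))) / INR (fact (2 * i + 1))) (x ^ 2)
    ((inv_power_fun r (1 + x) - inv_power_fun r (1 - x)) / (2 * x)).
Proof.
intros Hx. assert (Hx0 : x <> 0) by lra.
destruct r as [|r].
- cbn [inv_power_fun].
  pose proof (proj2 (is_pseries_parts _ _ _ _ Hx0 (is_pseries_ln x ltac:(lra)) (is_pseries_ln (- x) ltac:(lra)))) as H.
  replace (- ln (1 - x) - - ln (1 - - x)) with (ln (1 + x) - ln (1 - x)) in H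
    by (replace (1 - - x) with (1 + x) by ring; ring).
  eapply is_pseries_ext; [|exact H]. intros i. cbv beta.
  rewrite Nat.add_0_r, (Nat.add_1_r (2 * i)). cbn [PS_Int]. rewrite fact_simpl, mult_INR.
  change (1 / INR (S (2 * i)) = INR (fact (2 * i)) / (INR (S (2 * i)) * INR (fact (2 * i)))).
  field. split; [apply INR_fact_neq_0|apply not_0_INR; lia].
- cbn [inv_power_fun].
  pose proof (proj2 (is_pseries_parts _ _ _ _ Hx0 (is_pseries_inv_pow (2 * S r - 1) x ltac:(lra))
     (is_pseries_inv_pow (2 * S r - 1) (- x) ltac:(lra)))) as H.
  replace (S (2 * S r - 1)) with (2 * S r)%nat in H by lia.
  replace (1 - - x) with (1 + x) in H by ring.
  match goal with |- is_pseries _ _ ?l => match type of H with is_pseries _ _ ?l' =>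
    replace l with l' by (field; repeat split; try apply pow_nonzero; lra) end end.
  eapply is_pseries_ext; [|exact H]. intros i. cbv beta.
  now replace (2 * i + 1 + (2 * S r - 1))%nat with (2 * (i + S r))%nat by lia.
Qed.

Lemma psum_app (f : nat -> R) (n m : nat) :
  psum f (n + m) = psum f n + psum (fun i => f (n + i)%nat) m.
Proof.
induction m as [|m IH]; [rewrite Nat.add_0_r; simpl; ring|].
rewrite Nat.add_succ_r. cbn [psum]. rewrite IH. ring.
Qed.

(** Multiplication by u = 1/(m + 1/2) carries the endpoints to 1 - u/2 and 1 + u/2, where
    [odd_series] applies. The r leading zeros align the series for different r on the common powers
    u^(2j+1), so that they can be added termwise. *)
Lemma inv_power_fun_step (r : nat) (m : R) : 0 < m ->
  is_series (fun j => if (j <? r)%nat then 0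
       else INR (fact (2 * j)) * sinhc_coef (j - r) * (/ (m + / 2)) ^ (2 * j + 1))
    (inv_power_fun r (m + 1) - inv_power_fun r m).
Proof.
intros Hm. set (u := / (m + / 2)).
assert (Hu : 0 < u) by (apply Rinv_0_lt_compat; lra).
assert (Hu2 : u / 2 < 1).
{ unfold u, Rdiv. rewrite <- Rinv_mult, <- Rinv_1. apply Rinv_lt_contravar; lra. }
assert (H := odd_series r (u / 2) ltac:(lra)).
apply is_pseries_R, is_series_psum in H.
apply is_series_psum. apply (is_lim_seq_incr_n _ r).
assert (E : inv_power_fun r (m + 1) - inv_power_fun r m =
  u ^ (2 * r + 1) * ((inv_power_fun r (1 + u / 2) - inv_power_fun r (1 - u / 2)) / (2 * (u / 2)))).
{ replace (1 + u / 2) with ((m + 1) * u) by (unfold u; field; lra).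
  replace (1 - u / 2) with (m * u) by (unfold u; field; lra).
  destruct r as [|r]; cbn [inv_power_fun].
  - rewrite !ln_mult by lra. simpl. field. lra.
  - rewrite pow_add, !Rpow_mult_distr, pow_1.
    field. repeat split; try apply pow_nonzero; lra. }
rewrite E.
eapply is_lim_seq_ext; [|exact (is_lim_seq_scal_l _ (u ^ (2 * r + 1)) _ H)].
intros K. cbv beta. rewrite (Nat.add_comm K), psum_app, <- psum_scal.
rewrite (psum_ext _ (fun _ => 0) r), psum_const, Rmult_0_r, Rplus_0_l.
- apply psum_ext. intros i _.
  replace (r + i <? r)%nat with false by (symmetry; apply Nat.ltb_ge; lia).
  replace (r + i - r)%nat with i by lia. rewrite (Nat.add_comm r i).
  replace (2 * (i + r) + 1)%nat with ((2 * r + 1) + 2 * i)%nat by lia.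
  rewrite (pow_add u (2 * r + 1) (2 * i)). unfold sinhc_coef.
  rewrite (pow_mult u 2 i). replace ((u / 2) ^ 2) with (/ 4 * u ^ 2) by field.
  rewrite Rpow_mult_distr, pow_inv. field.
  split; [apply INR_fact_neq_0|apply pow_nonzero; lra].
- intros i Hi. now replace (i <? r)%nat with true by (symmetry; apply Nat.ltb_lt; lia).
Qed.

(* With the weights B_{2r}(1/2)/(2r)!, this is the error, on one interval [m, m+1], of the
   midpoint Euler-Maclaurin formula for 1/t, truncated after N terms. *)
Definition midpoint_defect (B : nat -> R -> R) (N : nat) (m : R) : R :=
  / (m + / 2)
  - psum (fun r => bernoulli_coef B (/ 2) r * (inv_power_fun r (m + 1) - inv_power_fun r m)) N.

(** Coefficient of z^2j in 1 minus the product of sinh(z/2)/(z/2) by the first N terms of the series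
    of its reciprocal. *)
Definition truncation_coef (B : nat -> R -> R) (N j : nat) : R :=
  (if (j =? 0)%nat then 1 else 0)
  - psum (fun r => bernoulli_coef B (/ 2) r * (if (j <? r)%nat then 0 else sinhc_coef (j - r))) N.

Lemma midpoint_defect_series (B : nat -> R -> R) (N : nat) (m : R) : 0 < m ->
  is_series (fun j => INR (fact (2 * j)) * (/ (m + / 2)) ^ (2 * j + 1) * truncation_coef B N j)
    (midpoint_defect B N m).
Proof.
intros Hm.
assert (H0 : is_lim_seq (psum (fun j => if (j =? 0)%nat then / (m + / 2) else 0)) (/ (m + / 2))).
{ apply is_lim_seq_incr_1. apply (is_lim_seq_ext (fun _ => / (m + / 2))); [|apply is_lim_seq_const].
  intros n. rewrite psum_head. simpl Nat.eqb. cbv iota. rewrite psum_const. ring. }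
assert (H1 := is_lim_seq_psum
  (fun r K => bernoulli_coef B (/ 2) r * psum (fun j => if (j <? r)%nat then 0
       else INR (fact (2 * j)) * sinhc_coef (j - r) * (/ (m + / 2)) ^ (2 * j + 1)) K)
  (fun r => bernoulli_coef B (/ 2) r * (inv_power_fun r (m + 1) - inv_power_fun r m)) N).
apply is_series_psum. unfold midpoint_defect.
eapply is_lim_seq_ext; [|apply is_lim_seq_minus'; [exact H0|apply H1]].
- intros K. cbv beta.
  rewrite (psum_ext _ (fun r => psum (fun j => bernoulli_coef B (/ 2) r * (if (j <? r)%nat then 0
       else INR (fact (2 * j)) * sinhc_coef (j - r) * (/ (m + / 2)) ^ (2 * j + 1))) K) N)
    by (intros; now rewrite psum_scal).
  rewrite psum_swap, <- psum_minus. apply psum_ext. intros j _.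
  unfold truncation_coef. rewrite Rmult_minus_distr_l, <- psum_scal. f_equal.
  + destruct j as [|j]; [simpl; field; lra|]. simpl Nat.eqb. cbv iota. ring.
  + apply psum_ext. intros r _. destruct (j <? r)%nat; ring.
- intros r _. apply (is_lim_seq_scal_l _ _ (Finite _)).
  apply is_series_psum, inv_power_fun_step, Hm.
Qed.

Lemma truncation_coef_succ (B : nat -> R -> R) (N j : nat) :
  truncation_coef B (S N) j = truncation_coef B N j
    - bernoulli_coef B (/ 2) N * (if (j <? N)%nat then 0 else sinhc_coef (j - N)).
Proof. unfold truncation_coef. cbn [psum]. ring. Qed.

Lemma psum_sum_f_R0 (f : nat -> R) (n : nat) : sum_f_R0 f n = psum f (S n).
Proof. rewrite <- psum_sum_n. symmetry. apply sum_n_Reals. Qed.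

(** Truncation after N terms does not affect the coefficients of index below N, and the full product
    is 1. *)
Lemma truncation_coef_vanish (B : nat -> R -> R) (N j : nat) : bernoulli_polynomials B ->
  (j < N)%nat -> truncation_coef B N j = 0.
Proof.
intros HB Hj. induction Hj as [|N Hj IH].
- unfold truncation_coef. pose proof (bernoulli_half_product B j HB) as H.
  unfold PS_mult in H. rewrite psum_sum_f_R0 in H.
  rewrite (psum_ext _ (fun r => bernoulli_coef B (/ 2) r * sinhc_coef (j - r))).
  + rewrite H. destruct j; simpl; ring.
  + intros r Hr. now replace (j <? r)%nat with false by (symmetry; apply Nat.ltb_ge; lia).
- rewrite truncation_coef_succ, IH.
  replace (j <? N)%nat with true by (symmetry; apply Nat.ltb_lt; lia). ring.
Qed.

Lemma sinhc_coef_pos (k : nat) : 0 < sinhc_coef k.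
Proof.
apply Rinv_0_lt_compat, Rmult_lt_0_compat; [apply pow_lt; lra|apply INR_fact_lt_0].
Qed.

(** The ratio is 4(2k+2)(2k+3), which is 80 at k = 1 but only 24 at k = 0. *)
Lemma sinhc_coef_ratio (k : nat) : (1 <= k)%nat -> 80 * sinhc_coef (S k) <= sinhc_coef k.
Proof.
intros Hk. unfold sinhc_coef.
replace (2 * S k + 1)%nat with (S (S (2 * k + 1))) by lia.
rewrite !fact_simpl, !mult_INR, <- tech_pow_Rmult.
assert (3 <= INR (2 * k + 1)) by (replace 3 with (INR 3) by (simpl; ring); apply le_INR; lia).
assert (E : INR (S (2 * k + 1)) = INR (2 * k + 1) + 1) by apply S_INR.
rewrite (S_INR (S (2 * k + 1))), E.
set (a := INR (2 * k + 1)) in *. pose proof (INR_fact_lt_0 (2 * k + 1)) as HF.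
assert (HP : 0 < 4 ^ k) by (apply pow_lt; lra).
set (F := INR (fact (2 * k + 1))) in *. set (P := 4 ^ k) in *.
replace (/ (4 * P * ((a + 1 + 1) * ((a + 1) * F)))) with (/ (4 * (a + 2) * (a + 1)) * / (P * F))
  by (field; lra).
rewrite <- Rmult_assoc. rewrite <- (Rmult_1_l (/ (P * F))) at 2.
apply Rmult_le_compat_r.
- apply Rlt_le, Rinv_0_lt_compat, Rmult_lt_0_compat; auto.
- assert (80 <= 4 * (a + 2) * (a + 1)) by nra.
  apply Rmult_le_reg_r with (4 * (a + 2) * (a + 1)); [lra|].
  rewrite Rmult_assoc, Rinv_l; lra.
Qed.

(* The terms of truncation_coef alternate and increase in modulus, so that its
   sign is the one of its last term. *)
Lemma truncation_coef_sign (B : nat -> R -> R) (N j : nat) : bernoulli_polynomials B ->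
  (S N <= j)%nat ->
  0 < (-1) ^ (S N) * truncation_coef B (S N) j <= half_coef_abs B N * sinhc_coef (j - N).
Proof.
intros HB. induction N as [|N IH]; intros Hj.
- rewrite half_coef_abs_0 by exact HB. unfold truncation_coef. cbn [psum].
  rewrite bernoulli_coef_0 by exact HB. destruct j as [|j]; [lia|].
  rewrite Nat.sub_0_r. pose proof (sinhc_coef_pos (S j)). simpl Nat.eqb. simpl Nat.ltb. cbv iota.
  change (S j <? 0)%nat with false. cbv iota. simpl pow. lra.
- specialize (IH ltac:(lia)). rewrite truncation_coef_succ.
  replace (j <? S N)%nat with false by (symmetry; apply Nat.ltb_ge; lia).
  replace (j - N)%nat with (S (j - S N)) in IH by lia.
  assert (E : (-1) ^ S (S N) * (truncation_coef B (S N) j - bernoulli_coef B (/ 2) (S N) * sinhc_coef (j - S N))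
    = half_coef_abs B (S N) * sinhc_coef (j - S N) - (-1) ^ S N * truncation_coef B (S N) j).
  { unfold half_coef_abs. simpl pow. ring. }
  rewrite E.
  (* The upper bound in the induction hypothesis is the modulus of the previous term; the two ratio
     bounds show that the new term exceeds it. *)
  pose proof (sinhc_coef_ratio (j - S N) ltac:(lia)) as R1.
  pose proof (half_coef_abs_ratio B N HB) as R2.
  pose proof (sinhc_coef_pos (S (j - S N))) as P1.
  pose proof (half_coef_abs_pos B N HB) as P2. pose proof (half_coef_abs_pos B (S N) HB) as P3.
  split; [|lra].
  assert (half_coef_abs B N * sinhc_coef (S (j - S N)) < 80 * half_coef_abs B (S N) * sinhc_coef (S (j - S N)))
    by (apply Rmult_lt_compat_r; lra).
  assert (half_coef_abs B (S N) * (80 * sinhc_coef (S (j - S N))) <= half_coef_abs B (S N) * sinhc_coef (j - S N))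
    by (apply Rmult_le_compat_l; lra).
  lra.
Qed.

Lemma midpoint_defect_sign (B : nat -> R -> R) (N : nat) (m : R) : bernoulli_polynomials B ->
  (1 <= N)%nat -> 0 < m -> 0 < (-1) ^ N * midpoint_defect B N m.
Proof.
intros HB HN Hm. destruct N as [|N]; [lia|].
assert (H := midpoint_defect_series B (S N) m Hm). apply is_series_psum in H.
set (f := fun j => INR (fact (2 * j)) * (/ (m + / 2)) ^ (2 * j + 1) * truncation_coef B (S N) j) in H.
assert (Hc : forall j, 0 < INR (fact (2 * j)) * (/ (m + / 2)) ^ (2 * j + 1)).
{ intros j. apply Rmult_lt_0_compat; [apply INR_fact_lt_0|apply pow_lt, Rinv_0_lt_compat; lra]. }
assert (Hp : forall j, (S N <= j)%nat -> 0 < (-1) ^ S N * f j).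
{ intros j Hj. unfold f. rewrite Rmult_comm, Rmult_assoc, (Rmult_comm _ ((-1) ^ S N)).
  apply Rmult_lt_0_compat; [apply Hc|]. now apply (truncation_coef_sign B N j). }
assert (Hf : forall j, 0 <= (-1) ^ S N * f j).
{ intros j. destruct (le_lt_dec (S N) j) as [h|h]; [now apply Rlt_le, Hp|].
  unfold f. rewrite truncation_coef_vanish by auto. rewrite !Rmult_0_r. lra. }
apply Rlt_le_trans with ((-1) ^ S N * f (S N)); [apply Hp; lia|].
apply (is_lim_seq_scal_l _ ((-1) ^ S N) (Finite _)) in H.
apply (is_lim_seq_incr_n _ (S (S N))) in H.
refine (is_lim_seq_le (fun _ => (-1) ^ S N * f (S N)) _ (Finite _) (Finite _) _ (is_lim_seq_const _) H).
intros K. cbv beta. rewrite <- psum_scal.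
apply (psum_ge_term (fun j => (-1) ^ S N * f j)); [auto|lia].
Qed.

(** * Summation over the lattice *)

Definition unit_step (a i : nat) : R := if (a <=? i)%nat then 1 else 0.

Lemma step_pos (a i : nat) : 0 <= unit_step a i.
Proof. unfold unit_step. destruct (a <=? i)%nat; lra. Qed.

Lemma psum_step (g : nat -> R) (a n : nat) : (a <= n)%nat ->
  psum (fun i => unit_step a i * (g (S i) - g i)) n = g n - g a.
Proof.
intros Ha. replace n with (a + (n - a))%nat by lia. rewrite psum_app.
rewrite (psum_ext _ (fun _ => 0) a), psum_const.
- rewrite (psum_ext _ (fun i => g (a + S i)%nat - g (a + i)%nat)).
  + rewrite (psum_telescope (fun i => g (a + i)%nat)), Nat.add_0_r. ring.
  + intros i _. unfold unit_step. replace (a <=? a + i)%nat with true by (symmetry; apply Nat.leb_le; lia).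
    rewrite Nat.add_succ_r. ring.
- intros i Hi. unfold unit_step. replace (a <=? i)%nat with false by (symmetry; apply Nat.leb_gt; lia). ring.
Qed.

(* For i < n: the number of y in (0, k n + i] congruent to nu, plus the number of
   those congruent to -nu, mod n. *)
Definition weight (n nu k i : nat) : R := 2 * INR k + unit_step nu i + unit_step (n - nu) i.

(** The value at m = k n + i for every k: the 2k in (2m+1)/n cancels that of [weight]. *)
Definition weight_fluct (n nu i : nat) : R :=
  (2 * INR i + 1) / INR n - unit_step nu i - unit_step (n - nu) i.

(** Summation by parts: the weight jumps by one for each point congruent to nu and for each
    congruent to -nu, and reaches 2K at K n. *)
Lemma weight_abel (g : nat -> R) (n nu K : nat) : (nu <= n)%nat ->
  psum (fun k => psum (fun i => weight n nu k i * (g (k * n + S i)%nat - g (k * n + i)%nat)) n) K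
  = 2 * INR K * g (K * n)%nat - psum (fun k => g (k * n + nu)%nat + g (k * n + (n - nu))%nat) K.
Proof.
intros Hnu. induction K as [|K IH]; [simpl; ring|]. cbn [psum]. rewrite IH.
rewrite (psum_ext (fun i => weight n nu K i * _) (fun i => 2 * INR K * (g (K * n + S i)%nat - g (K * n + i)%nat)
   + (unit_step nu i * (g (K * n + S i)%nat - g (K * n + i)%nat)
      + unit_step (n - nu) i * (g (K * n + S i)%nat - g (K * n + i)%nat))))
  by (intros; unfold weight; ring).
rewrite !psum_plus, psum_scal.
rewrite (psum_telescope (fun i => g (K * n + i)%nat)).
rewrite (psum_step (fun i => g (K * n + i)%nat) nu) by lia.
rewrite (psum_step (fun i => g (K * n + i)%nat) (n - nu)) by lia.
cbv beta. replace (S K * n)%nat with (K * n + n)%nat by lia. rewrite Nat.add_0_r, S_INR. ring.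
Qed.

(** * Finite sine expansion of the weight fluctuation *)

Lemma psum_sin (th : R) (m : nat) :
  psum (fun l => sin (INR (S l) * (2 * th))) m * (2 * sin th) = cos th - cos ((2 * INR m + 1) * th).
Proof.
rewrite Rmult_comm, <- psum_scal.
rewrite (psum_ext _ (fun l => - cos ((2 * INR (S l) + 1) * th) - - cos ((2 * INR l + 1) * th))).
- rewrite (psum_telescope (fun l => - cos ((2 * INR l + 1) * th))).
  simpl (INR 0). replace ((2 * 0 + 1) * th) with th by ring. ring.
- intros l _. rewrite S_INR.
  replace ((2 * (INR l + 1) + 1) * th) with ((INR l + 1) * (2 * th) + th) by ring.
  replace ((2 * INR l + 1) * th) with ((INR l + 1) * (2 * th) - th) by ring.
  generalize ((INR l + 1) * (2 * th)). intros t. rewrite cos_plus, cos_minus. ring.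
Qed.

Lemma ratio_in_01 (x y : R) : 0 < x < y -> 0 < x / y < 1.
Proof.
intros H. split; [apply Rdiv_lt_0_compat; lra|].
apply Rmult_lt_reg_r with y; [lra|]. unfold Rdiv. rewrite Rmult_assoc, Rinv_l; lra.
Qed.

Lemma half_index_bounds (n i : nat) : (i < n)%nat -> 0 < (INR i + / 2) / INR n < 1.
Proof.
intros Hi. apply ratio_in_01. pose proof (pos_INR i).
assert (INR (S i) <= INR n) by (apply le_INR; lia). rewrite S_INR in *. lra.
Qed.

(** For th = PI (i + 1/2)/n one has (2n-1) th = (2i+1) PI - th, so the two cosines of [psum_sin]
    reinforce each other. *)
Lemma cot_sine_sum (n i : nat) : (i < n)%nat ->
  cot (PI * ((INR i + / 2) / INR n))
  = psum (fun l => sin (INR (S l) * (2 * (PI * ((INR i + / 2) / INR n))))) (n - 1).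
Proof.
intros Hi. pose proof (half_index_bounds n i Hi) as Hx.
pose proof (sin_PI_pos _ Hx) as Hs.
assert (Hn : 0 < INR n) by (apply lt_0_INR; lia).
assert (E := psum_sin (PI * ((INR i + / 2) / INR n)) (n - 1)).
rewrite minus_INR in E by lia. simpl (INR 1) in E.
replace ((2 * (INR n - 1) + 1) * (PI * ((INR i + / 2) / INR n)))
  with (PI - PI * ((INR i + / 2) / INR n) + 2 * INR i * PI) in E by (field; lra).
rewrite cos_period in E.
replace (cos (PI - _)) with (- cos (PI * ((INR i + / 2) / INR n))) in E
  by (rewrite cos_minus, cos_PI, sin_PI; ring).
unfold cot. apply Rmult_eq_reg_r with (2 * sin (PI * ((INR i + / 2) / INR n))); [|lra].
rewrite E. field. lra.
Qed.

Lemma psum_odd_abel (C : nat -> R) (n : nat) :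
  psum (fun i => (2 * INR i + 1) * (C i - C (S i))) n
  = 2 * psum C n - C 0%nat - (2 * INR n - 1) * C n.
Proof.
induction n as [|n IH]; [simpl; ring|]. cbn [psum]. rewrite IH, S_INR. ring.
Qed.

(** Times 2 sin p, the sine becomes the decrement [C i - C (S i)] of a cosine of period n, so the
    linear part and the steps both sum by parts. As [C] sums to 0 over a period, only -2 [C nu]
    survives. *)
Lemma weight_fluct_sine (n nu l : nat) : (1 <= nu < n)%nat -> (1 <= l < n)%nat ->
  psum (fun i => weight_fluct n nu i * sin (INR l * (2 * (PI * ((INR i + / 2) / INR n))))) n
  = - (cos (2 * PI * INR nu * INR l / INR n) * csc (PI * INR l / INR n)).
Proof.
intros Hnu Hl.
assert (Hn : 0 < INR n) by (apply lt_0_INR; lia).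
assert (Hlx : 0 < INR l / INR n < 1).
{ apply ratio_in_01. split; [apply lt_0_INR; lia|apply lt_INR; lia]. }
pose proof (sin_PI_pos _ Hlx) as Hs.
set (p := PI * (INR l / INR n)) in *.
set (C := fun i : nat => cos (INR i * (2 * p))).
assert (HC0 : C 0%nat = 1) by (unfold C; simpl (INR 0); rewrite Rmult_0_l; apply cos_0).
assert (HCn : C n = 1).
{ unfold C. replace (INR n * (2 * p)) with (0 + 2 * INR l * PI) by (unfold p; field; lra).
  rewrite cos_period. apply cos_0. }
assert (HCs : psum C n = 0).
{ assert (E := psum_cos p 0 n). rewrite !Rminus_0_r in E.
  replace ((2 * INR n + 1) * p) with (p + 2 * INR l * PI) in E by (unfold p; field; lra).
  rewrite sin_period, Rminus_diag in E.
  assert (E' : psum (fun s => C (S s)) n = 0).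
  { apply Rmult_eq_reg_r with (2 * sin p); [|lra]. rewrite Rmult_0_l, <- E. f_equal.
    apply psum_ext. intros i _. unfold C. now rewrite Rminus_0_r. }
  pose proof (psum_head C n) as E1. cbn [psum] in E1. lra. }
assert (HCnu : C (n - nu)%nat = C nu).
{ unfold C. rewrite minus_INR by lia.
  replace ((INR n - INR nu) * (2 * p)) with (- (INR nu * (2 * p)) + 2 * INR l * PI) by (unfold p; field; lra).
  now rewrite cos_period, cos_neg. }
replace (2 * PI * INR nu * INR l / INR n) with (INR nu * (2 * p)) by (unfold p; field; lra).
replace (PI * INR l / INR n) with p by (unfold p; field; lra).
fold (C nu). unfold csc.
apply Rmult_eq_reg_l with (2 * sin p); [|lra]. rewrite <- psum_scal.
rewrite (psum_ext _ (fun i => / INR n * ((2 * INR i + 1) * (C i - C (S i)))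
   + (unit_step nu i * (C (S i) - C i) + unit_step (n - nu) i * (C (S i) - C i)))).
- rewrite !psum_plus, psum_scal, psum_odd_abel, !psum_step, HCs, HC0, HCn, HCnu by lia.
  field. lra.
- intros i _. unfold weight_fluct, C. rewrite S_INR.
  replace (INR l * (2 * (PI * ((INR i + / 2) / INR n)))) with (INR i * (2 * p) + p)
    by (unfold p; field; lra).
  replace ((INR i + 1) * (2 * p)) with ((INR i * (2 * p) + p) + p) by ring.
  replace (cos (INR i * (2 * p))) with (cos ((INR i * (2 * p) + p) - p)) by (f_equal; ring).
  generalize (INR i * (2 * p) + p). intros t. rewrite cos_plus, cos_minus. field. lra.
Qed.

Lemma weight_fluct_cot (n nu : nat) : (1 <= nu < n)%nat ->
  psum (fun i => weight_fluct n nu i * cot (PI * ((INR i + / 2) / INR n))) n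
  = - psum (fun l => cos (2 * PI * INR nu * INR (S l) / INR n) * csc (PI * INR (S l) / INR n)) (n - 1).
Proof.
intros Hnu.
rewrite (psum_ext _ (fun i => psum (fun l => weight_fluct n nu i *
   sin (INR (S l) * (2 * (PI * ((INR i + / 2) / INR n))))) (n - 1))).
- rewrite psum_swap.
  replace (- _) with ((-1) * psum (fun l => cos (2 * PI * INR nu * INR (S l) / INR n) * csc (PI * INR (S l) / INR n)) (n - 1)) by ring.
  rewrite <- psum_scal. apply psum_ext. intros l Hl.
  rewrite weight_fluct_sine by lia. ring.
- intros i Hi. rewrite cot_sine_sum by exact Hi. now rewrite psum_scal.
Qed.

(** By this antisymmetry 1/(m + 1/2) may be replaced by half the difference of its values at i and
    at n - 1 - i. Summed over the blocks, that difference converges, up to the factor 1/n, to the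
    partial fractions of a cotangent. *)
Lemma weight_fluct_rev (n nu i : nat) : (1 <= nu < n)%nat -> (i < n)%nat ->
  weight_fluct n nu (n - 1 - i) = - weight_fluct n nu i.
Proof.
intros Hnu Hi. assert (Hn : 0 < INR n) by (apply lt_0_INR; lia).
assert (E : forall a, (1 <= a < n)%nat -> unit_step a (n - 1 - i) = 1 - unit_step (n - a) i).
{ intros a Ha. unfold unit_step.
  destruct (Nat.leb_spec a (n - 1 - i)); destruct (Nat.leb_spec (n - a) i); try lia; ring. }
unfold weight_fluct. rewrite !E by lia. replace (n - (n - nu))%nat with nu by lia.
replace (n - 1 - i)%nat with (n - S i)%nat by lia. rewrite minus_INR, S_INR by lia. field. lra.
Qed.

Lemma cot_series (x : R) : 0 < x < 1 ->
  is_lim_seq (psum (fun k => / (x + INR k) - / (1 - x + INR k))) (PI * cot (PI * x)).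
Proof.
intros Hx. apply is_lim_seq_incr_1. rewrite <- digamma_reflection by exact Hx.
eapply is_lim_seq_ext; [|exact (is_lim_seq_minus' _ _ _ _
  (proj2 (lnGamma_derivatives 1 (1 - x) ltac:(lra))) (proj2 (lnGamma_derivatives 1 x Hx)))].
intros K. cbv beta. cbn [euler_approx]. rewrite psum_minus. ring.
Qed.

Lemma weight_fluct_lim (n nu : nat) : (1 <= nu < n)%nat ->
  is_lim_seq (fun K => psum (fun k => psum (fun i => weight_fluct n nu i * / (INR (k * n + i) + / 2)) n) K)
    (- (PI / (2 * INR n)) * psum (fun l => cos (2 * PI * INR nu * INR (S l) / INR n)
                                            * csc (PI * INR (S l) / INR n)) (n - 1)).
Proof.
intros Hnu. assert (Hn : 0 < INR n) by (apply lt_0_INR; lia).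
set (h := fun K i : nat => psum (fun k => / (INR (k * n + i) + / 2)) K).
assert (L : is_lim_seq (fun K => psum (fun i => weight_fluct n nu i * (/ (2 * INR n) *
    psum (fun k => / ((INR i + / 2) / INR n + INR k) - / (1 - (INR i + / 2) / INR n + INR k)) K)) n)
    (psum (fun i => weight_fluct n nu i * (/ (2 * INR n) * (PI * cot (PI * ((INR i + / 2) / INR n))))) n)).
{ apply (is_lim_seq_psum (fun i K => weight_fluct n nu i * (/ (2 * INR n) *
    psum (fun k => / ((INR i + / 2) / INR n + INR k) - / (1 - (INR i + / 2) / INR n + INR k)) K))).
  intros i Hi. apply (is_lim_seq_scal_l _ _ (Finite _)), (is_lim_seq_scal_l _ _ (Finite _)).
  apply cot_series, half_index_bounds, Hi. }
replace (- (PI / (2 * INR n)) * psum _ _) with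
  (psum (fun i => weight_fluct n nu i * (/ (2 * INR n) * (PI * cot (PI * ((INR i + / 2) / INR n))))) n).
- eapply is_lim_seq_ext; [|exact L]. intros K. cbv beta.
  rewrite psum_swap.
  rewrite (psum_ext (fun j => psum (fun i => weight_fluct n nu j * / (INR (i * n + j) + / 2)) K)
             (fun i => weight_fluct n nu i * h K i)) by (intros; unfold h; now rewrite psum_scal).
  assert (R1 : psum (fun i => weight_fluct n nu i * h K (n - 1 - i)%nat) n
               = - psum (fun i => weight_fluct n nu i * h K i) n).
  { rewrite <- (psum_rev (fun i => weight_fluct n nu i * h K i)).
    replace (- psum _ n) with ((-1) * psum (fun i => weight_fluct n nu (n - 1 - i) * h K (n - 1 - i)%nat) n) by ring.
    rewrite <- psum_scal. apply psum_ext. intros i Hi. rewrite weight_fluct_rev by auto. ring. }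
  rewrite (psum_ext _ (fun i => / 2 * (weight_fluct n nu i * h K i - weight_fluct n nu i * h K (n - 1 - i)%nat))).
  + rewrite psum_scal, psum_minus, R1. field.
  + intros i Hi. rewrite <- Rmult_minus_distr_l. unfold h. rewrite <- psum_minus.
    replace (/ (2 * INR n)) with (/ 2 * / INR n) by (field; lra).
    rewrite (Rmult_assoc (/ 2)), <- psum_scal.
    rewrite (psum_ext _ (fun k => / (INR (k * n + i) + / 2) - / (INR (k * n + (n - 1 - i)) + / 2))); [ring|].
    intros k _. rewrite !plus_INR, mult_INR. replace (n - 1 - i)%nat with (n - S i)%nat by lia.
    rewrite minus_INR, S_INR by lia.
    pose proof (pos_INR k). pose proof (pos_INR i).
    assert (INR (S i) <= INR n) by (apply le_INR; lia). rewrite S_INR in *.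
    assert (0 <= INR k * INR n) by (apply Rmult_le_pos; lra).
    field. repeat split; lra.
- rewrite (psum_ext _ (fun i => PI / (2 * INR n) * (weight_fluct n nu i * cot (PI * ((INR i + / 2) / INR n)))))
    by (intros; field; lra).
  rewrite psum_scal, weight_fluct_cot by exact Hnu. ring.
Qed.

(** * Limits of the weighted sums and the remainder *)

Definition lattice_sum (n nu r K : nat) : R :=
  2 * INR K * inv_power_fun r (INR (K * n))
  - psum (fun k => inv_power_fun r (INR (k * n + nu)) + inv_power_fun r (INR (k * n + (n - nu)))) K.

(** Dividing every argument by n costs ln n per logarithm, 2K times with each sign; what remains is
    [log_product_asymptotics]. *)
Lemma lattice_sum_log_lim (n nu : nat) : (1 <= nu < n)%nat ->
  is_lim_seq (fun K => 2 * INR K - lattice_sum n nu 0 K) (ln (2 * sin (PI * (INR nu / INR n)))).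
Proof.
intros Hnu. assert (Hn : 0 < INR n) by (apply lt_0_INR; lia).
assert (Hx : 0 < INR nu / INR n < 1).
{ apply ratio_in_01. split; [apply lt_0_INR; lia|apply lt_INR; lia]. }
eapply is_lim_seq_ext; [|exact (log_product_asymptotics _ Hx)].
intros K. cbv beta. unfold lattice_sum. cbn [inv_power_fun].
rewrite (psum_ext (fun k => ln (INR (k * n + nu)) + ln (INR (k * n + (n - nu))))
  (fun k => (ln (INR nu / INR n + INR k) + ln (1 - INR nu / INR n + INR k)) + 2 * ln (INR n))).
- rewrite (psum_plus _ (fun _ => 2 * ln (INR n))), psum_const. destruct K as [|K]; [simpl; ring|].
  rewrite mult_INR, ln_mult by (try apply lt_0_INR; lia || lra). ring.
- intros k _. pose proof (pos_INR k).
  replace (INR (k * n + nu)) with ((INR nu / INR n + INR k) * INR n)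
    by (rewrite plus_INR, mult_INR; field; lra).
  replace (INR (k * n + (n - nu))) with ((1 - INR nu / INR n + INR k) * INR n)
    by (rewrite plus_INR, mult_INR, minus_INR by lia; field; lra).
  rewrite !ln_mult by lra. ring.
Qed.

(** The boundary term is of order K^(1-2r) and disappears; the rest is [scrH_lim] rescaled by n. *)
Lemma lattice_sum_power_lim (n nu r : nat) : (1 <= nu < n)%nat -> (1 <= r)%nat ->
  is_lim_seq (lattice_sum n nu r)
    (- (PI ^ (2 * r) / INR n ^ (2 * r) * scrH (2 * r - 1) (INR nu / INR n))).
Proof.
intros Hnu Hr. assert (Hn : 0 < INR n) by (apply lt_0_INR; lia).
assert (Hx : 0 < INR nu / INR n < 1).
{ apply ratio_in_01. split; [apply lt_0_INR; lia|apply lt_INR; lia]. }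
assert (L := scrH_lim r _ Hr Hx).
set (c := INR (fact (2 * r - 1)) / INR n ^ (2 * r)).
assert (Hc : 0 < c) by (apply Rdiv_lt_0_compat; [apply INR_fact_lt_0|apply pow_lt, Hn]).
assert (L0 : is_lim_seq (fun K => 2 * INR (S K) * inv_power_fun r (INR (S K * n))) 0).
{ apply is_lim_seq_squeeze0 with (v := fun K => 2 * c * / INR (S K)).
  - intros K. assert (HK : 1 <= INR (S K)) by (apply (le_INR 1); lia).
    destruct r as [|r]; [lia|]. cbn [inv_power_fun]. rewrite mult_INR, Rpow_mult_distr.
    set (t := INR (S K)) in *.
    replace (2 * t * _ - 0) with (- (2 * c * / t ^ (2 * S r - 1))).
    + rewrite Rabs_Ropp, Rabs_pos_eq.
      * apply Rmult_le_compat_l; [lra|]. apply Rinv_le_contravar; [lra|].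
        rewrite <- (pow_1 t) at 1. apply Rle_pow; [lra|lia].
      * apply Rmult_le_pos; [lra|]. apply Rlt_le, inv_pow_pos; lra.
    + unfold c. replace (t ^ (2 * S r)) with (t * t ^ (2 * S r - 1))
        by (rewrite tech_pow_Rmult; f_equal; lia).
      field. repeat split; try apply pow_nonzero; lra.
  - replace (Finite 0) with (Rbar_mult (2 * c) 0) by (simpl; f_equal; ring).
    apply is_lim_seq_scal_l, is_lim_seq_inv_INR_S. }
apply is_lim_seq_incr_1. apply is_lim_seq_incr_1 in L.
replace (- (PI ^ (2 * r) / INR n ^ (2 * r) * scrH (2 * r - 1) (INR nu / INR n))) with
  (0 + c * (- (PI ^ (2 * r) / INR (fact (2 * r - 1))) * scrH (2 * r - 1) (INR nu / INR n))).
- eapply is_lim_seq_ext; [|exact (is_lim_seq_plus' _ _ _ _ L0 (is_lim_seq_scal_l _ c _ L))].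
  intros K. cbv beta. unfold lattice_sum. rewrite <- psum_scal.
  rewrite (psum_ext (fun i => c * _) (fun k => (-1) * (inv_power_fun r (INR (k * n + nu)) +
       inv_power_fun r (INR (k * n + (n - nu)))))); [rewrite psum_scal; ring|].
  intros k _. pose proof (pos_INR k).
  replace (INR (k * n + nu)) with ((INR nu / INR n + INR k) * INR n)
    by (rewrite plus_INR, mult_INR; field; lra).
  replace (INR (k * n + (n - nu))) with ((1 - INR nu / INR n + INR k) * INR n)
    by (rewrite plus_INR, mult_INR, minus_INR by lia; field; lra).
  destruct r as [|r]; [lia|]. cbn [inv_power_fun]. rewrite !Rpow_mult_distr. unfold c.
  set (a := INR nu / INR n) in *.
  field. repeat split; try apply pow_nonzero; lra.
- unfold c. field. split; [apply pow_nonzero; lra|apply INR_fact_neq_0].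
Qed.

(** PI/(2n) times the error of the expansion truncated to r < N. *)
Definition scaled_remainder (B : nat -> R -> R) (n nu N : nat) : R :=
  PI / (2 * INR n) * psum (fun l => cos (2 * PI * INR nu * INR (S l) / INR n)
                                    * csc (PI * INR (S l) / INR n)) (n - 1)
  + ln (2 * sin (PI * (INR nu / INR n)))
  + psum (fun r => bernoulli_coef B (/ 2) (S r) * (PI ^ (2 * S r) / INR n ^ (2 * S r)
                   * scrH (2 * S r - 1) (INR nu / INR n))) (N - 1).

Lemma scaled_remainder_lim (B : nat -> R -> R) (n nu N : nat) : bernoulli_polynomials B ->
  (1 <= nu < n)%nat -> (1 <= N)%nat ->
  is_lim_seq (psum (fun k => psum (fun i => weight n nu k i * midpoint_defect B N (INR (k * n + i))) n))
    (scaled_remainder B n nu N).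
Proof.
intros HB Hnu HN. assert (Hn : 0 < INR n) by (apply lt_0_INR; lia).
assert (L1 := weight_fluct_lim n nu Hnu).
assert (L2 := lattice_sum_log_lim n nu Hnu).
assert (L3 := is_lim_seq_psum (fun r K => bernoulli_coef B (/ 2) (S r) * lattice_sum n nu (S r) K)
  (fun r => bernoulli_coef B (/ 2) (S r) * (- (PI ^ (2 * S r) / INR n ^ (2 * S r)
                   * scrH (2 * S r - 1) (INR nu / INR n)))) (N - 1)).
assert (L3' := L3 ltac:(intros r _; apply (is_lim_seq_scal_l _ _ (Finite _)), lattice_sum_power_lim; [exact Hnu|lia])).
clear L3.
assert (L := is_lim_seq_minus' _ _ _ _ (is_lim_seq_minus' _ _ _ _ L2 L1) L3').
match type of L with is_lim_seq _ (Finite ?l) => replace (scaled_remainder B n nu N) with l end.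
- eapply is_lim_seq_ext; [|exact L]. intros K. cbv beta. destruct N as [|N]; [lia|].
  replace (S N - 1)%nat with N by lia.
  rewrite (psum_ext (fun k => psum (fun i => weight n nu k i * midpoint_defect B (S N) (INR (k * n + i))) n)
   (fun k => (2 - psum (fun i => weight_fluct n nu i * / (INR (k * n + i) + / 2)) n)
     - psum (fun r => bernoulli_coef B (/ 2) r * psum (fun i => weight n nu k i *
          (inv_power_fun r (INR (k * n + S i)) - inv_power_fun r (INR (k * n + i)))) n) (S N))).
  + set (F := fun k => psum (fun i => weight_fluct n nu i * / (INR (k * n + i) + / 2)) n).
    set (G := fun r k => psum (fun i => weight n nu k i *
          (inv_power_fun r (INR (k * n + S i)) - inv_power_fun r (INR (k * n + i)))) n).
    assert (HG : forall r, psum (G r) K = lattice_sum n nu r K).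
    { intros r. apply (weight_abel (fun m => inv_power_fun r (INR m))). lia. }
    change (2 * INR K - lattice_sum n nu 0 K - psum F K
      - psum (fun r => bernoulli_coef B (/ 2) (S r) * lattice_sum n nu (S r) K) N
      = psum (fun k => 2 - F k - psum (fun r => bernoulli_coef B (/ 2) r * G r k) (S N)) K).
    rewrite (psum_minus (fun k => 2 - F k)), (psum_minus (fun _ => 2)), psum_const.
    rewrite (psum_swap (fun k r => bernoulli_coef B (/ 2) r * G r k)), psum_head.
    rewrite psum_scal, HG, bernoulli_coef_0 by exact HB.
    rewrite (psum_ext (fun i => psum (fun k => bernoulli_coef B (/ 2) (S i) * G (S i) k) K)
      (fun r => bernoulli_coef B (/ 2) (S r) * lattice_sum n nu (S r) K)); [ring|].
    intros r _. now rewrite psum_scal, HG.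
  + intros k _.
    (* Since (2m+1)/n times 1/(m + 1/2) is 2/n, a block of n points contributes 2 besides its
       fluctuation; this balances the growth of the logarithmic sum. *)
    replace 2 with (psum (fun i => 2 * / INR n) n) at 1 by (rewrite psum_const; field; lra).
    rewrite <- psum_minus.
    rewrite (psum_ext (fun r => bernoulli_coef B (/ 2) r * _) (fun r => psum (fun i =>
       bernoulli_coef B (/ 2) r * (weight n nu k i *
          (inv_power_fun r (INR (k * n + S i)) - inv_power_fun r (INR (k * n + i))))) n))
      by (intros; now rewrite psum_scal).
    rewrite (psum_swap _ (S N)), <- psum_minus. apply psum_ext. intros i _.
    unfold midpoint_defect. rewrite Rmult_minus_distr_l, <- psum_scal. f_equal.
    * unfold weight, weight_fluct. rewrite plus_INR, mult_INR.
      pose proof (pos_INR k). pose proof (pos_INR i).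
      assert (0 <= INR k * INR n) by (apply Rmult_le_pos; lra). field. lra.
    * apply psum_ext. intros r _. rewrite Nat.add_succ_r, S_INR. ring.
- unfold scaled_remainder.
  rewrite (psum_ext (fun r => bernoulli_coef B (/ 2) (S r) * - _) (fun r => (-1) *
     (bernoulli_coef B (/ 2) (S r) * (PI ^ (2 * S r) / INR n ^ (2 * S r)
                   * scrH (2 * S r - 1) (INR nu / INR n))))) by (intros; ring).
  rewrite psum_scal. ring.
Qed.

Lemma scaled_remainder_sign (B : nat -> R -> R) (n nu N : nat) : bernoulli_polynomials B ->
  (1 <= nu < n)%nat -> (1 <= N)%nat -> 0 < (-1) ^ N * scaled_remainder B n nu N.
Proof.
intros HB Hnu HN.
assert (L := is_lim_seq_scal_l _ ((-1) ^ N) _ (scaled_remainder_lim B n nu N HB Hnu HN)).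
set (f := fun k i => (-1) ^ N * (weight n nu k i * midpoint_defect B N (INR (k * n + i)))).
assert (Hf : forall k i, 0 <= f k i).
{ intros k i. unfold f. destruct (Nat.eq_dec (k * n + i) 0) as [h|h].
  - assert (k = 0 /\ i = 0)%nat as [-> ->] by nia.
    unfold weight, unit_step. replace (nu <=? 0)%nat with false by (symmetry; apply Nat.leb_gt; lia).
    replace (n - nu <=? 0)%nat with false by (symmetry; apply Nat.leb_gt; lia).
    simpl (INR 0). right; ring.
  - pose proof (midpoint_defect_sign B N (INR (k * n + i)) HB HN ltac:(apply lt_0_INR; lia)) as H.
    assert (0 <= weight n nu k i).
    { unfold weight. pose proof (pos_INR k). pose proof (step_pos nu i).
      pose proof (step_pos (n - nu) i). lra. }
    replace (_ * _) with (weight n nu k i * ((-1) ^ N * midpoint_defect B N (INR (k * n + i)))) by ring.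
    apply Rmult_le_pos; lra. }
apply Rlt_le_trans with (psum (f 0%nat) n).
(* Strictness comes from the single point m = n - 1, whose weight is 2. *)
- apply Rlt_le_trans with (f 0%nat (n - 1)%nat); [|apply psum_ge_term; [auto|lia]].
  unfold f, weight, unit_step.
  replace (nu <=? n - 1)%nat with true by (symmetry; apply Nat.leb_le; lia).
  replace (n - nu <=? n - 1)%nat with true by (symmetry; apply Nat.leb_le; lia).
  pose proof (midpoint_defect_sign B N (INR (0 * n + (n - 1))) HB HN ltac:(apply lt_0_INR; lia)) as H.
  simpl (INR 0). lra.
- apply (psum_lower_bound_lim (fun k => psum (f k) n)).
  + intros k. apply psum_nonneg. auto.
  + eapply is_lim_seq_ext; [|exact L]. intros K. cbv beta. rewrite <- psum_scal.
    apply psum_ext. intros k _. unfold f. now rewrite psum_scal.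
Qed.

Theorem theorem4 (B : nat -> R -> R) (hB : bernoulli_polynomials B)
    (n N nu : nat) (hn : (2 <= n)%nat) (hN : (2 <= N)%nat)
    (hnu : (1 <= nu <= n - 1)%nat) :
  (exists lambda : R, 0 < lambda < 1 /\
    sum_n_m (fun l => cos (2 * PI * INR nu * INR l / INR n) * csc (PI * INR l / INR n))
            1 (n - 1)
    = - (2 * INR n / PI) * ln (2 * sin (PI * INR nu / INR n))
      + 2 * sum_n_m (fun r => (1 - / 2 ^ (2 * r - 1)) * PI ^ (2 * r - 1) * B (2 * r)%nat 0
                              / (INR (fact (2 * r)) * INR n ^ (2 * r - 1))
                              * scrH (2 * r - 1) (INR nu / INR n))
                    1 (N - 1)
      + 2 * lambda * ((1 - / 2 ^ (2 * N - 1)) * PI ^ (2 * N - 1) * B (2 * N)%nat 0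
                      / (INR (fact (2 * N)) * INR n ^ (2 * N - 1)))
        * scrH (2 * N - 1) (INR nu / INR n))
  /\
  (forall r : nat, (1 <= r)%nat ->
    scrH (2 * r - 1) (INR nu / INR n)
      = - (1 / PI ^ (2 * r))
        * (polygamma (2 * r - 1) (INR nu / INR n)
           + polygamma (2 * r - 1) (1 - INR nu / INR n))
    /\
    scrH (2 * r - 1) (INR nu / INR n)
      = (-1) ^ r * ((2 * INR n) ^ (2 * r - 1) / INR r)
        * sum_n_m (fun s => B (2 * r)%nat (INR s / INR n)
                            * cos (2 * PI * INR s * INR nu / INR n))
                  1 n
    /\
    scrH (2 * r - 1) (INR nu / INR n) < 0).
Proof.
assert (Hnu : (1 <= nu < n)%nat) by lia.
assert (Hn : 0 < INR n) by (apply lt_0_INR; lia).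
assert (Hx : 0 < INR nu / INR n < 1).
{ apply ratio_in_01. split; [apply lt_0_INR; lia|apply lt_INR; lia]. }
pose proof PI_RGT_0 as HPI.
split.
- set (T := fun r => (1 - / 2 ^ (2 * r - 1)) * PI ^ (2 * r - 1) * B (2 * r)%nat 0
                              / (INR (fact (2 * r)) * INR n ^ (2 * r - 1))
                              * scrH (2 * r - 1) (INR nu / INR n)).
  assert (HT : forall r, (1 <= r)%nat ->
    bernoulli_coef B (/ 2) r * (PI ^ (2 * r) / INR n ^ (2 * r) * scrH (2 * r - 1) (INR nu / INR n))
    = - (PI / INR n) * T r).
  { intros r Hr. rewrite bernoulli_coef_half by auto. unfold T, bernoulli_coef.
    replace (PI ^ (2 * r)) with (PI * PI ^ (2 * r - 1)) by (rewrite tech_pow_Rmult; f_equal; lia).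
    replace (INR n ^ (2 * r)) with (INR n * INR n ^ (2 * r - 1)) by (rewrite tech_pow_Rmult; f_equal; lia).
    field. repeat split; try apply pow_nonzero; try apply INR_fact_neq_0; lra. }
  pose proof (scaled_remainder_sign B n nu N hB Hnu ltac:(lia)) as P.
  pose proof (scaled_remainder_sign B n nu (S N) hB Hnu ltac:(lia)) as P'.
  assert (E : scaled_remainder B n nu (S N) = scaled_remainder B n nu N - PI / INR n * T N).
  { unfold scaled_remainder. replace (S N - 1)%nat with (S (N - 1)) by lia. cbn [psum].
    replace (S (N - 1)) with N by lia. rewrite HT by lia. ring. }
  (* Consecutive remainders differ by the N-th term, so [a + b] is that term up to scale. As [a] and
     [b] both have the sign (-1)^N, the witness a/(a+b) lies strictly between 0 and 1. *)
  set (b := - scaled_remainder B n nu (S N)) in *.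
  set (a := scaled_remainder B n nu N) in *.
  assert (P2 : 0 < (-1) ^ N * b) by (unfold b; simpl pow in P'; lra).
  assert (Hab : a + b = PI / INR n * T N) by (unfold b; rewrite E; ring).
  assert (P3 : 0 < (-1) ^ N * (a + b)) by lra.
  assert (Hne : a + b <> 0) by (intros h; rewrite h in P3; lra).
  exists (a / (a + b)). split.
  + replace (a / (a + b)) with ((-1) ^ N * a / ((-1) ^ N * (a + b))).
    * apply ratio_in_01. lra.
    * field. split; [exact Hne|]. apply pow_nonzero; lra.
  + rewrite !psum_sum_n_m.
    change (psum _ (N - 1)) with (psum (fun r => T (S r)) (N - 1)).
    rewrite (Rmult_assoc (2 * (a / (a + b)))). fold (T N).
    replace (T N) with (INR n / PI * (a + b)) by (rewrite Hab; field; lra).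
    replace (PI * INR nu / INR n) with (PI * (INR nu / INR n)) by (field; lra).
    replace (2 * (a / (a + b)) * (INR n / PI * (a + b))) with (2 * INR n / PI * a) by (field; lra).
    unfold a, scaled_remainder.
    rewrite (psum_ext (fun r => bernoulli_coef B (/ 2) (S r) * _) (fun r => - (PI / INR n) * T (S r)))
      by (intros; apply HT; lia).
    rewrite psum_scal. match goal with |- ?x = ?y => change (@eq R x y) end. field. lra.
- intros r Hr. rewrite psum_sum_n_m. repeat split.
  + now apply scrH_polygamma.
  + now apply scrH_bernoulli.
  + now apply scrH_neg.
Qed.
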